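(* Let $f,g\in L^\infty$. Then $S_{f,g}$ is quasinormal if and only if one of the following statements holds. (1) $|f|$ and $|g|$ are constants, and $f,\bar g\in H^\infty$; (2) $|f|=|g|$ is constant, and $f\bar g\in H^\infty$; (3) $f-g$ and $f|g|^2-g|f|^2$ are constants, and $(|f|^2)_-=(|g|^2)_-=(f\bar g)_-$; (4) $\begin{bmatrix} V(f)_-\\ (\bar g)_-\end{bmatrix}\ne0$, $\begin{bmatrix} V(|f|^2-f\bar g)_-\\ (f\bar g-|g|^2)_-\end{bmatrix}\ne0$, and one of the following statements holds. (a) There are constants $\mu$ and $\alpha\ (\ne0)$ such that $f-\mu g$ is constant, and $|f|^2-f\bar g-\bar\alpha\bar g$, $|g|^2-f\bar g+\alpha g$, $f(\mu\bar f-\bar g-\alpha)$, $\bar g(\bar\mu f-g-\bar\alpha)$, $fg(\mu\bar f-\bar g-\alpha)$, $\bar g^2(\bar\mu f-g-\bar\alpha)\in H^\infty$; (b) There are constants $\mu$ and $\alpha\ (\ne0)$ such that $g-\mu f$ is constant, and $|f|^2-f\bar g-\bar\alpha\bar f$, $|g|^2-f\bar g+\alpha f$, $f(\bar f-\mu\bar g-\alpha)$, $\bar g(f-\bar\mu g-\bar\alpha)$, $\bar f\bar g(f-\bar\mu g-\bar\alpha)$, $f^2(\bar f-\mu\bar g-\alpha)\in H^\infty$; (c) There are constants $\mu$ and $\alpha\ (\ne0)$ such that $f(\bar f-\bar\mu\bar g)$, $\bar g(f-\mu g)$, $|f|^2-f\bar g-\bar\alpha(\mu\bar f-\bar g)$,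 $f\bar g-|g|^2-\alpha(\bar\mu f-g)$, $f\bar g-\alpha f$, $|g|^2-\bar\alpha\bar g$, $\bar g(|f|^2-|g|^2-\bar\alpha\mu\bar f+\bar\alpha\bar g)$, $f(|f|^2-|g|^2-\alpha\bar\mu f+\alpha g)\in H^\infty$; (d) There are constants $\mu$ and $\alpha\ (\ne0)$ such that $f(\bar g-\bar\mu\bar f)$, $\bar g(g-\mu f)$, $|f|^2-f\bar g-\bar\alpha(\bar f-\mu\bar g)$, $f\bar g-|g|^2-\alpha(f-\bar\mu g)$, $f\bar g-\bar\alpha\bar g$, $|f|^2-\alpha f$, $\bar g(|f|^2-|g|^2+\bar\alpha\mu\bar g-\bar\alpha\bar f)$, $f(|f|^2-|g|^2+\alpha\bar\mu g-\alpha f)\in H^\infty$.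
   Context: $L^2$ and $L^\infty$ are the Lebesgue spaces of the unit circle $\mathbb T$ with normalized Lebesgue measure. $H^2\subset L^2$ is the Hardy space, $P_+$ is the orthogonal projection of $L^2$ onto $H^2$, $P_-=I-P_+$, and $H^\infty=L^\infty\cap H^2$. A bar denotes complex conjugation. For $x\in L^2$, $x_-=P_-x$. $V$ is the anti-unitary operator on $L^2$ given by $Vx=\bar z\bar x$; $V(x)_-$ means $V(P_-x)$. Columns $\begin{bmatrix} x\\ y\end{bmatrix}$ with $x,y\in L^2$ are vectors of $L^2\oplus L^2$. For $f,g\in L^\infty$ the singular integral operator $S_{f,g}$ on $L^2$ is $S_{f,g}x=fP_+x+gP_-x$. A bounded operator $T$ is quasinormal if $T$ commutes with $T^*T$. *)

(* Defs.v *)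
From HB Require Import structures.
From mathcomp Require Import all_boot all_order all_algebra.
From mathcomp Require Import complex.
From mathcomp Require Import all_classical all_reals all_analysis.

Set Implicit Arguments.
Unset Strict Implicit.
Unset Printing Implicit Defensive.

Import Order.TTheory GRing.Theory Num.Theory.
Local Open Scope classical_set_scope.
Local Open Scope ring_scope.

(* The unit circle is parametrized by t |-> exp (2 i pi t), t in [0, 1], which
   carries Lebesgue measure on [0, 1] to normalized arc length.  A function on
   the circle is represented by a function R -> R[i] of the parameter t; its
   values outside [0, 1] are irrelevant (apart from its being measurable), since
   the measure below vanishes there.
   Elements of L^2 and L^oo are represented by functions, and equality in these
   spaces is equality almost everywhere. *)

Lemma measurable_itv01 (R : realType) :
  measurable ([set` `[0%R, 1%R]] : set (measurableTypeR R)).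
Proof. exact: measurable_itv. Qed.

Lemma lebesgue_itv01_lty (R : realType) :
  (@lebesgue_measure R [set` `[0%R, 1%R]] < +oo)%E.
Proof. by rewrite lebesgue_measure_itv /= lte01 oppr0 addr0 ltry. Qed.

Definition circle (R : realType) :
    {finite_measure set (measurableTypeR R) -> \bar R} :=
  mfrestr (@measurable_itv01 R) (lebesgue_itv01_lty R).

Definition zfun {R : realType} (t : R) : R[i] :=
  Complex (cos (2 * pi * t)) (sin (2 * pi * t)).

Definition Cint {R : realType} (x : R -> R[i]) : R[i] :=
  Complex (\int[circle R]_t complex.Re (x t)) (\int[circle R]_t complex.Im (x t)).

Definition inner {R : realType} (x y : R -> R[i]) : R[i] :=
  Cint (fun t => x t * (y t)^*).

Definition norm2 {R : realType} (x : R -> R[i]) : R :=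
  Num.sqrt (complex.Re (inner x x)).

Definition L2 {R : realType} : set (R -> R[i]) :=
  [set x | (fun t => complex.Re (x t)) \in Lfun (circle R) 2%:E /\
           (fun t => complex.Im (x t)) \in Lfun (circle R) 2%:E].

Definition Linfty {R : realType} : set (R -> R[i]) :=
  [set x | (fun t => complex.Re (x t)) \in Lfun (circle R) +oo%E /\
           (fun t => complex.Im (x t)) \in Lfun (circle R) +oo%E].

Definition fourier {R : realType} (x : R -> R[i]) (n : int) : R[i] :=
  inner x (fun t => zfun t ^ n).

Definition H2 {R : realType} : set (R -> R[i]) :=
  [set x | L2 x /\ forall n : int, n < 0 -> fourier x n = 0].

Definition Hinfty {R : realType} : set (R -> R[i]) := Linfty `&` H2.

(* A representative of the orthogonal projection onto H^2; it is determined up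
   to almost everywhere equality.  The default value 0 plays no
   role for x in L^2, where the projection exists. *)
Definition Pplus {R : realType} (x : R -> R[i]) : R -> R[i] :=
  xget (fun=> 0)
    [set y | H2 y /\ forall h, H2 h -> inner (fun t => x t - y t) h = 0].

Definition Pminus {R : realType} (x : R -> R[i]) : R -> R[i] :=
  fun t => x t - Pplus x t.

Definition Vop {R : realType} (x : R -> R[i]) : R -> R[i] :=
  fun t => (zfun t)^* * (x t)^*.

Definition singint {R : realType} (f g x : R -> R[i]) : R -> R[i] :=
  fun t => f t * Pplus x t + g t * Pminus x t.

Definition is_const {R : realType} (x : R -> R[i]) : Prop :=
  exists c : R[i], x = (fun=> c) %[ae circle R].

(* Linearity is up to almost everywhere equality; with the norm bound it implies
   that T respects almost everywhere equality. *)
Definition bounded_operator {R : realType}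
    (T : (R -> R[i]) -> (R -> R[i])) : Prop :=
  [/\ forall x, L2 x -> L2 (T x),
      forall (a : R[i]) x y, L2 x -> L2 y ->
        T (fun t => a * x t + y t) = (fun t => a * T x t + T y t)
          %[ae circle R] &
      exists M : R, forall x, L2 x -> norm2 (T x) <= M * norm2 x].

Definition is_adjoint {R : realType}
    (T A : (R -> R[i]) -> (R -> R[i])) : Prop :=
  (forall y, L2 y -> L2 (A y)) /\
  forall x y, L2 x -> L2 y -> inner (T x) y = inner x (A y).

Definition quasinormal {R : realType}
    (T : (R -> R[i]) -> (R -> R[i])) : Prop :=
  bounded_operator T /\
  exists2 A, is_adjoint T A &
    forall x, L2 x -> T (A (T x)) = A (T (T x)) %[ae circle R].

(* Main.v *)
Require Import Defs.
From HB Require Import structures.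
From mathcomp Require Import all_boot all_order all_algebra.
From mathcomp Require Import complex.
From mathcomp Require Import all_classical all_reals all_analysis.
From mathcomp Require Import measurable_realfun ess_sup_inf.
From mathcomp Require Import zify ring lra.

Set Implicit Arguments.
Unset Strict Implicit.
Unset Printing Implicit Defensive.

Import Order.TTheory GRing.Theory Num.Theory.
Import numFieldNormedType.Exports.
Local Open Scope classical_set_scope.
Local Open Scope ring_scope.

(** Write S for the singular integral operator, T for its adjoint, h = f - g,
and P, Q = I - P for the Hardy projection and its complement.  Both functions
are bounded, so S is bounded with T y = P (f^* y) + Q (g^* y), and S is
quasinormal exactly when the form
  qdefect y v = <T S y, T v> - <S S y, S v>
vanishes on L^2 (quasinormalP).

The form is tested against the bilateral shift.  Since P (z x) differs from
z P x by a constant, S (z x) = z S x + <x, z^-1> h and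
T (z x) = z T x + <x, z^-1 h>.  Hence, for y orthogonal to the constants,
passing from (y, v) to (z^-1 y, z^-1 v) changes qdefect by an explicit form
shift_defect y v of finite rank (qdefect_shift).  Along z^n x with n tending to
plus or minus infinity, S looks like multiplication by f or by g, which is a
normal operator, so qdefect (z^n y) (z^n v) tends to 0 (qdefect_zn_pos and
qdefect_zn_neg).  Together, qdefect is zero if and only if shift_defect y v is
zero for all y orthogonal to 1 (qdefect0P).

The remaining problem is algebraic.  For y orthogonal to 1 the form reads
  <S y, f> <f, v> - <S y, g> <g, v> - <S y, 1> <T h, v> - (...) <1, v>,
and its vanishing compares coefficients of the vectors f, g, T h and 1.  The
Hardy space enters through a single fact: <S y, b> = 0 for all such y if and
only if T b is constant, if and only if f b^* and g^* b belong to H^2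
(sing_perp_H2, from singadj_constP).  If T 1 is constant, f and g^* are in H^2
and the comparison forces constant moduli.  If T h is constant, either T f and
T g are constant, or f - g is.  If neither is constant, some y has
<S y, 1> <> 0, so T h is a combination w of f and g up to a constant, and in
that normal form (shift_defect_normal) the coefficient of <1, v> is
- <S y, |f|^2 - |g|^2 - w^*>.  Then either f, g, 1 are linearly dependent, which
leaves the vectors g and 1, or f and 1, to compare; or they are independent and
T f, T g are both multiples of T 1 up to constants.  These are the four
subcases with mu and alpha (invariant_case4).  Each alternative conversely makes
shift_defect vanish by the same formulas.

The facts about L^2 that this uses are the projection theorem, obtained from
completeness (sqint_complete, projection), and the uniqueness of Fourier
coefficients (Fourier_uniqueness). *)

(** * Square-integrable and bounded real functions on the circle *)

Notation "x =ae y" := (ae_eq (circle _) setT x y) (at level 70).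

Section RealFunctions.
Context {R : realType}.
Notation mu := (circle R).
Implicit Types u v b : R -> R.

Lemma circle_setT : mu setT = 1%E.
Proof.
by rewrite /= /mfrestr /mrestr setTI lebesgue_measure_itv /= lte01 oppr0 adde0.
Qed.

Lemma aeS (P Q : R -> Prop) : (forall t, P t -> Q t) ->
  (\forall t \ae mu, P t) -> (\forall t \ae mu, Q t).
Proof. exact: (@filterS _ _ (ae_filter_ringOfSetsType mu)). Qed.

Lemma aeS2 (P Q S : R -> Prop) : (forall t, P t -> Q t -> S t) ->
  (\forall t \ae mu, P t) -> (\forall t \ae mu, Q t) -> (\forall t \ae mu, S t).
Proof. by move=> h hP hQ; exact: (@filterS2 _ _ (ae_filter_ringOfSetsType mu) P Q S h hP hQ). Qed.

Definition sqint (u : R -> R) : Prop := u \in Lfun mu 2%:E.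

Lemma sqintP u : sqint u <->
  measurable_fun setT u /\ mu.-integrable setT (EFin \o (fun t => u t ^+ 2)).
Proof.
split=> [su|[m_u iu]].
  split; last exact: Lfun2_integrable_sqr.
  by move: su; rewrite /sqint inE => /andP[]; rewrite inE.
rewrite /sqint inE; apply/andP; split; rewrite inE //=.
rewrite /finite_norm unlock /= poweR_lty //.
have /integrableP[_] := iu; apply: le_lt_trans.
rewrite ge0_le_integral //=.
- apply/measurable_EFinP.
  by apply: (measurableT_comp (measurable_powR _)) => //; exact: measurableT_comp.
- apply/measurable_EFinP; apply: measurableT_comp => //.
  exact: measurable_funX.
- by move=> t _; rewrite lee_fin powR_mulrn // normrX.
Qed.

Lemma sqint_measurable u : sqint u -> measurable_fun setT u.
Proof. by move=> /sqintP[]. Qed.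

Lemma sqint_integrable u : sqint u -> mu.-integrable setT (EFin \o u).
Proof.
by move=> su; apply/Lfun1_integrable/Lfun_subset12 => //; exact: fin_num_measure.
Qed.

Lemma sqint_mul_integrable u v : sqint u -> sqint v ->
  mu.-integrable setT (EFin \o (fun t => u t * v t)).
Proof. by move=> su sv; apply/Lfun1_integrable/Lfun2_mul_Lfun1. Qed.

Lemma rintD u v : mu.-integrable setT (EFin \o u) ->
  mu.-integrable setT (EFin \o v) -> mu.-integrable setT (EFin \o (u + v)).
Proof.
by move=> iu iv; apply: eq_integrable (integrableD measurableT iu iv).
Qed.

Lemma rintZ (k : R) u : mu.-integrable setT (EFin \o u) ->
  mu.-integrable setT (EFin \o (fun t => k * u t)).
Proof. by move=> iu; apply: eq_integrable (integrableZl measurableT k iu). Qed.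

Lemma sqintD u v : sqint u -> sqint v -> sqint (u + v).
Proof.
move=> su sv; apply/sqintP; split.
  by apply: measurable_funD; apply: sqint_measurable.
have -> : (fun t => (u + v) t ^+ 2) =
   (fun t => u t ^+ 2) + (fun t => v t ^+ 2) + (fun t => 2 * (u t * v t)).
  apply/funext => t.
  by change ((u t + v t) ^+ 2 = u t ^+ 2 + v t ^+ 2 + 2 * (u t * v t)); ring.
apply: rintD; last exact/rintZ/sqint_mul_integrable.
by apply: rintD; [have [] := (sqintP u).1 su|have [] := (sqintP v).1 sv].
Qed.

Definition bounded_ae (b : R -> R) :=
  measurable_fun setT b /\ exists M : R, \forall t \ae mu, `|b t| <= M.

Lemma LinftyP b : b \in Lfun mu +oo%E <-> bounded_ae b.
Proof.
have m1 : (0 < mu setT)%E by rewrite circle_setT.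
split=> [|[mb [M bM]]].
  rewrite inE => /andP[]; rewrite !inE/= => mb.
  rewrite /finite_norm unlock m1 => fb; split => //.
  have [|M bM] := @ess_supr_bounded _ _ _ mu (fun t => `|b t|); first exact: fb.
  by exists M.
rewrite inE; apply/andP; split; rewrite inE //=.
rewrite /finite_norm unlock m1.
have: (ess_sup mu (abse \o (EFin \o b)) <= M%:E)%E.
  by apply/ess_supP; apply: aeS bM => t /=; rewrite lee_fin.
by move=> /le_lt_trans; apply; rewrite ltry.
Qed.

(** The product is dominated by M^2 u^2, where M bounds b almost everywhere. *)
Lemma sqintM b u : bounded_ae b -> sqint u -> sqint (b * u).
Proof.
move=> [mb [M bM]] /sqintP[m_u iu]; apply/sqintP; split.
  exact: measurable_funM.
have mbu : measurable_fun setT (fun t => (b * u) t ^+ 2).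
  by apply: measurable_funX; exact: measurable_funM.
apply/integrableP; split; first exact/measurable_EFinP.
have /integrableP[_] := integrableZl measurableT (M ^+ 2) iu.
apply: le_lt_trans.
apply: ae_ge0_le_integral => //=.
- by apply/measurable_EFinP; exact: measurableT_comp.
- apply/measurable_EFinP; apply: measurableT_comp => //.
  by apply: measurable_funM => //; exact: measurable_funX.
- apply: aeS bM => t bt _; rewrite lee_fin.
  have -> : (b * u) t ^+ 2 = b t ^+ 2 * u t ^+ 2 by exact: exprMn.
  rewrite (normrM (b t ^+ 2)) (normrM (M ^+ 2)) ler_wpM2r // !normrX.
  apply: lerXn2r; rewrite ?nnegrE ?normr_ge0 //.
  by rewrite (le_trans bt) // ler_norm.
Qed.

Lemma bounded_aeD b c : bounded_ae b -> bounded_ae c -> bounded_ae (b + c).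
Proof.
move=> [mb [M bM]] [mc [M' cM]]; split; first exact: measurable_funD.
exists (M + M'); apply: aeS2 bM cM => t h1 h2.
by rewrite (le_trans (ler_normD _ _)) // lerD.
Qed.

Lemma bounded_aeN b : bounded_ae b -> bounded_ae (- b).
Proof.
move=> [mb [M bM]]; split; first exact: measurableT_comp.
by exists M; apply: aeS bM => t h1; rewrite /GRing.opp/= normrN.
Qed.

Lemma bounded_aeM b c : bounded_ae b -> bounded_ae c -> bounded_ae (b * c).
Proof.
move=> [mb [M bM]] [mc [M' cM]]; split; first exact: measurable_funM.
exists (M * M'); apply: aeS2 bM cM => t h1 h2.
by rewrite [X in `|X|](_ : _ = b t * c t) // normrM ler_pM.
Qed.

Lemma bounded_ae_le b (M : R) : measurable_fun setT b ->
  (forall t, `|b t| <= M) -> bounded_ae b.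
Proof. by move=> mb bM; split => //; exists M; exact: aeW. Qed.

Lemma bounded_ae_sqint b : bounded_ae b -> sqint b.
Proof.
move=> /LinftyP; apply: Lfun_subset => //.
- by rewrite lee1n.
- by rewrite leey.
- exact: fin_num_measure.
- by rewrite leey.
Qed.

Lemma Rintegral_ae u v : measurable_fun setT u -> measurable_fun setT v ->
  u =ae v -> \int[mu]_t u t = \int[mu]_t v t.
Proof.
move=> m_u m_v uv; rewrite /Rintegral; congr fine; apply: ae_eq_integral => //.
- exact/measurable_EFinP.
- exact/measurable_EFinP.
- by apply: aeS uv => t /(_ I) ->.
Qed.

Lemma Rint_sqr_eq0 u : sqint u -> \int[mu]_t (u t ^+ 2) = 0 -> u =ae 0.
Proof.
move=> /sqintP[m_u iu] iu0.
have h : (\int[mu]_t `|(EFin \o (fun t => u t ^+ 2)%R) t|)%E = 0%E.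
  rewrite -[RHS]/(0%:E) -iu0 /Rintegral fineK.
    by apply: eq_integral => t _ /=; rewrite ger0_norm // sqr_ge0.
  exact: integrable_fin_num.
have m2 : measurable_fun setT (EFin \o (fun t => u t ^+ 2)).
  by apply/measurable_EFinP; exact: measurable_funX.
have := (ae_eq_integral_abs mu measurableT m2).1 h.
apply: aeS => t /(_ I) /= [] /eqP; rewrite sqrf_eq0 => /eqP -> //.
Qed.

End RealFunctions.

(** * Complex functions, characters and the inner product *)

Section ComplexFunctions.
Context {R : realType}.
Notation mu := (circle R).
Notation C := R[i].
Implicit Types (x y b : R -> C) (a c : C).

Definition cj x : R -> C := fun t => (x t)^*.

(** Arithmetic of the two components of a complex number; they are distinct from
the real and imaginary parts that every closed field carries. *)
Lemma cReD (a c : C) : complex.Re (a + c) = complex.Re a + complex.Re c.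
Proof. by case: a; case: c. Qed.
Lemma cImD (a c : C) : complex.Im (a + c) = complex.Im a + complex.Im c.
Proof. by case: a; case: c. Qed.
Lemma cReM (a c : C) : complex.Re (a * c) =
  complex.Re a * complex.Re c - complex.Im a * complex.Im c.
Proof. by case: a; case: c. Qed.
Lemma cImM (a c : C) : complex.Im (a * c) =
  complex.Re a * complex.Im c + complex.Im a * complex.Re c.
Proof. by case: a; case: c. Qed.
Lemma cRe_conj (a : C) : complex.Re a^* = complex.Re a.
Proof. by case: a. Qed.
Lemma cIm_conj (a : C) : complex.Im a^* = - complex.Im a.
Proof. by case: a. Qed.
Lemma complexP (a c : C) : complex.Re a = complex.Re c ->
  complex.Im a = complex.Im c -> a = c.
Proof. by case: a c => [? ?] [? ?] /= -> ->. Qed.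

Lemma cjD x y : cj (x + y) = cj x + cj y.
Proof. by apply/funext => t; exact: rmorphD. Qed.
Lemma cjN x : cj (- x) = - cj x.
Proof. by apply/funext => t; exact: rmorphN. Qed.
Lemma cjB x y : cj (x - y) = cj x - cj y.
Proof. by rewrite cjD cjN. Qed.
Lemma cjM x y : cj (x * y) = cj x * cj y.
Proof. by apply/funext => t; exact: rmorphM. Qed.
Lemma cjK x : cj (cj x) = x.
Proof. by apply/funext => t; exact: conjCK. Qed.
Lemma cj1 : cj 1 = 1.
Proof. by apply/funext => t; exact: rmorph1. Qed.
Lemma cj0 : cj 0 = 0.
Proof. by apply/funext => t; exact: rmorph0. Qed.

Definition re x : R -> R := fun t => complex.Re (x t).
Definition im x : R -> R := fun t => complex.Im (x t).

Lemma reD x y : re (x + y) = re x + re y.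
Proof. by apply/funext => t; exact: cReD. Qed.
Lemma imD x y : im (x + y) = im x + im y.
Proof. by apply/funext => t; exact: cImD. Qed.
Lemma reM x y : re (x * y) = re x * re y - im x * im y.
Proof. by apply/funext => t; exact: cReM. Qed.
Lemma imM x y : im (x * y) = re x * im y + im x * re y.
Proof. by apply/funext => t; exact: cImM. Qed.
Lemma re_cj x : re (cj x) = re x.
Proof. by apply/funext => t; exact: cRe_conj. Qed.
Lemma im_cj x : im (cj x) = - im x.
Proof. by apply/funext => t; exact: cIm_conj. Qed.

Lemma L2E x : L2 x <-> sqint (re x) /\ sqint (im x).
Proof. by []. Qed.
Lemma LinftyE x : Linfty x <-> bounded_ae (re x) /\ bounded_ae (im x).
Proof. by split=> -[/LinftyP h1 /LinftyP h2]. Qed.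

Lemma bounded_ae_cst (k : R) : bounded_ae (cst k : R -> R).
Proof. by apply: (@bounded_ae_le _ _ `|k|) => //; exact: measurable_cst. Qed.

Lemma sqintN (u : R -> R) : sqint u -> sqint (- u).
Proof.
move=> su; rewrite (_ : - u = (cst (-1)) * u); last first.
  by apply/funext => t; rewrite /GRing.opp/GRing.mul/= mulN1r.
exact: sqintM (bounded_ae_cst _) su.
Qed.

Lemma L2D x y : L2 x -> L2 y -> L2 (x + y).
Proof.
by rewrite !L2E reD imD => -[h1 h2] [h3 h4]; split; exact: sqintD.
Qed.

Lemma L2M b x : Linfty b -> L2 x -> L2 (b * x).
Proof.
rewrite LinftyE !L2E reM imM => -[b1 b2] [x1 x2].
by split; apply: sqintD; try apply: sqintN; exact: sqintM.
Qed.

Lemma L2cj x : L2 x -> L2 (cj x).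
Proof. by rewrite !L2E re_cj im_cj => -[h1 h2]; split => //; exact: sqintN. Qed.

Lemma Linfty_L2 b : Linfty b -> L2 b.
Proof.
by rewrite LinftyE L2E => -[h1 h2]; split; exact: bounded_ae_sqint.
Qed.

Lemma LinftyD x y : Linfty x -> Linfty y -> Linfty (x + y).
Proof.
by rewrite !LinftyE reD imD => -[h1 h2] [h3 h4]; split; exact: bounded_aeD.
Qed.

Lemma LinftyN x : Linfty x -> Linfty (- x).
Proof.
rewrite !LinftyE => -[h1 h2]; split; [move: h1|move: h2] => /bounded_aeN.
  congr bounded_ae; apply/funext => t.
  by rewrite /re /GRing.opp/=; case: (x t).
congr bounded_ae; apply/funext => t.
by rewrite /im /GRing.opp/=; case: (x t).
Qed.

Lemma LinftyM b x : Linfty b -> Linfty x -> Linfty (b * x).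
Proof.
rewrite !LinftyE reM imM => -[b1 b2] [x1 x2].
by split; apply: bounded_aeD; try apply: bounded_aeN; exact: bounded_aeM.
Qed.

Lemma Linfty_cj x : Linfty x -> Linfty (cj x).
Proof.
by rewrite !LinftyE re_cj im_cj => -[h1 h2]; split => //; exact: bounded_aeN.
Qed.

Lemma Linfty_cst a : Linfty (cst a : R -> C).
Proof. by rewrite LinftyE; split; exact: bounded_ae_cst. Qed.

Lemma Linfty1 : Linfty (1 : R -> C). Proof. exact: (Linfty_cst 1). Qed.
Lemma Linfty0 : Linfty (0 : R -> C). Proof. exact: (Linfty_cst 0). Qed.

Lemma L2N x : L2 x -> L2 (- x).
Proof. by move=> /(L2M (Linfty_cst (-1))); congr L2; apply/funext => t; exact: mulN1r. Qed.

Lemma L2B x y : L2 x -> L2 y -> L2 (x - y).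
Proof. by move=> hx hy; apply: L2D => //; exact: L2N. Qed.

Lemma L2Z a x : L2 x -> L2 (cst a * x).
Proof. exact/L2M/Linfty_cst. Qed.

Definition zn (n : int) : R -> C := fun t => zfun t ^ n.

Lemma Linfty_z : Linfty (@zfun R).
Proof.
have mt : measurable_fun setT (fun t : R => 2 * pi * t).
  exact: measurable_funM.
rewrite LinftyE; split.
  apply: (@bounded_ae_le _ _ 1) => [|t]; last first.
    by rewrite ler_norml cos_geN1 cos_le1.
  apply: measurableT_comp mt; apply: continuous_measurable_fun.
  exact: continuous_cos.
apply: (@bounded_ae_le _ _ 1) => [|t]; last first.
  by rewrite ler_norml sin_geN1 sin_le1.
apply: measurableT_comp mt; apply: continuous_measurable_fun.
exact: continuous_sin.
Qed.

Lemma zfun_conjM (t : R) : (zfun t)^* * zfun t = 1.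
Proof.
apply: complexP; rewrite ?cReM ?cImM ?cRe_conj ?cIm_conj /=.
  by rewrite mulNr opprK -!expr2 cos2Dsin2.
ring.
Qed.

Lemma zfun_neq0 (t : R) : zfun t != 0.
Proof.
apply/eqP => z0; have := zfun_conjM t; rewrite z0 mulr0 => /eqP.
by rewrite eq_sym oner_eq0.
Qed.

Lemma zfun_conj (t : R) : (zfun t)^* = (zfun t)^-1.
Proof.
by rewrite -[LHS]mulr1 -(mulfV (zfun_neq0 t)) mulrA zfun_conjM mul1r.
Qed.

Lemma znD (m n : int) : zn (m + n) = zn m * zn n.
Proof. by apply/funext => t; exact: expfzDr (zfun_neq0 t). Qed.

Lemma zn0 : zn 0 = 1. Proof. by apply/funext => t; exact: expr0z. Qed.

Lemma cj_zn (n : int) : cj (zn n) = zn (- n).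
Proof.
apply/funext => t; rewrite /cj /zn.
transitivity ((zfun t)^* ^ n); last by rewrite zfun_conj exprz_inv.
by apply: rmorphXz; rewrite unitfE zfun_neq0.
Qed.

Lemma znN (n : int) : zn (- n) * zn n = 1.
Proof. by rewrite -znD addNr zn0. Qed.

Lemma Linfty_zn (n : int) : Linfty (zn n).
Proof.
have Hn (m : nat) : Linfty (zn m).
  elim: m => [|m IH]; first by rewrite zn0; exact: Linfty1.
  rewrite -addn1 PoszD znD; apply: LinftyM => //.
  by have := Linfty_z; congr Linfty.
case: n => // m; rewrite NegzE -cj_zn; exact/Linfty_cj/Hn.
Qed.


Definition L1 x := mu.-integrable setT (EFin \o re x) /\
  mu.-integrable setT (EFin \o im x).

Lemma rintB (u v : R -> R) : mu.-integrable setT (EFin \o u) ->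
  mu.-integrable setT (EFin \o v) -> mu.-integrable setT (EFin \o (u - v)).
Proof.
move=> iu /(rintZ (-1)) iv; apply: rintD => //.
by move: iv; congr integrable; apply/funext => t /=; rewrite mulN1r.
Qed.

Lemma L2_L1M x y : L2 x -> L2 y -> L1 (x * y).
Proof.
rewrite !L2E /L1 reM imM => -[x1 x2] [y1 y2].
by split; [apply: rintB|apply: rintD]; exact: sqint_mul_integrable.
Qed.

Lemma CintD x y : L1 x -> L1 y -> Cint (x + y) = Cint x + Cint y.
Proof.
move=> [x1 x2] [y1 y2]; apply: complexP; rewrite ?cReD ?cImD /=.
  rewrite -(RintegralD measurableT x1 y1) /Rintegral; congr fine.
  by apply: eq_integral => t _; rewrite -cReD.
rewrite -(RintegralD measurableT x2 y2) /Rintegral; congr fine.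
by apply: eq_integral => t _; rewrite -cImD.
Qed.

Lemma CintZ a x : L1 x -> Cint (cst a * x) = a * Cint x.
Proof.
move=> [x1 x2]; apply: complexP; rewrite ?cReM ?cImM /=.
  rewrite -!RintegralZl // -RintegralB ?measurableT //; try exact: rintZ.
  by rewrite /Rintegral; congr fine; apply: eq_integral => t _; rewrite -cReM.
rewrite -!RintegralZl // -RintegralD ?measurableT //; try exact: rintZ.
by rewrite /Rintegral; congr fine; apply: eq_integral => t _; rewrite -cImM.
Qed.

Lemma Cint_cj x : L1 x -> Cint (cj x) = (Cint x)^*.
Proof.
move=> [x1 x2]; apply: complexP; rewrite ?cRe_conj ?cIm_conj /=.
  by congr Rintegral; exact: re_cj.
rewrite -mulN1r -RintegralZl //; congr Rintegral.
by apply/funext => t; rewrite mulN1r; exact: cIm_conj.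
Qed.

Lemma Cint_cst a : Cint (cst a) = a.
Proof.
have m1 : fine (mu setT) = 1 := congr1 fine (@circle_setT R).
by apply: complexP => /=; rewrite Rintegral_cst // [X in _ * X]m1 mulr1.
Qed.

Lemma innerE x y : inner x y = Cint (x * cj y). Proof. by []. Qed.

Lemma inner_Ml b x y : inner (b * x) y = inner x (cj b * y).
Proof.
rewrite !innerE; congr Cint; rewrite cjM cjK; ring.
Qed.

Lemma innerDl x x' y : L2 x -> L2 x' -> L2 y ->
  inner (x + x') y = inner x y + inner x' y.
Proof.
move=> hx hx' /L2cj hy; rewrite !innerE mulrDl.
by apply: CintD; exact: L2_L1M.
Qed.

Lemma innerZl a x y : L2 x -> L2 y -> inner (cst a * x) y = a * inner x y.
Proof.
move=> hx /L2cj hy; rewrite !innerE -mulrA.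
by apply: CintZ; exact: L2_L1M.
Qed.

Lemma innerC x y : L2 x -> L2 y -> inner y x = (inner x y)^*.
Proof.
move=> hx hy; rewrite !innerE -Cint_cj; last by apply: L2_L1M => //; exact: L2cj.
by congr Cint; rewrite cjM cjK mulrC.
Qed.

Lemma innerDr x y y' : L2 x -> L2 y -> L2 y' ->
  inner x (y + y') = inner x y + inner x y'.
Proof.
move=> hx hy hy'; rewrite innerC ?innerDl //; last exact: L2D.
by rewrite (innerC hy hx) (innerC hy' hx); exact: rmorphD.
Qed.

Lemma innerZr a x y : L2 x -> L2 y -> inner x (cst a * y) = a^* * inner x y.
Proof.
move=> hx hy; rewrite innerC ?innerZl //; last exact: L2Z.
by rewrite (innerC hy hx); exact: rmorphM.
Qed.

Lemma innerNl x y : L2 x -> L2 y -> inner (- x) y = - inner x y.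
Proof.
by move=> hx hy; rewrite -mulN1r (innerZl (-1)) // mulN1r.
Qed.

Lemma innerNr x y : L2 x -> L2 y -> inner x (- y) = - inner x y.
Proof.
move=> hx hy; rewrite innerC ?innerNl //; last exact: L2N.
by rewrite (innerC hy hx); exact: rmorphN.
Qed.

Lemma innerBl x x' y : L2 x -> L2 x' -> L2 y ->
  inner (x - x') y = inner x y - inner x' y.
Proof. by move=> *; rewrite innerDl ?innerNl //; exact: L2N. Qed.

Lemma innerBr x y y' : L2 x -> L2 y -> L2 y' ->
  inner x (y - y') = inner x y - inner x y'.
Proof. by move=> *; rewrite innerDr ?innerNr //; exact: L2N. Qed.

Lemma inner0l x : L2 x -> inner 0 x = 0.
Proof.
move=> hx; have h0 := Linfty_L2 Linfty0.
by have := innerDl h0 h0 hx; rewrite addr0 => /eqP; rewrite -subr_eq0 opprD addNKr oppr_eq0 => /eqP.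
Qed.

Lemma inner0r x : L2 x -> inner x 0 = 0.
Proof.
by move=> hx; rewrite innerC ?inner0l ?rmorph0 //; exact: Linfty_L2 Linfty0.
Qed.

Definition nsq x : R := \int[mu]_t (re x t ^+ 2) + \int[mu]_t (im x t ^+ 2).

Lemma inner_nsq x : L2 x -> inner x x = (nsq x)%:C%C.
Proof.
rewrite L2E => -[/[dup] s1 /sqintP[m1 i1] /[dup] s2 /sqintP[m2 i2]].
rewrite innerE; apply: complexP => /=.
  rewrite /nsq -RintegralD //; congr Rintegral; apply/funext => t.
  by rewrite cReM cRe_conj cIm_conj mulrN opprK -!expr2.
rewrite [X in Rintegral _ _ X](_ : _ = cst 0); last first.
  by apply/funext => t; rewrite cImM cRe_conj cIm_conj /=; ring.
by rewrite Rintegral_cst // mul0r.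
Qed.

Lemma nsq_ge0 x : 0 <= nsq x.
Proof. by apply: addr_ge0; apply: Rintegral_ge0 => t _; exact: sqr_ge0. Qed.

Lemma ae_refl x : x =ae x. Proof. exact: aeW. Qed.

Lemma aeE x y : (x =ae y) <-> (\forall t \ae mu, x t = y t).
Proof. by split; apply: aeS => t h // ; exact: h. Qed.

Lemma inner_eq0 x : L2 x -> inner x x = 0 -> x =ae 0.
Proof.
move=> hx; rewrite inner_nsq // => -[/eqP].
rewrite /nsq paddr_eq0 ?Rintegral_ge0 //; try by move=> t _; exact: sqr_ge0.
move=> /andP[/eqP h1 /eqP h2]; case: hx => s1 s2.
apply: aeS2 (Rint_sqr_eq0 s1 h1) (Rint_sqr_eq0 s2 h2) => t /(_ I) e1 /(_ I) e2 _.
exact: complexP.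
Qed.

Lemma L1_ae x y : L1 x -> L1 y -> x =ae y -> Cint x = Cint y.
Proof.
move=> [/measurable_int/measurable_EFinP x1 /measurable_int/measurable_EFinP x2].
move=> [/measurable_int/measurable_EFinP y1 /measurable_int/measurable_EFinP y2] /aeE xy.
apply: complexP; apply: Rintegral_ae => //; apply: aeS xy => t + _;
  by rewrite /re /im => ->.
Qed.

Lemma inner_ae x x' y y' : L2 x -> L2 x' -> L2 y -> L2 y' ->
  x =ae x' -> y =ae y' -> inner x y = inner x' y'.
Proof.
move=> hx hx' hy hy' /aeE xx' /aeE yy'; rewrite !innerE.
apply: L1_ae; try by apply: L2_L1M => //; exact: L2cj.
apply/aeE; apply: aeS2 xx' yy' => t e1 e2.
by rewrite /GRing.mul/= /cj e1 e2.
Qed.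

End ComplexFunctions.

(** * Completeness *)

Section Completeness.
Context {R : realType}.
Notation mu := (circle R).

Definition rnsq (u : R -> R) : R := \int[mu]_t (u t ^+ 2).

Lemma sqintB (u v : R -> R) : sqint u -> sqint v -> sqint (u - v).
Proof. by move=> su sv; apply: sqintD => //; exact: sqintN. Qed.

(** With p = 2^-n the pointwise inequality |u| <= p/2 + u^2/(2p) integrates to
p/2 + p/2.  It plays the role of Cauchy-Schwarz on a space of mass one. *)
Lemma le_int_abs (u : R -> R) (n : nat) : sqint u -> rnsq u <= 4^-1 ^+ n ->
  (\int[mu]_t `|(u t)%:E| <= (2^-1 ^+ n)%:E)%E.
Proof.
move=> /[dup] su /sqintP[m_u iu] un.
have p0 : (0 : R) < 2^-1 ^+ n by rewrite exprn_gt0 // invr_gt0.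
have p40 : (4^-1 : R) ^+ n = (2^-1 ^+ n) ^+ 2.
  by rewrite -exprM mulnC exprM; congr (_ ^+ n); rewrite -[4]/(2 * 2)%:R natrM invfM expr2.
set p := 2^-1 ^+ n in p0 p40 *.
pose b : R -> R := cst (p / 2) + (fun t => (2 * p)^-1 * u t ^+ 2).
have ib : mu.-integrable setT (EFin \o b).
  by apply: rintD; [exact: finite_measure_integrable_cst|exact: rintZ].
apply: (@le_trans _ _ (\int[mu]_t (b t)%:E)%E).
  apply: ge0_le_integral => //=.
  - by apply/measurable_EFinP; exact: measurableT_comp.
  - exact: measurable_int ib.
  - move=> t _; rewrite lee_fin [b t]/(p / 2 + (2 * p)^-1 * u t ^+ 2).
    rewrite -real_normK ?num_real //; set a := `|u t|.
    have : 0 <= (2 * p)^-1 * (p - a) ^+ 2.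
      by rewrite mulr_ge0 ?sqr_ge0 // invr_ge0 mulr_ge0 // ltW.
    have -> : (2 * p)^-1 * (p - a) ^+ 2 = p / 2 - a + (2 * p)^-1 * a ^+ 2.
      by field; rewrite gt_eqF.
    by move=> h; rewrite -subr_ge0 addrAC.
have -> : (\int[mu]_t (b t)%:E = (\int[mu]_t b t)%:E)%E.
  by rewrite /Rintegral fineK //; exact: integrable_fin_num ib.
rewrite lee_fin RintegralD //; [|exact: finite_measure_integrable_cst|exact: rintZ].
rewrite Rintegral_cst // RintegralZl // [fine _](congr1 fine (@circle_setT R)) mulr1.
have : (2 * p)^-1 * rnsq u <= (2 * p)^-1 * (p ^+ 2).
  by rewrite ler_pM2l ?invr_gt0 ?mulr_gt0 // -p40.
have -> : (2 * p)^-1 * p ^+ 2 = p / 2 by field; rewrite gt_eqF.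
by rewrite /rnsq => h; rewrite [leRHS]splitr lerD2l.
Qed.

(** The increments have L^1 norms at most 2^-n, so the sum of their absolute
values has finite integral and is therefore finite almost everywhere. *)
Lemma ae_cvg_of_fast (v : nat -> R -> R) : (forall n, sqint (v n)) ->
  (forall n, rnsq (v n.+1 - v n) <= 4^-1 ^+ n) ->
  \forall t \ae mu, cvgn (fun n => v n t).
Proof.
move=> sv dv.
pose g (n : nat) (t : R) : \bar R := (`|(v n.+1 - v n) t|)%:E.
have sd n : sqint (v n.+1 - v n) by exact: sqintB.
have mg n : measurable_fun setT (g n).
  by apply/measurable_EFinP; apply: measurableT_comp => //; exact: sqint_measurable.
have g0 n t : (0 <= g n t)%E by rewrite lee_fin.
have iG : (\int[mu]_t (\sum_(n <oo) g n t) < +oo)%E.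
  rewrite integral_nneseries //.
  apply: (@le_lt_trans _ _ (\sum_(n <oo) (2^-1 ^+ n)%:E)%E).
    apply: lee_nneseries => n _; first by move=> _; apply: integral_ge0 => t _.
    exact: le_int_abs.
  apply: (@le_lt_trans _ _ 2%:E); last exact: ltry.
  apply: lime_le; first by apply: is_cvg_nneseries => n _ _; rewrite lee_fin exprn_ge0.
  apply: nearW => k; rewrite sumEFin lee_fin big_mkord.
  have -> : \sum_(i < k) (2^-1 : R) ^+ i = 2 - 2 * 2^-1 ^+ k.
    elim: k => [|k IH]; first by rewrite big_ord0 expr0; ring.
    by rewrite big_ord_recr /= IH exprS; field.
  by rewrite lerBlDr lerDl mulr_ge0 // exprn_ge0.
have mG : measurable_fun setT (fun t => (\sum_(n <oo) g n t)%E).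
  by apply: ge0_emeasurable_sum => // n t _ _; exact: g0.
have G0 t : (0 <= \sum_(n <oo) g n t)%E by exact: nneseries_ge0.
have /integrable_ae : mu.-integrable setT (fun t => (\sum_(n <oo) g n t)%E).
  apply/integrableP; split => //.
  by under eq_integral => t _ do rewrite gee0_abs //.
move=> /(_ measurableT); apply: aeS => t /(_ I) Gt.
have : cvgn (series (telescope (fun n => v n t))).
  apply: normed_cvg.
  change (cvgn (series (fun n : nat => `|(v n.+1 - v n) t|))).
  apply: nondecreasing_is_cvgn.
    by apply/nondecreasing_seqP => n; rewrite !seriesEnat /= big_nat_recr //= lerDl.
  exists (fine (\sum_(n <oo) g n t)%E) => _ [n _ <-].
  rewrite -lee_fin fineK //.
  have := @nneseries_lim_ge R (g ^~ t) xpredT 0 n (fun n _ _ => g0 n t).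
  by apply: le_trans; rewrite -sumEFin.
rewrite telescopeK => /(is_cvgD (is_cvg_cst (v 0 t))).
by congr (cvgn _); apply/funext => n /=; rewrite /GRing.add/= addrC subrK.
Qed.

(** The pointwise limit exists almost everywhere; taking the upper limit gives a
function that is measurable and defined everywhere, and Fatou's lemma carries
the estimates on v n - v k over to it. *)
Lemma sqint_complete (v : nat -> R -> R) : (forall n, sqint (v n)) ->
  (forall k n, (k <= n)%N -> rnsq (v n - v k) <= 4^-1 ^+ k) ->
  exists w, sqint w /\ forall k, rnsq (w - v k) <= 4^-1 ^+ k.
Proof.
move=> sv vC.
have m_v n : measurable_fun setT (v n) by exact: sqint_measurable.
pose w t := fine (limn_esup (fun n => (v n t)%:E)).
have mw : measurable_fun setT w.
  apply: (measurableT_comp (fine_measurable measurableT)).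
  by apply: measurable_fun_limn_esup => n; exact/measurable_EFinP.
have cw : \forall t \ae mu, v n t @[n --> \oo] --> w t.
  have := ae_cvg_of_fast sv (fun n => vC n n.+1 (leqnSn n)).
  apply: aeS => t /cvg_ex[l vl]; rewrite /w.
  have /cvg_limn_einf_sup[_ ->] : (v n t)%:E @[n --> \oo] --> l%:E.
    by apply: cvg_EFin => //; exact: nearW.
  exact: vl.
have mwk k : measurable_fun setT (fun t => (w t - v k t) ^+ 2).
  by apply: measurable_funX; exact: measurable_funB.
have mEk k : measurable_fun setT (EFin \o (fun t => (w t - v k t) ^+ 2)).
  by apply/measurable_EFinP; exact: mwk.
have fatouk k : (\int[mu]_t ((w t - v k t) ^+ 2)%:E <= (4^-1 ^+ k)%:E)%E.
  pose f (n : nat) (t : R) := ((v n t - v k t) ^+ 2)%:E.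
  have mf n : measurable_fun setT (f n).
    by apply/measurable_EFinP; apply: measurable_funX; exact: measurable_funB.
  have f0 n t : (setT t -> 0 <= f n t)%E by rewrite lee_fin sqr_ge0.
  have einf_ge0 t : (0 <= limn_einf (f^~ t))%E.
    rewrite limn_einf_lim; apply: lime_ge; first exact: is_cvg_einfs.
    apply: nearW => n; apply: le_ereal_inf_tmp => _ [m _ <-]; exact: f0.
  have mlim : measurable_fun setT (fun t => limn_einf (f ^~ t)).
    have -> : (fun t => limn_einf (f ^~ t)) =
        (fun t => - limn_esup (fun n => - f n t))%E.
      by apply/funext => t.
    apply: measurableT_comp => //.
    by apply: measurable_fun_limn_esup => n; exact: measurableT_comp.
  have -> : (\int[mu]_t ((w t - v k t) ^+ 2)%:E =
             \int[mu]_t limn_einf (f ^~ t))%E.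
    apply: ge0_ae_eq_integral => //.
    - exact: mEk.
    - by move=> t _; rewrite lee_fin sqr_ge0.
    - apply: aeS cw => t vt _; apply/esym.
      have [-> //] : ((limn_einf (f^~ t) = ((w t - v k t) ^+ 2)%:E) *
        (limn_esup (f^~ t) = ((w t - v k t) ^+ 2)%:E))%type.
      apply: cvg_limn_einf_sup; apply: cvg_EFin; first exact: nearW.
      have vk : v n t - v k t @[n --> \oo] --> w t - v k t.
        by apply: cvgB => //; exact: cvg_cst.
      by rewrite expr2; exact: (cvgM vk vk).
  apply: (le_trans (fatou mu measurableT mf f0)).
  rewrite limn_einf_lim; apply: lime_le; first exact: is_cvg_einfs.
  near=> n; apply: ge_ereal_inf; exists (\int[mu]_x f n x)%E.
    by exists n => /=.
  have kn : (k <= n)%N by near: n; exists k.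
  have := vC k n kn; rewrite /rnsq -lee_fin /Rintegral fineK //.
  apply: integrable_fin_num => //.
  by have /sqintP[] : sqint (v n - v k) by exact: sqintB.
have swk k : sqint (w - v k).
  apply/sqintP; split; first exact: measurable_funB.
  apply/integrableP; split.
    exact: mEk.
  apply: (le_lt_trans _ (ltry (4^-1 ^+ k))).
  apply: le_trans (fatouk k); rewrite le_eqVlt; apply/orP; left; apply/eqP.
  by apply: eq_integral => t _ /=; rewrite ger0_norm // sqr_ge0.
exists w; split.
  by rewrite -(subrK (v 0) w); exact: sqintD.
move=> k; rewrite -lee_fin /rnsq /Rintegral fineK; first exact: fatouk.
by apply: integrable_fin_num => //; have /sqintP[] := swk k.
Unshelve. all: by end_near.
Qed.

End Completeness.

(** * Orthogonal projection onto closed subspaces *)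

Section Hilbert.
Context {R : realType}.
Notation mu := (circle R).
Notation C := R[i].
Implicit Types (x y h : R -> C) (a c : C).

Definition sqn a : R := complex.Re a ^+ 2 + complex.Im a ^+ 2.

Lemma sqn_ge0 a : 0 <= sqn a.
Proof. by apply: addr_ge0; exact: sqr_ge0. Qed.

Lemma sqn_eq0 a : sqn a = 0 -> a = 0.
Proof.
move/eqP; rewrite /sqn paddr_eq0 ?sqr_ge0 // !sqrf_eq0 => /andP[/eqP h1 /eqP h2].
exact: complexP.
Qed.

Lemma mul_conj a : a * a^* = (sqn a)%:C%C.
Proof.
by case: a => a1 a2; apply: complexP; rewrite /sqn /=; ring.
Qed.

Lemma sqnD_le a c : sqn (a + c) <= 2 * sqn a + 2 * sqn c.
Proof.
rewrite -subr_ge0 (_ : _ - _ = sqn (a - c)) ?sqn_ge0 //.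
case: a => a1 a2; case: c => c1 c2; rewrite /sqn /=; ring.
Qed.

Lemma nsqE x : L2 x -> nsq x = complex.Re (inner x x).
Proof. by move=> hx; rewrite inner_nsq. Qed.

Lemma nsqD x y : L2 x -> L2 y ->
  nsq (x + y) = nsq x + nsq y + 2 * complex.Re (inner x y).
Proof.
move=> hx hy; rewrite !nsqE //; last exact: L2D.
rewrite innerDl ?innerDr //; try exact: L2D.
by rewrite (innerC hx hy) !cReD cRe_conj; ring.
Qed.

Lemma nsqN x : L2 x -> nsq (- x) = nsq x.
Proof.
move=> hx; rewrite !nsqE //; last exact: L2N.
by rewrite innerNl ?innerNr ?opprK //; exact: L2N.
Qed.

Lemma nsqB x y : L2 x -> L2 y ->
  nsq (x - y) = nsq x + nsq y - 2 * complex.Re (inner x y).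
Proof.
move=> hx hy; rewrite nsqD ?nsqN ?innerNr //; last exact: L2N.
by case: (inner x y) => ? ? /=; rewrite mulrN.
Qed.

Lemma nsqZ a x : L2 x -> nsq (cst a * x) = sqn a * nsq x.
Proof.
move=> hx; rewrite !nsqE //; last exact: L2Z.
rewrite innerZl ?innerZr //; last exact: L2Z.
by rewrite mulrA mul_conj inner_nsq // cReM /= mul0r subr0.
Qed.

(** The choice of scalar that minimizes the distance from x to the line of h. *)
Lemma nsq_proj x h : L2 x -> L2 h -> 0 < nsq h ->
  nsq (x - cst (inner x h / (nsq h)%:C%C) * h) = nsq x - sqn (inner x h) / nsq h.
Proof.
move=> hx hh h0.
rewrite nsqB ?nsqZ //; last exact: L2Z.
rewrite innerZr //.
have -> : (inner x h / (nsq h)%:C%C)^* * inner x h = ((nsq h)^-1 * sqn (inner x h))%:C%C.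
  rewrite -fmorphV rmorphM /= mulrAC [_^* * _]mulrC mul_conj.
  by apply: complexP; rewrite ?cReM ?cImM ?cRe_conj ?cIm_conj /=; ring.
have -> : sqn (inner x h / (nsq h)%:C%C) = sqn (inner x h) * (nsq h)^-1 ^+ 2.
  rewrite -fmorphV; case: (inner x h) => a1 a2; rewrite /sqn /=; ring.
by rewrite /=; field; rewrite gt_eqF.
Qed.

Lemma Cauchy_Schwarz x y : L2 x -> L2 y -> sqn (inner x y) <= nsq x * nsq y.
Proof.
move=> hx hy; have := nsq_ge0 y; rewrite le_eqVlt => /orP[/eqP y0|y0].
  have := inner_eq0 hy; rewrite inner_nsq // -y0 => /(_ erefl) yae.
  rewrite (inner_ae hx hx hy _ (ae_refl _) yae) ?inner0r //.
    by rewrite mulr0 /sqn /= expr0n addr0.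
  exact: Linfty_L2 Linfty0.
have := nsq_ge0 (x - cst (inner x y / (nsq y)%:C%C) * y).
by rewrite nsq_proj // subr_ge0 ler_pdivrMr.
Qed.

Lemma reB x y : re (x - y) = re x - re y.
Proof.
rewrite reD; congr (_ + _); apply/funext => t.
by rewrite /re /GRing.opp/=; case: (y t).
Qed.

Lemma imB x y : im (x - y) = im x - im y.
Proof.
rewrite imD; congr (_ + _); apply/funext => t.
by rewrite /im /GRing.opp/=; case: (y t).
Qed.

Lemma L2_complete (u : nat -> R -> C) : (forall n, L2 (u n)) ->
  (forall k n, (k <= n)%N -> nsq (u n - u k) <= 4^-1 ^+ k) ->
  exists x, L2 x /\ forall k, nsq (x - u k) <= 2 * 4^-1 ^+ k.
Proof.
move=> hu uC.
have [|v [hv vk]] := @sqint_complete _ (fun n => re (u n)) (fun n => (hu n).1).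
  move=> k n kn; apply: le_trans (uC k n kn).
  rewrite /nsq /rnsq -reB.
  by rewrite lerDl; apply: Rintegral_ge0 => t _; exact: sqr_ge0.
have [|w [hw wk]] := @sqint_complete _ (fun n => im (u n)) (fun n => (hu n).2).
  move=> k n kn; apply: le_trans (uC k n kn).
  rewrite /nsq /rnsq -imB.
  by rewrite lerDr; apply: Rintegral_ge0 => t _; exact: sqr_ge0.
exists (fun t => Complex (v t) (w t)); split => // k.
rewrite mulr2n mulrDl mul1r /nsq reB imB.
by apply: lerD; [exact: vk|exact: wk].
Qed.

Lemma eq0_geometric (a K : R) : 0 <= a -> (forall k : nat, a <= K * 4^-1 ^+ k) -> a = 0.
Proof.
move=> a0 h; apply/eqP; rewrite eq_le a0 andbT.
have cv : (fun k : nat => K * 4^-1 ^+ k) @ \oo --> K * 0.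
  by apply: cvgMr; apply: cvg_expr; rewrite ger0_norm ?invf_lt1 ?ltr1n.
rewrite mulr0 in cv; rewrite -(cvg_lim _ cv) //.
by apply: limr_ge; [exact: cvgP cv|exact: nearW].
Qed.

(** Closedness is stated through approximation in norm, which avoids putting a
topology on functions that are only considered up to almost everywhere
equality. *)
Record closed_linear (M : set (R -> C)) := ClosedLinear {
  closed_linear_L2 : M `<=` L2;
  closed_linear0 : M 0;
  closed_linearP : forall a x y, M x -> M y -> M (cst a * x + y);
  closed_linear_closed : forall x, L2 x ->
    (forall e : R, 0 < e -> exists2 y, M y & nsq (x - y) <= e) -> M x }.

(** A sequence in M whose distances to x approach the infimum is Cauchy, by the
parallelogram identity applied at the midpoints; its limit y is in M, and since
no multiple of h improves the distance, x - y is orthogonal to h. *)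
Theorem projection (M : set (R -> C)) x : closed_linear M -> L2 x ->
  exists y, M y /\ forall h, M h -> inner (x - y) h = 0.
Proof.
move=> [ML2 M0 MP Mcl] hx.
pose D := [set nsq (x - m) | m in M].
have hD : has_inf D.
  split; first by exists (nsq (x - 0)), 0.
  by exists 0 => _ [m _ <-]; exact: nsq_ge0.
pose d := inf D.
have dle m : M m -> d <= nsq (x - m).
  by move=> Mm; apply: ge_inf; [exact: hD.2|exists m].
(* The parallelogram identity turns an excess e k over the infimum into a
   distance 4 * e k, which has to be the rate 4^-k of the completeness lemma. *)
pose e (k : nat) : R := 4^-1 * 4^-1 ^+ k.
have e0 k : 0 < e k by rewrite mulr_gt0 ?exprn_gt0 ?invr_gt0.
have mex k : exists m, M m /\ nsq (x - m) < d + e k.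
  by have [_ [m Mm <-] mlt] := inf_adherent (e0 k) hD; exists m.
pose m k := sval (cid (mex k)).
have Mm k : M (m k) by have [] := svalP (cid (mex k)).
have mlt k : nsq (x - m k) < d + e k by have [] := svalP (cid (mex k)).
have hm k : L2 (m k) by exact/ML2/Mm.
have hxm k : L2 (x - m k) by exact: L2B.
have mC k n : (k <= n)%N -> nsq (m n - m k) <= 4^-1 ^+ k.
  move=> kn.
  have par : nsq (m n - m k) = 2 * nsq (x - m n) + 2 * nsq (x - m k)
                               - nsq ((x - m n) + (x - m k)).
    have -> : m n - m k = (x - m k) - (x - m n) by ring.
    by rewrite (nsqB (hxm k) (hxm n)) (nsqD (hxm n) (hxm k)) (innerC (hxm n) (hxm k)) cRe_conj; ring.
  have mid : nsq ((x - m n) + (x - m k)) =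
             4 * nsq (x - (cst 2^-1 * m n + cst 2^-1 * m k)).
    have -> : (x - m n) + (x - m k) =
              cst 2 * (x - (cst 2^-1 * m n + cst 2^-1 * m k)).
      have -> : (cst 2 : R -> C) = 2 by apply/funext => t.
      have h2 : (2 : R -> C) * cst 2^-1 = 1.
        have n2 : (2 : C) != 0 by rewrite pnatr_eq0.
        by apply/funext => t; exact: mulfV n2.
      rewrite mulrBr mulrDr !mulrA h2; ring.
    rewrite nsqZ; last first.
      by apply: L2B => //; apply: L2D; exact: L2Z.
    by congr (_ * _); rewrite /sqn /=; ring.
  have := dle _ (MP 2^-1 _ _ (Mm n) (MP 2^-1 _ _ (Mm k) M0)).
  rewrite addr0 par mid => dl.
  have en : e n <= e k.
    rewrite ler_pM2l ?invr_gt0 //; apply: ler_wiXn2l => //.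
    by rewrite invf_le1 ?ler1n.
  have := mlt n; have := mlt k.
  have -> : (4^-1 : R) ^+ k = 4 * e k by rewrite /e mulrA divff ?mul1r // pnatr_eq0.
  lra.
have [y [hy yk]] := L2_complete hm mC.
have My : M y.
  apply: Mcl => // eps eps0.
  have [k ek] : exists k : nat, 2 * 4^-1 ^+ k <= eps.
    apply: contrapT => /forallNP H.
    suff : eps = 0 by move=> E; rewrite E ltxx in eps0.
    apply: (@eq0_geometric _ 2); first exact: ltW.
    by move=> k; have /negP := H k; rewrite -ltNge => /ltW.
  by exists (m k) => //; exact: le_trans (yk k) ek.
exists y; split => // h Mh.
have hh := ML2 _ Mh.
apply: sqn_eq0; apply: (@eq0_geometric _ (2 * nsq h + 4 * nsq h)); first exact: sqn_ge0.
move=> k.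
have -> : x - y = (x - m k) - (y - m k) by ring.
rewrite innerBl //; last exact: L2B.
apply: (le_trans (sqnD_le _ _)).
have -> : sqn (- inner (y - m k) h) = sqn (inner (y - m k) h).
  by case: (inner _ _) => ? ?; rewrite /sqn /= !sqrrN.
have h1 : sqn (inner (x - m k) h) <= e k * nsq h.
  have := nsq_ge0 h; rewrite le_eqVlt => /orP[/eqP h0|h0].
    by rewrite -h0 mulr0; have := Cauchy_Schwarz (hxm k) hh; rewrite -h0 mulr0.
  rewrite -ler_pdivrMr //.
  have := dle _ (MP (inner (x - m k) h / (nsq h)%:C%C) _ _ Mh (Mm k)).
  have -> : x - (cst (inner (x - m k) h / (nsq h)%:C%C) * h + m k) =
     (x - m k) - cst (inner (x - m k) h / (nsq h)%:C%C) * h by ring.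
  rewrite nsq_proj //; have := mlt k; lra.
have h2 : sqn (inner (y - m k) h) <= 2 * 4^-1 ^+ k * nsq h.
  apply: (le_trans (Cauchy_Schwarz _ _)) => //; first exact: L2B.
  by rewrite ler_wpM2r ?nsq_ge0.
have ek : e k <= 4^-1 ^+ k.
  by rewrite ler_piMl ?exprn_ge0 // ?invr_ge0 // invf_le1 ?ler1n.
have := nsq_ge0 h; have : e k * nsq h <= 4^-1 ^+ k * nsq h.
  by rewrite ler_wpM2r ?nsq_ge0.
lra.
Qed.

End Hilbert.

(** * Orthonormality of the characters *)

Section CircleMeasure.
Context {R : realType}.
Notation mu := (circle R).
Notation leb := (@lebesgue_measure R).

(** Through the uniform distribution, integrals over the circle become Lebesgue
integrals over [0, 1]. *)
Lemma circle_uniform (A : set (measurableTypeR R)) : measurable A ->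
  mu A = uniform_prob (@ltr01 R) A.
Proof.
move=> mA; rewrite /uniform_prob integral_uniform_pdf.
rewrite (eq_integral (cst 1%E)); last first.
  move=> t; rewrite inE => -[_] /=; rewrite in_itv /= /uniform_pdf => ->.
  by rewrite subr0 invr1.
by rewrite integral_cst ?mul1e //; exact: measurableI.
Qed.

Lemma ge0_circle_integral (f : R -> \bar R) : measurable_fun setT f ->
  (forall t, 0 <= f t)%E ->
  (\int[mu]_t f t = \int[leb]_(t in `[0%R, 1%R]) f t)%E.
Proof.
move=> mf f0; have := integral_uniform (@ltr01 R) mf f0.
rewrite subr0 invr1 mul1e => <-.
by apply: eq_measure_integral => A mA _; exact: circle_uniform.
Qed.

Lemma circle_integral (f : R -> \bar R) : measurable_fun setT f ->
  (\int[mu]_t f t = \int[leb]_(t in `[0%R, 1%R]) f t)%E.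
Proof.
move=> mf; rewrite integralE [RHS]integralE.
rewrite !ge0_circle_integral //.
- exact: measurable_funeneg.
- exact: measurable_funepos.
Qed.

Lemma circle_integrable (f : R -> \bar R) : mu.-integrable setT f ->
  leb.-integrable `[0%R, 1%R] f.
Proof.
move=> /integrableP[mf fi]; apply/integrableP; split.
  exact: measurable_funTS.
by rewrite -ge0_circle_integral //; exact: measurableT_comp.
Qed.

Lemma circle_ae_itv : \forall t \ae mu, 0 < t < 1.
Proof.
exists (~` `]0%R, 1%R[%classic); split.
- exact: measurableC.
- apply/eqP; rewrite eq_le measure_ge0 andbT /= /mfrestr /mrestr.
  have -> : ~` `]0%R, 1%R[%classic `&` [set` `[0%R, 1%R]] = [set (0:R); 1].
    apply/seteqP; split => t /=; rewrite !in_itv /=.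
      move=> [] /negP; rewrite negb_and -!leNgt => /orP[h1|h1] /andP[h2 h3].
        by left; apply/eqP; rewrite eq_le h1.
      by right; apply/eqP; rewrite eq_le h3.
    by move=> [->|->]; rewrite ?ltxx ?lexx ?ler01 ?andbF //; split.
  rewrite (@countable_lebesgue_measure0 R [set 0; 1]) //.
  exact/finite_set_countable/finite_set2.
- by move=> t /= h /=; rewrite in_itv.
Qed.

Lemma lebesgue_circle_ae (P : R -> Prop) :
  (\forall t \ae leb, 0 < t < 1 -> P t) -> \forall t \ae mu, P t.
Proof.
move=> [N [mN N0 NP]].
have : \forall t \ae mu, 0 < t < 1 -> P t.
  exists N; split => //.
  apply/eqP; rewrite eq_le measure_ge0 andbT -N0.
  rewrite /= /mfrestr /mrestr; apply: le_measure; rewrite ?inE //.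
  exact: measurableI.
by apply: aeS2 circle_ae_itv => t h; apply.
Qed.

Lemma zfun_exp (n : nat) (t : R) : zfun t ^+ n =
  Complex (cos (n%:R * (2 * pi * t))) (sin (n%:R * (2 * pi * t))).
Proof.
elim: n => [|n IH]; first by rewrite expr0 mul0r cos0 sin0.
have -> : n.+1%:R * (2 * pi * t) = n%:R * (2 * pi * t) + 2 * pi * t.
  by rewrite -addn1 natrD; ring.
rewrite exprS IH cosD sinD /zfun.
by apply: complexP; rewrite ?cReM ?cImM /=; ring.
Qed.

(** The fundamental theorem of calculus for a primitive that takes the same value
at both ends of [0, 1]. *)
Lemma circle_Rintegral_eq0 (f F : R -> R) :
  (forall t : R, is_derive t 1 F (f t)) -> continuous f -> F 1 = F 0 ->
  \int[mu]_t f t = 0.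
Proof.
move=> dF cf F01.
rewrite /Rintegral circle_integral; last first.
  by apply/measurable_EFinP; exact: continuous_measurable_fun.
have cF : continuous F.
  move=> t; apply: differentiable_continuous; apply/derivable1_diffP.
  exact: (@ex_derive _ _ _ _ _ _ _ (dF t)).
rewrite (@continuous_FTC2 _ _ F) ?F01 -?EFinB ?subrr //.
- by apply: continuous_subspaceT => t; exact: cf.
- split.
  + by move=> t _; exact: (@ex_derive _ _ _ _ _ _ _ (dF t)).
  + by apply: cvg_at_right_filter; exact: cF.
  + by apply: cvg_at_left_filter; exact: cF.
- by move=> t _; rewrite derive1E; exact: (@derive_val _ _ _ _ _ _ _ (dF t)).
Qed.

Lemma int_cos_sin (n : nat) : (0 < n)%N ->
  \int[mu]_t cos (n%:R * (2 * pi * t)) = 0 /\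
  \int[mu]_t sin (n%:R * (2 * pi * t)) = 0.
Proof.
move=> n0; set w : R := n%:R * (2 * pi).
have w0 : w != 0 by rewrite mulf_neq0 ?pnatr_eq0 -?lt0n ?mulf_neq0 ?pnatr_eq0 ?gt_eqF ?pi_gt0.
have d1 (t : R) : is_derive t 1 (fun t : R => w * t) w.
  by apply: is_derive_eq; rewrite scaler1.
have per : w * 1 = 0 + (pi *+ 2) *+ n by rewrite mulr1 add0r /w !mulr_natl.
have cw : continuous (fun t : R => w * t) by move=> t; exact: mulrl_continuous.
split.
  apply: (@circle_Rintegral_eq0 _ (fun t : R => w^-1 * sin (w * t))).
  - move=> t; rewrite mulrA -/w.
    have := @is_derive1_comp R sin (fun t => w * t) t _ _ (is_derive_sin _) (d1 t).
    move=> /(@is_deriveZ R R R (sin \o (fun t : R => w * t)) w^-1 t 1).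
    by rewrite /GRing.scale /= mulrC mulfK.
  - move=> t; under eq_fun do rewrite mulrA.
    by apply: continuous_comp; [exact: cw|exact: continuous_cos].
  - by rewrite per (periodicn (@sinD2pi R)) mulr0.
apply: (@circle_Rintegral_eq0 _ (fun t : R => - w^-1 * cos (w * t))).
- move=> t; rewrite mulrA -/w.
  have := @is_derive1_comp R cos (fun t => w * t) t _ _ (is_derive_cos _) (d1 t).
  move=> /(@is_deriveZ R R R (cos \o (fun t : R => w * t)) (- w^-1) t 1).
  by rewrite /GRing.scale /= mulrC mulNr mulrNN mulfK.
- move=> t; under eq_fun do rewrite mulrA.
  by apply: continuous_comp; [exact: cw|exact: continuous_sin].
- by rewrite per (periodicn (@cosD2pi R)) mulr0.
Qed.

Lemma Cint_zn (n : int) : Cint (zn n : R -> R[i]) = (n == 0)%:R.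
Proof.
have Hn (m : nat) : (0 < m)%N -> Cint (zn m : R -> R[i]) = 0.
  move=> m0; have [h1 h2] := int_cos_sin m0.
  have -> : zn m = fun t => Complex (cos (m%:R * (2 * pi * t))) (sin (m%:R * (2 * pi * t))) :> R[i].
    by apply/funext => t; exact: zfun_exp.
  exact: complexP.
case: n => [[|m]|m].
- by rewrite zn0 (Cint_cst 1).
- by rewrite Hn.
- rewrite NegzE -cj_zn Cint_cj ?Hn ?rmorph0 //.
  have L1 := @Linfty_zn R m.+1.
  by have := L2_L1M (Linfty_L2 L1) (Linfty_L2 Linfty1); rewrite mulr1.
Qed.

Lemma inner_zn (m n : int) : inner (zn m : R -> R[i]) (zn n) = (m == n)%:R.
Proof. by rewrite innerE cj_zn -znD Cint_zn subr_eq0. Qed.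

End CircleMeasure.

(** * Uniqueness of Fourier coefficients *)

Section Uniqueness.
Context {R : realType}.
Notation mu := (circle R).
Notation leb := (@lebesgue_measure R).

Definition below (b : R) (u : R -> R) (t : R) : R := if t < b then u t else 0.

(** By Lebesgue differentiation u is almost everywhere the derivative of its
indefinite integral, which vanishes on ]0, 1[. *)
Lemma ae0_of_int_below (u : R -> R) : measurable_fun setT u ->
  mu.-integrable setT (EFin \o u) ->
  (forall b : R, 0 < b < 1 -> \int[mu]_t below b u t = 0) -> u =ae 0.
Proof.
move=> m_u iu hu.
set I01 : set R := [set` `[0%R, 1%R]].
have mI : measurable I01 by exact: measurable_itv.
pose f : R -> R := u \_ I01.
have iI : leb.-integrable I01 (EFin \o u) by exact: circle_integrable.
have iF : leb.-integrable setT (EFin \o f).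
  have := (@integrable_mkcond _ _ R leb I01 (EFin \o u) mI).1 iI.
  by apply: eq_integrable => // t _; rewrite /= /f !patchE; case: ifP.
pose F x := \int[leb]_(t in `]-oo, x]) f t.
have iFS (A : set R) : measurable A -> leb.-integrable A (EFin \o f).
  by move=> mA; apply: integrableS iF.
have F0 b : 0 < b < 1 -> F b = 0.
  move=> b01; rewrite /F -Rintegral_itv_bndo_bndc; last exact: iFS.
  rewrite -(hu b b01) /Rintegral circle_integral; last first.
    apply/measurable_EFinP; apply: measurable_fun_ifT => //.
    exact: measurable_fun_ltr.
  congr fine; rewrite integral_mkcond [RHS]integral_mkcond.
  apply: eq_integral => t _; rewrite !patchE /f patchE /below.
  have -> : (t \in `]-oo, b[%classic) = (t < b) by rewrite mem_setE in_itv.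
  by case: (t < b); case: (t \in I01).
have := FTC1Ny (fun y => iFS _ (measurable_itv _)) (integrable_locally_restrict mI iI).
move=> Fae; suff : \forall t \ae mu, u t = 0 by apply: aeS => t h _.
apply: lebesgue_circle_ae.
apply: (@filterS _ _ (ae_filter_ringOfSetsType leb)) Fae => t [_ Ft] t01.
have ft : f t = u t.
  rewrite /f patchE; case: ifPn => //; rewrite mem_setE in_itv /=.
  by have /andP[/ltW-> /ltW->] := t01.
rewrite -ft -Ft -/F derive1E.
rewrite (@near_eq_derive _ _ _ F (cst 0) t 1) ?derive_cst //.
have t01' : t \in `]0, 1[ by rewrite in_itv.
have := near_in_itvoo t01'; apply: filterS => s; rewrite in_itv /=.
exact: F0.
Qed.

(** On [0, 1] these polynomials stay between 0 and 1 and converge to the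
indicator function of s > 1/2, as Bernoulli's inequality shows.  Composed with
a trigonometric polynomial they approximate indicator functions of intervals. *)
Definition sharp (k : nat) (s : R) : R := 1 - (1 - s ^+ k) ^+ (2 ^ k).

Lemma bernoulli (y : R) (n : nat) : -1 <= y -> 1 + n%:R * y <= (1 + y) ^+ n.
Proof.
move=> y1; elim: n => [|n IH]; first by rewrite mul0r addr0 expr0.
have y0 : 0 <= 1 + y by rewrite -lerBlDl sub0r.
rewrite exprS; apply: (le_trans _ (ler_wpM2l y0 IH)).
rewrite -natr1 -subr_ge0.
have -> : (1 + y) * (1 + n%:R * y) - (1 + (n%:R + 1) * y) = n%:R * y ^+ 2 by ring.
by rewrite mulr_ge0 ?sqr_ge0.
Qed.

Lemma sharp01 k (s : R) : 0 <= s <= 1 -> 0 <= sharp k s <= 1.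
Proof.
move=> /andP[s0 s1].
have /andP[a0 a1] : 0 <= s ^+ k <= 1 by rewrite exprn_ge0 // exprn_ile1.
have b0 : 0 <= 1 - s ^+ k by rewrite subr_ge0.
rewrite /sharp subr_ge0 exprn_ile1 ?b0 //=.
  by rewrite lerBlDr lerDl exprn_ge0.
by rewrite lerBlDr lerDl.
Qed.

Lemma sharp_lt (s : R) : 0 <= s < 2^-1 -> sharp k s @[k --> \oo] --> (0 : R).
Proof.
move=> /andP[s0 s1].
have s1' : s <= 1 by rewrite (le_trans (ltW s1)) // invf_le1 ?ler1n.
apply: (@squeeze_cvgr _ _ _ _ (cst 0) (fun k => (2 * s) ^+ k)).
- apply: nearW => k; have h01 : 0 <= s <= 1 by rewrite s0.
  have /andP[-> _] := sharp01 k h01.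
  have /andP[a0 a1] : 0 <= s ^+ k <= 1 by rewrite exprn_ge0 // exprn_ile1.
  have := @bernoulli (- s ^+ k) (2 ^ k); rewrite lerN2 => /(_ a1).
  by rewrite /sharp /= exprMn natrX mulrN => h; rewrite lerBlDr -lerBlDl.
- exact: cvg_cst.
- apply: cvg_expr; rewrite ger0_norm ?mulr_ge0 //.
  by rewrite -ltr_pdivlMl // mulr1.
Qed.

Lemma sharp_gt (s : R) : 2^-1 < s <= 1 -> sharp k s @[k --> \oo] --> (1 : R).
Proof.
move=> /andP[s0 s1].
have p0 : 0 < s by rewrite (lt_trans _ s0) // invr_gt0.
have p1 : 1 < 2 * s by rewrite -ltr_pdivrMl // mulr1.
have p2 : 0 < 2 * s by rewrite mulr_gt0.
apply: (@squeeze_cvgr _ _ _ _ (fun k => 1 - (2 * s)^-1 ^+ k) (cst 1)).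
- apply: nearW => k; have h01 : 0 <= s <= 1 by rewrite (ltW p0).
  have /andP[_ ->] := sharp01 k h01.
  rewrite andbT lerD2l lerN2 exprVn.
  have /andP[a0 a1] : 0 <= s ^+ k <= 1 by rewrite exprn_ge0 ?exprn_ile1 // ltW.
  have y1 : -1 <= s ^+ k by rewrite (le_trans _ a0) // oppr_le0.
  have := @bernoulli (s ^+ k) (2 ^ k) y1.
  rewrite natrX -exprMn => h.
  have q0 : 0 < (1 + s ^+ k) ^+ (2 ^ k) by rewrite exprn_gt0 // ltr_wpDr.
  apply: (@le_trans _ _ ((1 + s ^+ k) ^+ (2 ^ k))^-1).
    rewrite -[leRHS]mul1r ler_pdivlMr // -exprMn.
    have -> : (1 - s ^+ k) * (1 + s ^+ k) = 1 - (s ^+ k) ^+ 2 by ring.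
    apply: exprn_ile1; first by rewrite subr_ge0 exprn_ile1.
    by rewrite lerBlDr lerDl sqr_ge0.
  rewrite lef_pV2 ?posrE // ?exprn_gt0 //; apply: (le_trans _ h).
  by rewrite lerDr.
- rewrite -[X in _ --> X]subr0; apply: cvgB; first exact: cvg_cst.
  apply: cvg_expr; rewrite ger0_norm ?invr_ge0 ?(ltW p2) //.
  by rewrite invf_lt1.
- exact: cvg_cst.
Qed.

Notation C := R[i].
Implicit Types (x p : R -> C).

(** The functions that multiply the set of null functions into itself form an
algebra containing the characters, hence all trigonometric polynomials. *)
Definition null x := L2 x /\ forall n : int, inner x (zn n) = 0.
Definition multiplier p := Linfty p /\ forall x, null x -> null (p * x).

Lemma L2_zn (n : int) : L2 (zn n : R -> C).
Proof. exact/Linfty_L2/Linfty_zn. Qed.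

Lemma multiplier_cst (a : C) : multiplier (cst a).
Proof.
split; first exact: Linfty_cst.
move=> x [hx xn]; split; first exact: L2Z.
by move=> n; rewrite innerZl ?xn ?mulr0 //; exact: L2_zn.
Qed.

Lemma multiplier_zn (n : int) : multiplier (zn n).
Proof.
split; first exact: Linfty_zn.
move=> x [hx xn]; split; first exact: L2M (Linfty_zn n) hx.
by move=> m; rewrite inner_Ml cj_zn -znD.
Qed.

Lemma multiplierD p q : multiplier p -> multiplier q -> multiplier (p + q).
Proof.
move=> [hp pn] [hq qn]; split; first exact: LinftyD.
move=> x xn; have [h1 h2] := pn x xn; have [h3 h4] := qn x xn.
rewrite mulrDl; split; first exact: L2D.
by move=> n; rewrite innerDl ?h2 ?h4 ?addr0 //; exact: L2_zn.
Qed.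

Lemma multiplierM p q : multiplier p -> multiplier q -> multiplier (p * q).
Proof.
move=> [hp pn] [hq qn]; split; first exact: LinftyM.
by move=> x xn; rewrite -mulrA; apply/pn/qn.
Qed.

Lemma multiplierB1 p : multiplier p -> multiplier (1 - p).
Proof.
move=> hp; rewrite -mulN1r; apply: multiplierD; first exact: (multiplier_cst 1).
by apply: multiplierM => //; exact: (multiplier_cst (-1)).
Qed.

Lemma multiplierX p (k : nat) : multiplier p -> multiplier (p ^+ k).
Proof.
move=> hp; elim: k => [|k IH]; first by rewrite expr0; exact: (multiplier_cst 1).
by rewrite exprS; exact: multiplierM.
Qed.

(** A trigonometric polynomial of degree one with values in [0, 1] that crosses
1/2 on ]0, 1[ exactly at b, from above to below. *)
Definition hat (b t : R) : R := 2^-1 + sin (pi * t) * sin (pi * b - pi * t) / 2.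

Lemma hat01 b t : 0 <= hat b t <= 1.
Proof.
have : `|sin (pi * t) * sin (pi * b - pi * t)| <= 1.
  by rewrite normrM mulr_ile1 // ler_norml sin_geN1 sin_le1.
rewrite ler_norml /hat => /andP[h1 h2]; apply/andP; split; lra.
Qed.

Lemma hat_lt b t : 0 < b < 1 -> 0 < t < 1 -> b < t -> hat b t < 2^-1.
Proof.
move=> /andP[b0 b1] /andP[t0 t1] bt; rewrite /hat gtrDl.
rewrite pmulr_llt0 ?invr_gt0 // pmulr_rlt0; last first.
  by apply: sin_gt0_pi; rewrite mulr_gt0 ?pi_gt0 //= gtr_pMr ?pi_gt0.
rewrite -opprB sinN oppr_lt0 -mulrBr; apply: sin_gt0_pi.
rewrite mulr_gt0 ?pi_gt0 ?subr_gt0 //= gtr_pMr ?pi_gt0 //.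
by rewrite ltrBlDr (lt_trans t1) // ltrDl.
Qed.

Lemma hat_gt b t : 0 < b < 1 -> 0 < t < 1 -> t < b -> 2^-1 < hat b t.
Proof.
move=> /andP[b0 b1] /andP[t0 t1] bt; rewrite /hat ltrDl.
rewrite pmulr_lgt0 ?invr_gt0 // pmulr_rgt0; last first.
  by apply: sin_gt0_pi; rewrite mulr_gt0 ?pi_gt0 //= gtr_pMr ?pi_gt0.
rewrite -mulrBr; apply: sin_gt0_pi.
rewrite mulr_gt0 ?pi_gt0 ?subr_gt0 //= gtr_pMr ?pi_gt0 //.
by rewrite ltrBlDr (lt_trans b1) // ltrDl.
Qed.

(** By the product formula for sines, hat is a combination of 1, z and z^-1. *)
Lemma hat_multiplier b : multiplier (fun t => (hat b t)%:C%C).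
Proof.
pose w : C := Complex (cos (pi * b) / 8) (sin (pi * b) / 8).
have -> : (fun t => (hat b t)%:C%C) =
  cst (2^-1 - cos (pi * b) / 4)%:C%C +
  (cst w^* * zn 1 + cst w * zn (- 1)) :> (R -> C).
  apply/funext => t.
  rewrite -cj_zn.
  change ((hat b t)%:C%C = (2^-1 - cos (pi * b) / 4)%:C%C +
    (w^* * zfun t ^ 1 + w * (zfun t ^ 1)^*)).
  rewrite expr1z.
  have E : 2 * pi * t = pi * t + pi * t by ring.
  have cs := cos2Dsin2 (pi * t).
  apply: complexP; rewrite ?(cReD, cImD, cReM, cImM, cRe_conj, cIm_conj) /=.
    rewrite /hat sinB E cosD sinD.
    have -> : cos (pi * b) / 4 = cos (pi * b) * (cos (pi * t) ^+ 2 + sin (pi * t) ^+ 2) / 4.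
      by rewrite cs mulr1.
    by field.
  by field.
apply: multiplierD; first exact: multiplier_cst.
by apply: multiplierD; apply: multiplierM;
  [exact: multiplier_cst|exact: multiplier_zn|exact: multiplier_cst|exact: multiplier_zn].
Qed.

Lemma sharp_multiplier b k : multiplier (fun t => (sharp k (hat b t))%:C%C).
Proof.
have -> : (fun t => (sharp k (hat b t))%:C%C) =
  1 - (1 - (fun t => (hat b t)%:C%C) ^+ k) ^+ (2 ^ k) :> (R -> C).
  apply/funext => t.
  have fX (p : R -> C) (n : nat) : (p ^+ n) t = p t ^+ n.
    by elim: n => [|n IH]; rewrite ?expr0 // !exprS -IH.
  rewrite /sharp rmorphB rmorphXn rmorphB rmorphXn /= rmorph1.
  by rewrite [RHS]/(1 - _ t) fX; congr (1 - (1 - _) ^+ _); rewrite fX.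
by apply/multiplierB1/multiplierX/multiplierB1/multiplierX/hat_multiplier.
Qed.

(** The weights sharp k (hat b t) tend boundedly to the indicator function of
t < b. *)
Lemma int_below (u : R -> R) b : 0 < b < 1 -> measurable_fun setT u ->
  mu.-integrable setT (EFin \o u) ->
  (forall k, \int[mu]_t (sharp k (hat b t) * u t) = 0) ->
  \int[mu]_t below b u t = 0.
Proof.
move=> b01 m_u iu hu.
have mh : measurable_fun setT (hat b).
  have mt : measurable_fun setT (fun t : R => pi * t) by exact: measurable_funM.
  have ms (v : R -> R) : measurable_fun setT v -> measurable_fun setT (fun t => sin (v t)).
    move=> mv; apply: measurableT_comp mv; apply: continuous_measurable_fun.
    exact: continuous_sin.
  apply: measurable_funD => //; apply: measurable_funM => //.
  by apply: measurable_funM; apply: ms => //; exact: measurable_funB.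
have mS k : measurable_fun setT (fun t => sharp k (hat b t)).
  apply: measurable_funB => //; apply: measurable_funX.
  by apply: measurable_funB => //; exact: measurable_funX.
have mSu k : measurable_fun setT (fun t => sharp k (hat b t) * u t).
  exact: measurable_funM.
have mf_ k : measurable_fun setT (EFin \o (fun t => sharp k (hat b t) * u t)).
  by apply/measurable_EFinP; exact: mSu.
have mb : measurable_fun setT (below b u).
  apply: measurable_fun_ifT => //; exact: measurable_fun_ltr.
pose f_ k t := (sharp k (hat b t) * u t)%:E.
have [] := @dominated_convergence _ _ R mu setT measurableT f_
  (EFin \o below b u) (fun t => `|u t|%:E).
- exact: mf_.
- by apply/measurable_EFinP; exact: mb.
- have nb : \forall t \ae mu, t <> b.
    exists [set b]; split => //; last by move=> t /= /contrapT.
    apply/eqP; rewrite eq_le measure_ge0 andbT -(lebesgue_measure_set1 b).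
    rewrite /= /mfrestr /mrestr; apply: le_measure; rewrite ?inE //.
    exact: measurableI.
  apply: aeS2 nb circle_ae_itv => t tb t01 _.
  apply: cvg_EFin; first exact: nearW.
  rewrite /below; case: ltgtP tb => // h _.
    rewrite -[X in _ --> X]mul1r; apply: (@cvgMl _ _ _ _ (fun k => sharp k (hat b t))).
    by apply: sharp_gt; rewrite hat_gt //; have /andP[] := hat01 b t.
  rewrite -[X in _ --> X](mul0r (u t)); apply: (@cvgMl _ _ _ _ (fun k => sharp k (hat b t))).
  by apply: sharp_lt; rewrite hat_lt // andbT; have /andP[] := hat01 b t.
- exact: integrable_norm.
- apply: aeW => t k _; rewrite /f_ /= lee_fin normrM ler_piMl //.
  by have /andP[h0 h1] := sharp01 k (hat01 b t); rewrite ger0_norm.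
move=> ib _ /=.
have -> : (fun k => \int[mu]_t f_ k t)%E = cst 0%E.
  apply/funext => k /=; transitivity (\int[mu]_t (sharp k (hat b t) * u t))%:E; last by rewrite hu.
  rewrite /Rintegral fineK //.
  apply: integrable_fin_num => //.
  apply: (le_integrable measurableT _ _ (integrable_norm iu)).
    exact: mf_.
  move=> t _ /=; rewrite lee_fin normr_id normrM ler_piMl //.
  by have /andP[h0 h1] := sharp01 k (hat01 b t); rewrite ger0_norm.
by move=> /cvg_lim h; rewrite /Rintegral -h // lim_cst.
Qed.

(** If all coefficients of x vanish, so does the integral of p x for every
trigonometric polynomial p.  Those polynomials can be chosen to approximate the
indicator function of [0, b[ boundedly, so that x has integral zero over all
these intervals. *)
Theorem Fourier_uniqueness x : L2 x -> (forall n : int, inner x (zn n) = 0) ->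
  x =ae 0.
Proof.
move=> hx xn.
have key b k : \int[mu]_t (sharp k (hat b t) * re x t) = 0 /\
               \int[mu]_t (sharp k (hat b t) * im x t) = 0.
  have [_ /(_ x (conj hx xn))[_ /(_ 0)]] := sharp_multiplier b k.
  rewrite innerE zn0 cj1 mulr1 => -[e1 e2].
  split; [apply: etrans e1|apply: etrans e2]; congr Rintegral; apply/funext => t.
    by rewrite cReM /= mul0r subr0.
  by rewrite cImM /= mul0r addr0.
have [s1 s2] := hx.
have h1 : re x =ae 0.
  apply: ae0_of_int_below; [exact: sqint_measurable|exact: sqint_integrable|].
  move=> b b01; apply: int_below => //; [exact: sqint_measurable|exact: sqint_integrable|].
  by move=> k; have [] := key b k.
have h2 : im x =ae 0.
  apply: ae0_of_int_below; [exact: sqint_measurable|exact: sqint_integrable|].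
  move=> b b01; apply: int_below => //; [exact: sqint_measurable|exact: sqint_integrable|].
  by move=> k; have [] := key b k.
by apply: aeS2 h1 h2 => t /(_ I) e1 /(_ I) e2 _; exact: complexP.
Qed.

End Uniqueness.

(** * The Hardy projection *)

(** The projection is given by a choice among representatives; locking it keeps
that choice opaque to unification, as is needed for the algebra below. *)
HB.lock Definition hproj {R : realType} (x : R -> R[i]) : R -> R[i] := Pplus x.
Canonical hproj_unlockable := Unlockable hproj.unlock.

HB.lock Definition hcoproj {R : realType} (x : R -> R[i]) : R -> R[i] :=
  x - hproj x.
Canonical hcoproj_unlockable := Unlockable hcoproj.unlock.

HB.lock Definition sing {R : realType} (f g x : R -> R[i]) : R -> R[i] :=
  f * hproj x + g * hcoproj x.
Canonical sing_unlockable := Unlockable sing.unlock.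

HB.lock Definition singadj {R : realType} (f g x : R -> R[i]) : R -> R[i] :=
  hproj (cj f * x) + hcoproj (cj g * x).
Canonical singadj_unlockable := Unlockable singadj.unlock.

(* Projections, conjugates and constant functions are generalized first, as the
   reification of ring would otherwise try to look inside them. *)
Ltac fring := repeat match goal with
    | |- context [hproj ?x] => generalize (hproj x) end;
  repeat match goal with
    | |- context [hcoproj ?x] => generalize (hcoproj x) end;
  repeat match goal with |- context [cj ?x] => generalize (cj x) end;
  repeat match goal with |- context [@cst ?A ?B ?x] => generalize (@cst A B x) end;
  intros; ring.

(* The same for identities between scalars, with inner products as atoms. *)
Ltac cring := repeat match goal with
    |- context [inner ?x ?y] => generalize (inner x y) end; intros; ring.

Ltac linf := lazymatch goal with
  | |- Linfty (cst _) => exact (Linfty_cst _)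
  | |- Linfty (fun=> _) => exact (Linfty_cst _)
  | |- Linfty 1 => exact Linfty1
  | |- Linfty 0 => exact Linfty0
  | |- Linfty (zn _) => exact (Linfty_zn _)
  | |- Linfty (cj _) => apply: Linfty_cj; linf
  | |- Linfty (- _) => apply: LinftyN; linf
  | |- Linfty (_ + _) => apply: LinftyD; linf
  | |- Linfty (_ * _) => apply: LinftyM; linf
  | H : Linfty ?x |- Linfty ?x => exact H
  end.

Ltac l2 := lazymatch goal with
  | |- L2 (cj _) => apply: L2cj; l2
  | |- L2 (- _) => apply: L2N; l2
  | |- L2 (_ + _) => apply: L2D; l2
  | |- L2 (_ * _) => apply: L2M; [linf|l2]
  | |- L2 (hproj _) => auto with l2 nocore
  | |- L2 (hcoproj _) => auto with l2 nocore
  | |- L2 (sing _ _ _) => auto with l2 nocore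
  | |- L2 (singadj _ _ _) => auto with l2 nocore
  | H : L2 ?x |- L2 ?x => exact H
  | H : forall n, L2 (?u n) |- L2 (?u ?m) => exact (H m)
  | |- L2 _ => apply: Linfty_L2; linf
  end.

#[global] Hint Extern 0 (L2 _) => l2 : core.
#[global] Hint Extern 0 (Linfty _) => linf : core.

Section AlmostEverywhere.
Context {R : realType}.
Notation C := R[i].
Implicit Types (x y h : R -> C) (a c : C).

Lemma ae_sym x y : x =ae y -> y =ae x.
Proof. by move=> /aeE h; apply/aeE; apply: aeS h. Qed.

Lemma ae_trans x y w : x =ae y -> y =ae w -> x =ae w.
Proof.
by move=> /aeE h1 /aeE h2; apply/aeE; apply: aeS2 h1 h2 => t -> ->.
Qed.

Lemma aeD x x' y y' : x =ae x' -> y =ae y' -> x + y =ae x' + y'.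
Proof.
move=> /aeE h1 /aeE h2; apply/aeE; apply: aeS2 h1 h2 => t e1 e2.
by rewrite /GRing.add/= e1 e2.
Qed.

Lemma aeM x x' y y' : x =ae x' -> y =ae y' -> x * y =ae x' * y'.
Proof.
move=> /aeE h1 /aeE h2; apply/aeE; apply: aeS2 h1 h2 => t e1 e2.
by rewrite /GRing.mul/= e1 e2.
Qed.

Lemma aeN x x' : x =ae x' -> - x =ae - x'.
Proof.
move=> /aeE h1; apply/aeE; apply: aeS h1 => t e1.
by rewrite /GRing.opp/= e1.
Qed.

Lemma aeB x x' y y' : x =ae x' -> y =ae y' -> x - y =ae x' - y'.
Proof. by move=> h1 h2; apply: aeD => //; exact: aeN. Qed.

Lemma ae_cj x x' : x =ae x' -> cj x =ae cj x'.
Proof. by move=> /aeE h1; apply/aeE; apply: aeS h1 => t e1; rewrite /cj e1. Qed.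

Lemma aeMl b x y : x =ae y -> b * x =ae b * y.
Proof. by move=> h; apply: aeM => //; exact: ae_refl. Qed.

Lemma ae_subr0 x y : x - y =ae 0 <-> x =ae y.
Proof.
split => h.
  have := aeD h (ae_refl y); rewrite subrK add0r //.
by have := aeB h (ae_refl y); rewrite subrr.
Qed.

Lemma inner_ael x x' y : L2 x -> L2 x' -> L2 y -> x =ae x' -> inner x y = inner x' y.
Proof. by move=> *; apply: inner_ae => //; exact: ae_refl. Qed.

Lemma inner_aer x y y' : L2 x -> L2 y -> L2 y' -> y =ae y' -> inner x y = inner x y'.
Proof. by move=> *; apply: inner_ae => //; exact: ae_refl. Qed.

Lemma inner_ext x y : L2 x -> L2 y -> (forall v, L2 v -> inner x v = inner y v) ->
  x =ae y.
Proof.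
move=> hx hy h; apply/ae_subr0; apply: inner_eq0 => //.
by rewrite innerBl // h // subrr.
Qed.

Lemma inner_Mr b x y : inner x (b * y) = inner (cj b * x) y.
Proof. by rewrite inner_Ml cjK. Qed.

End AlmostEverywhere.

Section HardyProjection.
Context {R : realType}.
Notation C := R[i].
Notation P := (@hproj R).
Notation Q := (@hcoproj R).
Implicit Types (x y h : R -> C) (a c : C).

Lemma H2I x : L2 x -> (forall n : int, n < 0 -> inner x (zn n) = 0) -> H2 x.
Proof. by []. Qed.

Lemma H2_L2 x : H2 x -> L2 x. Proof. by case. Qed.

Lemma inner11 : inner (1 : R -> C) 1 = 1.
Proof. by rewrite -zn0 inner_zn. Qed.

Lemma nsq_zn (n : int) : nsq (zn n : R -> C) = 1.
Proof. by rewrite nsqE // inner_zn eqxx. Qed.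

Lemma H2_closed_linear : closed_linear (@H2 R).
Proof.
split.
- by move=> x [].
- by apply: H2I => // n _; rewrite inner0l.
- move=> a x y [hx xn] [hy yn]; split => // n n0.
  change (inner (cst a * x + y) (zn n) = 0).
  have h1 : inner x (zn n) = 0 := xn n n0.
  have h2 : inner y (zn n) = 0 := yn n n0.
  by rewrite innerDl // innerZl // h1 h2 mulr0 addr0.
- move=> x hx xcl; split => // n n0; apply: sqn_eq0.
  apply/eqP; rewrite eq_le sqn_ge0 andbT; apply/ler_addgt0Pr => e e0.
  have [y [hy yn] xy] := xcl e e0.
  have yn0 : inner y (zn n) = 0 := yn n n0.
  rewrite add0r -[x](subrK y).
  change (sqn (inner (x - y + y) (zn n)) <= e).
  rewrite innerDl // yn0 addr0.
  by apply: (le_trans (Cauchy_Schwarz _ _)) => //; rewrite nsq_zn mulr1.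
Qed.

Lemma H2lin a x y : H2 x -> H2 y -> H2 (cst a * x + y).
Proof. exact: (closed_linearP H2_closed_linear). Qed.

Lemma H2D x y : H2 x -> H2 y -> H2 (x + y).
Proof.
move=> hx hy; have := H2lin 1 hx hy.
by rewrite (_ : cst 1 = 1 :> (R -> C)) ?mul1r.
Qed.

Lemma H2_0 : H2 (0 : R -> C). Proof. exact: (closed_linear0 H2_closed_linear). Qed.

Lemma H2Z a x : H2 x -> H2 (cst a * x).
Proof. by move=> hx; have := H2lin a hx H2_0; rewrite addr0. Qed.

Lemma H2N x : H2 x -> H2 (- x).
Proof. by move=> /(H2Z (-1)); rewrite (_ : cst (-1) = -1 :> (R -> C)) ?mulN1r. Qed.

Lemma H2B x y : H2 x -> H2 y -> H2 (x - y).
Proof. by move=> hx hy; apply: H2D => //; exact: H2N. Qed.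

Lemma H2_ae x y : L2 y -> x =ae y -> H2 x -> H2 y.
Proof.
move=> hy xy [hx xn]; apply: H2I => // n n0.
by rewrite -(inner_ael hx hy _ xy) //; exact: xn.
Qed.

Lemma H2_zn (n : nat) : H2 (zn n : R -> C).
Proof.
apply: H2I => // m m0.
by rewrite inner_zn; case: eqP => // E; rewrite -E in m0.
Qed.

Lemma H2_cst a : H2 (cst a : R -> C).
Proof. by rewrite -[cst a]mulr1 -zn0; exact: H2Z (H2_zn 0). Qed.

Lemma hprojP x : L2 x -> H2 (P x) /\ forall h, H2 h -> inner (x - P x) h = 0.
Proof.
move=> hx; rewrite unlock; have [y hy] := projection H2_closed_linear hx.
exact: (@xgetPex _ (fun=> 0) [set y | H2 y /\ forall h, H2 h -> inner (fun t => x t - y t) h = 0]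
  (ex_intro _ y hy)).
Qed.

Lemma H2P x : L2 x -> H2 (P x). Proof. by move=> /hprojP[]. Qed.
Lemma L2P x : L2 x -> L2 (P x). Proof. by move=> /H2P[]. Qed.
Hint Extern 0 (L2 (hproj _)) => (apply: L2P; l2) : l2.

Lemma QE x : Q x = x - P x. Proof. by rewrite unlock. Qed.

Lemma L2Q x : L2 x -> L2 (Q x). Proof. by move=> hx; rewrite QE. Qed.
Hint Extern 0 (L2 (hcoproj _)) => (apply: L2Q; l2) : l2.

Lemma Q_orth x h : L2 x -> H2 h -> inner (Q x) h = 0.
Proof. by rewrite QE => /hprojP[_]; apply. Qed.

Lemma P_unique x y : L2 x -> H2 y -> (forall h, H2 h -> inner (x - y) h = 0) ->
  P x =ae y.
Proof.
move=> hx hy yo; apply/ae_subr0; have [hy' _] := hy; apply: inner_eq0 => //.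
have hd : H2 (P x - y) by apply: H2B => //; exact: H2P.
have -> : inner (P x - y) (P x - y) = inner (x - y) (P x - y) - inner (Q x) (P x - y).
  rewrite -innerBl //; congr (inner _ _).
  by rewrite QE; fring.
by rewrite yo // Q_orth // subrr.
Qed.

Lemma P_ae x y : L2 x -> L2 y -> x =ae y -> P x =ae P y.
Proof.
move=> hx hy xy; apply: P_unique => //; first exact: H2P.
move=> h hh; have [hh' _] := hh; rewrite -(Q_orth hy hh) QE.
by apply: inner_ael => //; apply: aeB => //; exact: ae_refl.
Qed.

Lemma Q_ae x y : L2 x -> L2 y -> x =ae y -> Q x =ae Q y.
Proof. by move=> hx hy xy; rewrite !QE; apply: aeB => //; exact: P_ae. Qed.

Lemma P_lin a x y : L2 x -> L2 y -> P (cst a * x + y) =ae cst a * P x + P y.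
Proof.
move=> hx hy; apply: P_unique => //.
  by apply: H2lin; exact: H2P.
move=> h hh; have [hh' _] := hh.
have -> : cst a * x + y - (cst a * P x + P y) = cst a * Q x + Q y.
  by rewrite !QE; fring.
by rewrite innerDl // innerZl // !Q_orth // mulr0 addr0.
Qed.

Lemma Q_lin a x y : L2 x -> L2 y -> Q (cst a * x + y) =ae cst a * Q x + Q y.
Proof.
move=> hx hy; rewrite !QE.
have -> : cst a * (x - P x) + (y - P y) = cst a * x + y - (cst a * P x + P y) by fring.
by apply: aeB; [exact: ae_refl|exact: P_lin].
Qed.

Lemma inner_PQ x y : L2 x -> L2 y -> inner (P x) (Q y) = 0.
Proof.
move=> hx hy; rewrite innerC //; first by rewrite Q_orth ?rmorph0 //; exact: H2P.
Qed.

Lemma inner_P x y : L2 x -> L2 y -> inner (P x) y = inner x (P y).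
Proof.
move=> hx hy.
have -> : inner (P x) y = inner (P x) (P y).
  by rewrite -[in LHS](subrK (P y) y) innerDr // -QE inner_PQ // add0r.
have /eqP := Q_orth hx (H2P hy); rewrite QE innerBl // subr_eq0 => /eqP ->.
by [].
Qed.

Lemma inner_Q x y : L2 x -> L2 y -> inner (Q x) y = inner x (Q y).
Proof. by move=> hx hy; rewrite !QE innerBl // innerBr // inner_P. Qed.

Lemma nsq_PQ x : L2 x -> nsq x = nsq (P x) + nsq (Q x).
Proof.
move=> hx; rewrite -[in LHS](subrK (P x) x) addrC -QE nsqD // inner_PQ //=.
by rewrite mulr0 addr0.
Qed.

(** Multiplication by z preserves H^2, and the only part of z Q x that falls into
H^2 is its constant term, the coefficient of x at z^-1. *)
Lemma P_shift x : L2 x -> P (zn 1 * x) =ae zn 1 * P x + cst (inner x (zn (-1))).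
Proof.
move=> hx; set c := inner x (zn (-1)).
have [Px _] := hprojP hx; have [_ Pxn] := Px.
apply: P_unique => //.
  apply: H2D; last exact: H2_cst.
  apply: H2I => // n n0.
  rewrite inner_Ml cj_zn -znD; apply: Pxn.
  by rewrite addrC subr_lt0 (lt_trans n0).
move=> h hh; have [hh' hn] := hh.
have -> : zn 1 * x - (zn 1 * P x + cst c) = zn 1 * Q x - cst c * 1.
  by rewrite QE; fring.
rewrite innerBl // innerZl // inner_Ml cj_zn.
set e := inner h 1.
have hw : H2 (zn (-1) * h - cst e * zn (-1)).
  apply: H2I => // n n0.
  rewrite innerBl // innerZl // inner_Ml cj_zn -znD inner_zn.
  have [->|n1] := eqVneq n (-1).
    by rewrite addNr zn0 mulr1 subrr.
  rewrite mulr0 subr0.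
  by apply: hn; move/eqP: n1 => n1; lia.
have -> : zn (-1) * h = (zn (-1) * h - cst e * zn (-1)) + cst e * zn (-1) by fring.
rewrite innerDr // Q_orth // add0r innerZr // QE innerBl //.
rewrite (_ : inner (P x) (zn (-1)) = 0) ?subr0; last exact: Pxn.
by rewrite -/c (innerC hh' (Linfty_L2 Linfty1)) -/e mulrC subrr.
Qed.

Lemma Q_shift x : L2 x -> Q (zn 1 * x) =ae zn 1 * Q x - cst (inner x (zn (-1))).
Proof.
move=> hx; rewrite !QE.
have -> : zn 1 * (x - P x) - cst (inner x (zn (-1))) =
  zn 1 * x - (zn 1 * P x + cst (inner x (zn (-1)))) by fring.
by apply: aeB; [exact: ae_refl|exact: P_shift].
Qed.

End HardyProjection.

#[global] Hint Extern 0 (L2 (hproj _)) => (apply: L2P; l2) : l2.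
#[global] Hint Extern 0 (L2 (hcoproj _)) => (apply: L2Q; l2) : l2.

(** * The singular integral operator and the shift *)

Section SingularIntegral.
Context {R : realType}.
Notation C := R[i].
Notation P := (@hproj R).
Notation Q := (@hcoproj R).
Implicit Types (x y v : R -> C) (a c : C).
Variables f g : R -> C.
Hypotheses (hf : Linfty f) (hg : Linfty g).

Notation S := (sing f g).
Notation T := (singadj f g).

Lemma singE x : S x = f * P x + g * Q x. Proof. by rewrite unlock. Qed.

Lemma singadjE x : T x = P (cj f * x) + Q (cj g * x). Proof. by rewrite unlock. Qed.

Lemma L2_sing x : L2 x -> L2 (S x).
Proof. by move=> hx; rewrite singE. Qed.

Lemma L2_singadj x : L2 x -> L2 (T x).
Proof. by move=> hx; rewrite singadjE. Qed.

Hint Extern 0 (L2 (sing f g _)) => (apply: L2_sing; l2) : l2.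
Hint Extern 0 (L2 (singadj f g _)) => (apply: L2_singadj; l2) : l2.

Lemma singadjP x y : L2 x -> L2 y -> inner (S x) y = inner x (T y).
Proof.
move=> hx hy; rewrite singE singadjE innerDl // innerDr // !inner_Ml.
by rewrite inner_P // inner_Q.
Qed.

Lemma sing_lin a x y : L2 x -> L2 y -> S (cst a * x + y) =ae cst a * S x + S y.
Proof.
move=> hx hy; rewrite !singE.
have -> : cst a * (f * P x + g * Q x) + (f * P y + g * Q y) =
  f * (cst a * P x + P y) + g * (cst a * Q x + Q y) by fring.
by apply: aeD; apply: aeMl; [exact: P_lin|exact: Q_lin].
Qed.

Lemma sing_ae x y : L2 x -> L2 y -> x =ae y -> S x =ae S y.
Proof.
move=> hx hy xy; rewrite !singE.
by apply: aeD; apply: aeMl; [exact: P_ae|exact: Q_ae].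
Qed.

Lemma singadj_lin a x y : L2 x -> L2 y -> T (cst a * x + y) =ae cst a * T x + T y.
Proof.
move=> hx hy; rewrite !singadjE.
have E b : b * (cst a * x + y) = cst a * (b * x) + b * y by fring.
have -> : cst a * (P (cj f * x) + Q (cj g * x)) + (P (cj f * y) + Q (cj g * y)) =
  (cst a * P (cj f * x) + P (cj f * y)) + (cst a * Q (cj g * x) + Q (cj g * y)) by fring.
by rewrite !E; apply: aeD; [exact: P_lin|exact: Q_lin].
Qed.

Lemma singadj_ae x y : L2 x -> L2 y -> x =ae y -> T x =ae T y.
Proof.
move=> hx hy xy; rewrite !singadjE.
by apply: aeD; [apply: P_ae|apply: Q_ae] => //; exact: aeMl.
Qed.

Lemma sing_shift y : L2 y ->
  S (zn 1 * y) =ae zn 1 * S y + cst (inner y (zn (-1))) * (f - g).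
Proof.
move=> hy; rewrite !singE; set c := cst _.
have -> : zn 1 * (f * P y + g * Q y) + c * (f - g) =
  f * (zn 1 * P y + c) + g * (zn 1 * Q y - c) by fring.
by apply: aeD; apply: aeMl; [exact: P_shift|exact: Q_shift].
Qed.

Lemma singadj_shift y : L2 y ->
  T (zn 1 * y) =ae zn 1 * T y + cst (inner y (zn (-1) * (f - g))).
Proof.
move=> hy; rewrite !singadjE.
have E b : b * (zn 1 * y) = zn 1 * (b * y) by fring.
rewrite !E.
have -> : cst (inner y (zn (-1) * (f - g))) =
  cst (inner (cj f * y) (zn (-1))) - cst (inner (cj g * y) (zn (-1))) :> (R -> C).
  rewrite mulrBr innerBr // !(mulrC (zn (-1))) !inner_Mr.
  by apply/funext.
set c := cst _; set d := cst _.
have -> : zn 1 * (P (cj f * y) + Q (cj g * y)) + (c - d) =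
  (zn 1 * P (cj f * y) + c) + (zn 1 * Q (cj g * y) - d) by fring.
by apply: aeD; [exact: P_shift|exact: Q_shift].
Qed.

Lemma P_cst a : P (cst a) =ae cst a.
Proof.
by apply: P_unique => //; [exact: H2_cst|move=> h [hh _]; rewrite subrr inner0l].
Qed.

Lemma sing_cst a : S (cst a) =ae cst a * f.
Proof.
have h := @P_cst a.
rewrite singE QE.
have -> : cst a * f = f * cst a + g * (cst a - cst a) by fring.
apply: aeD; apply: aeMl => //.
by apply: aeB => //; exact: ae_refl.
Qed.

(** The form <(S T S - T S S) y, v>, moved to the right by adjunction so that
both sides of the shift identity are visible. *)
Definition qdefect y v := inner (T (S y)) (T v) - inner (S (S y)) (S v).

Notation h := (f - g).
Notation F := (T f).
Notation G := (T g).
Notation U := (T 1).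
Notation H := (T h).

(** With y0 = z^-1 y and v0 = z^-1 v, the shift formulas express S y, T S y,
S S y, S v and T v through the same vectors for y0 and v0 up to rank one terms;
<y, 1> = 0 removes the one in S y.  Expanding the two inner products leaves
qdefect y0 v0 and a form of finite rank. *)
Theorem qdefect_shift y v : L2 y -> L2 v -> inner y 1 = 0 ->
  qdefect y v = qdefect (zn (-1) * y) (zn (-1) * v)
    + inner y F * inner f v - inner y G * inner g v - inner y U * inner H v
    - inner y (T H - cst (inner h h) * U) * inner 1 v.
Proof.
move=> hy hv y1.
have [d dE] : {d | d = f - g} by exists (f - g).
rewrite -dE.
have hd : Linfty d by rewrite dE.
pose y0 : R -> C := zn (-1) * y; pose v0 : R -> C := zn (-1) * v.
rewrite -/y0 -/v0.
have zK (w : R -> C) : zn 1 * (zn (-1) * w) = w by rewrite mulrA -znD subrr zn0 mul1r.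
have hy0 : L2 y0 by rewrite /y0.
have hv0 : L2 v0 by rewrite /v0.
have iz (w w' : R -> C) : inner (zn (-1) * w) (zn (-1) * w') = inner w w'.
  by rewrite inner_Ml cj_zn opprK zK.
have iz' (w w' : R -> C) : inner (zn 1 * w) (zn 1 * w') = inner w w'.
  by rewrite inner_Ml cj_zn mulrA -znD addNr zn0 mul1r.
have izm (w : R -> C) : inner w (zn (-1)) = inner (zn 1 * w) 1.
  by rewrite inner_Ml mulr1 cj_zn.
have S1 : S 1 =ae f by have := sing_cst 1; rewrite (_ : cst 1 = 1) ?mul1r.
(* the shift intertwines S up to a finite rank correction *)
have Sy : S y =ae zn 1 * S y0.
  have := sing_shift hy0; rewrite -dE /y0 zK izm zK y1.
  by rewrite (_ : cst 0 = 0) // mul0r addr0.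
have Sv : S v =ae zn 1 * S v0 + cst (inner v 1) * d.
  by have := sing_shift hv0; rewrite -dE /v0 zK izm zK.
have Tv : T v =ae zn 1 * T v0 + cst (inner v d).
  by have := singadj_shift hv0; rewrite -dE /v0 zK iz.
have TSy : T (S y) =ae zn 1 * T (S y0) + cst (inner y (T d)).
  have e1 : T (S y) =ae T (zn 1 * S y0) by apply: singadj_ae.
  apply: (ae_trans e1); have := singadj_shift (L2_sing hy0); rewrite -dE.
  suff -> : inner (S y0) (zn (-1) * d) = inner y (T d) by [].
  by rewrite inner_Mr cj_zn opprK -(inner_ael (L2_sing hy) _ _ Sy) // singadjP.
have SSy : S (S y) =ae zn 1 * S (S y0) + cst (inner y U) * d.
  have e1 : S (S y) =ae S (zn 1 * S y0) by apply: sing_ae.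
  apply: (ae_trans e1); have := sing_shift (L2_sing hy0); rewrite -dE.
  suff -> : inner (S y0) (zn (-1)) = inner y U by [].
  by rewrite izm -(inner_ael (L2_sing hy) _ _ Sy) // singadjP.
have i1 (a : C) (w : R -> C) : L2 w -> inner (cst a) w = a * inner 1 w.
  by move=> hw; rewrite -innerZl // mulr1.
have yH : inner y (T d) = inner y F - inner y G.
  by rewrite -!singadjP // dE (innerBr (L2_sing hy) (Linfty_L2 hf) (Linfty_L2 hg)).
have TS w : L2 w -> inner 1 (T w) = inner f w.
  by move=> hw; rewrite -singadjP // (inner_ael _ _ _ S1).
have E1 : inner (zn 1 * T (S y0)) 1 = inner y G.
  have e : inner (T (S y)) 1 = inner (zn 1 * T (S y0)) 1 + inner y (T d).
    rewrite (inner_ael _ _ _ TSy) // innerDl // i1 //.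
    by rewrite inner11 mulr1.
  have e' : inner (T (S y)) 1 = inner y F.
    rewrite innerC // TS // -innerC // singadjP //.
  by apply: (addIr (inner y (T d))); rewrite -e e' yH addrC subrK.
have E2 : inner (zn 1 * S (S y0)) d = inner y (T (T d)) - inner y U * inner d d.
  have e : inner (S (S y)) d = inner (zn 1 * S (S y0)) d + inner y U * inner d d.
    by rewrite (inner_ael _ _ _ SSy) // innerDl // innerZl.
  have e' : inner (S (S y)) d = inner y (T (T d)) by rewrite !singadjP.
  by rewrite -e' e addrK.
rewrite /qdefect.
have -> : inner (T (S y)) (T v) =
    inner (T (S y0)) (T v0) + inner d v * inner y G + inner y (T d) * inner f v.
  rewrite (inner_ael _ _ _ TSy) // innerDl // i1 // TS //; congr (_ + _).
  rewrite (inner_aer _ _ _ Tv) // innerDr // iz'; congr (_ + _).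
  by rewrite -[cst _]mulr1 innerZr // E1 -innerC.
have -> : inner (S (S y)) (S v) =
    inner (S (S y0)) (S v0) + inner 1 v * (inner y (T (T d)) - inner y U * inner d d)
    + inner y U * inner (T d) v.
  have hSv : inner d (S v) = inner (T d) v.
    by rewrite innerC // singadjP // -innerC.
  rewrite (inner_ael _ _ _ SSy) // innerDl // innerZl // hSv; congr (_ + _).
  rewrite (inner_aer _ _ _ Sv) // innerDr // iz'; congr (_ + _).
  by rewrite innerZr // E2 -innerC.
have hfg : inner d v = inner f v - inner g v by rewrite dE innerBl.
rewrite innerBr // innerZr // yH hfg.
have hN : (inner d d)^* = inner d d by rewrite -innerC.
by rewrite hN; cring.
Qed.

End SingularIntegral.

#[global] Hint Extern 0 (L2 (sing _ _ _)) => (apply: L2_sing; [linf|linf|l2]) : l2.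
#[global] Hint Extern 0 (L2 (singadj _ _ _)) => (apply: L2_singadj; [linf|linf|l2]) : l2.


(** * Asymptotics along powers of the shift *)

Section Bounds.
Context {R : realType}.
Notation mu := (circle R).
Notation C := R[i].
Implicit Types (x y v b : R -> C) (a c : C).

Lemma nsq_ae x y : L2 x -> L2 y -> x =ae y -> nsq x = nsq y.
Proof. by move=> hx hy xy; rewrite !nsqE // (inner_ae _ _ _ _ xy xy). Qed.

Lemma nsqD_le x y : L2 x -> L2 y -> nsq (x + y) <= 2 * nsq x + 2 * nsq y.
Proof.
move=> hx hy; rewrite -subr_ge0 (_ : _ - _ = nsq (x - y)) ?nsq_ge0 //.
by rewrite nsqD // nsqB //; ring.
Qed.

Lemma rnsq_bounded (b : R -> R) : bounded_ae b ->
  exists2 K : R, 0 <= K & forall u, sqint u -> rnsq (b * u) <= K * rnsq u.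
Proof.
move=> hb; have [mb [M bM]] := hb; exists (M ^+ 2); first exact: sqr_ge0.
move=> u su; have [m_u iu] := (sqintP u).1 su.
have [mbu ibu] := (sqintP _).1 (sqintM hb su).
rewrite /rnsq -RintegralZl // /Rintegral fine_le //.
- exact: integrable_fin_num.
- exact: (integrable_fin_num _ (rintZ (M ^+ 2) iu)).
apply: ae_ge0_le_integral => //=.
- by move=> t _; rewrite lee_fin sqr_ge0.
- exact: measurable_int ibu.
- by move=> t _; rewrite lee_fin mulr_ge0 // sqr_ge0.
- exact: (measurable_int _ (rintZ (M ^+ 2) iu)).
- apply: aeS bM => t bt _; rewrite lee_fin.
  rewrite [X in X ^+ 2 <= _](_ : _ = b t * u t) // exprMn ler_wpM2r ?sqr_ge0 //.
  by rewrite -real_normK ?num_real // lerXn2r ?nnegrE // (le_trans _ bt).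
Qed.

Lemma rnsqD_le (u w : R -> R) : sqint u -> sqint w ->
  rnsq (u + w) <= 2 * rnsq u + 2 * rnsq w.
Proof.
move=> su sw; have [m_u iu] := (sqintP u).1 su; have [mw iw] := (sqintP w).1 sw.
have [_ iuw] := (sqintP _).1 (sqintD su sw).
rewrite /rnsq -!RintegralZl // -RintegralD //; try exact: rintZ.
apply: le_Rintegral => //.
  by apply: rintD; exact: rintZ.
move=> t _; rewrite [X in X ^+ 2 <= _](_ : _ = u t + w t) // -subr_ge0.
have -> : 2 * u t ^+ 2 + 2 * w t ^+ 2 - (u t + w t) ^+ 2 = (u t - w t) ^+ 2 by ring.
exact: sqr_ge0.
Qed.

Lemma nsq_mul_bounded b : Linfty b ->
  exists2 K : R, 0 <= K & forall x, L2 x -> nsq (b * x) <= K * nsq x.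
Proof.
rewrite LinftyE => -[/[dup] b1 /rnsq_bounded[K1 K10 h1] /[dup] b2 /rnsq_bounded[K2 K20 h2]].
exists (2 * (K1 + K2)); first by rewrite mulr_ge0 // addr_ge0.
move=> x [s1 s2].
have e1 : nsq x = rnsq (re x) + rnsq (im x) by [].
have -> : nsq (b * x) = rnsq (re b * re x + - im b * im x) + rnsq (re b * im x + im b * re x).
  by rewrite -imM mulNr -reM.
have b2' : forall u, sqint u -> rnsq (- im b * u) = rnsq (im b * u).
  move=> u su; rewrite /rnsq; congr Rintegral; apply/funext => t.
  by rewrite [X in X ^+ 2 = _](_ : _ = - (im b t * u t)) ?sqrrN //; exact: mulNr.
have := rnsqD_le (sqintM b1 s1) (sqintM (bounded_aeN b2) s2).
have := rnsqD_le (sqintM b1 s2) (sqintM b2 s1).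
rewrite e1 b2' //.
have := h1 _ s1; have := h1 _ s2; have := h2 _ s1; have := h2 _ s2.
move=> *; lra.
Qed.

(** Convergence to 0 in L^2, in squared norm. *)
Definition vanishing (u : nat -> R -> C) := forall e : R, 0 < e ->
  exists n0 : nat, forall n, (n0 <= n)%N -> nsq (u n) <= e.

Lemma vanishing_le (K : R) (u w : nat -> R -> C) : 0 <= K ->
  (forall n, nsq (w n) <= K * nsq (u n)) -> vanishing u -> vanishing w.
Proof.
move=> K0 wu vu e e0.
have K1 : 0 < K + 1 by rewrite ltr_wpDl.
have [n0 h] := vu (e / (K + 1)) (divr_gt0 e0 K1).
exists n0 => n /h un; apply: (le_trans (wu n)).
apply: (@le_trans _ _ (K * (e / (K + 1)))); first by rewrite ler_wpM2l.
by rewrite mulrA ler_pdivrMr // mulrDr mulr1 mulrC lerDl ltW.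
Qed.

Lemma vanishing_ae (u w : nat -> R -> C) : (forall n, L2 (u n)) ->
  (forall n, L2 (w n)) -> (forall n, u n =ae w n) -> vanishing u -> vanishing w.
Proof.
move=> hu hw uw; apply: (@vanishing_le 1) => // n.
by rewrite mul1r (nsq_ae _ _ (uw n)).
Qed.

Lemma vanishingD (u w : nat -> R -> C) : (forall n, L2 (u n)) ->
  (forall n, L2 (w n)) -> vanishing u -> vanishing w ->
  vanishing (fun n => u n + w n).
Proof.
move=> hu hw vu vw e e0.
have e4 : 0 < e / 4 by rewrite divr_gt0.
have [n1 h1] := vu _ e4; have [n2 h2] := vw _ e4.
exists (maxn n1 n2) => n; rewrite geq_max => /andP[/h1 un /h2 wn].
by apply: (le_trans (nsqD_le (hu n) (hw n))); lra.
Qed.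

Lemma vanishingN (u : nat -> R -> C) : (forall n, L2 (u n)) ->
  vanishing u -> vanishing (fun n => - u n).
Proof.
by move=> hu; apply: (@vanishing_le 1) => // n; rewrite mul1r nsqN.
Qed.

(** The vectors x along which the contractions A n vanish form a closed subspace.
If it contains all characters it is the whole of L^2: whatever is orthogonal to
it has only zero Fourier coefficients. *)
Lemma vanishing_density (A : nat -> (R -> C) -> (R -> C)) :
  (forall n x, L2 x -> L2 (A n x)) ->
  (forall n a x y, L2 x -> L2 y -> A n (cst a * x + y) =ae cst a * A n x + A n y) ->
  (forall n x, L2 x -> nsq (A n x) <= nsq x) ->
  (forall j : int, vanishing (fun n => A n (zn j))) ->
  forall x, L2 x -> vanishing (fun n => A n x).
Proof.
move=> hA Alin Ale Az.
have AB n x y : L2 x -> L2 y -> A n x =ae A n (x - y) + A n y.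
  move=> hx hy; rewrite -[in X in X =ae _](subrK y x).
  have := Alin n 1 (x - y) y; rewrite (_ : cst 1 = 1) // !mul1r; apply=> //.
pose M := [set x : R -> C | L2 x /\ vanishing (fun n => A n x)].
have clM : closed_linear M.
  split.
  - by move=> x [].
  - split => //.
    have h0 : L2 (0 : R -> C) by exact: Linfty_L2 Linfty0.
    have n0 : nsq (0 : R -> C) = 0 by rewrite nsqE // inner0l.
    move=> e e0; exists 0 => n _.
    by apply: (le_trans (Ale n _ h0)); rewrite n0 ltW.
  - move=> a x y [hx vx] [hy vy]; split => //.
    apply: (@vanishing_ae (fun n => cst a * A n x + A n y)) => [n|n|n|].
    + by apply: L2D; [apply: L2Z|]; exact: hA.
    + by apply: hA.
    + by apply: ae_sym; exact: Alin.
    + apply: vanishingD => [n|n||] //; [by apply/L2Z/hA|exact: hA|].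
      apply: (@vanishing_le (sqn a)) vx => [|n]; first exact: sqn_ge0.
      by rewrite nsqZ //; exact: hA.
  - move=> x hx xcl; split => // e e0.
    have e4 : 0 < e / 4 by rewrite divr_gt0.
    have [y [hy vy] xy] := xcl _ e4; have [n0 h] := vy _ e4.
    exists n0 => n /h yn.
    have hxy : L2 (x - y) by [].
    have ha := hA n _ hxy; have hb := hA n _ hy.
    rewrite (nsq_ae (hA n _ hx) _ (AB n x y hx hy)) //.
    apply: (le_trans (nsqD_le ha hb)).
    have := Ale n _ hxy; lra.
move=> x hx; have [y [[hy vy] xy]] := projection clM hx.
have x_y : x - y =ae 0.
  apply: Fourier_uniqueness => // n; apply: xy; split => //.
have hxy : L2 (x - y) by [].
have n0 : nsq (x - y) = 0.
  have h0 : L2 (0 : R -> C) by exact: Linfty_L2 Linfty0.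
  by rewrite (nsq_ae hxy h0 x_y) nsqE // inner0l.
apply: (@vanishing_ae (fun n => A n (x - y) + A n y)) => [n|n|n|].
- by apply: L2D; exact: hA.
- exact: hA.
- by apply: ae_sym; exact: AB.
- apply: vanishingD => [n|n||]; [exact: hA|exact: hA| |exact: vy].
  by move=> e e0; exists 0 => n _; apply: (le_trans (Ale n _ hxy)); rewrite n0 ltW.
Qed.

Lemma nsq_zn_mul (n : int) x : L2 x -> nsq (zn n * x) = nsq x.
Proof.
by move=> hx; rewrite !nsqE // inner_Ml cj_zn mulrA znN mul1r.
Qed.

Lemma nsq_P_le x : L2 x -> nsq (hproj x) <= nsq x.
Proof. by move=> hx; rewrite (nsq_PQ hx) lerDl nsq_ge0. Qed.

Lemma nsq_Q_le x : L2 x -> nsq (hcoproj x) <= nsq x.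
Proof. by move=> hx; rewrite (nsq_PQ hx) lerDr nsq_ge0. Qed.

Lemma Q_H2 x : H2 x -> hcoproj x =ae 0.
Proof.
move=> hx; have [hx' _] := hx; rewrite QE; apply/ae_subr0/ae_sym.
by apply: P_unique => // h [hh _]; rewrite subrr inner0l.
Qed.

Lemma P_zn_neg (n : int) : n < 0 -> hproj (zn n : R -> C) =ae 0.
Proof.
move=> n0; apply: P_unique => //; first exact: H2_0.
move=> h [hh hn]; rewrite subr0 innerC // (_ : inner h (zn n) = 0) ?rmorph0 //.
exact: hn.
Qed.

Lemma vanishing_near (u : nat -> R -> C) (n0 : nat) : (forall n, L2 (u n)) ->
  (forall n, (n0 <= n)%N -> u n =ae 0) -> vanishing u.
Proof.
move=> hu u0 e e0; exists n0 => n /u0 un.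
by rewrite (nsq_ae (hu n) (Linfty_L2 Linfty0) un) nsqE // inner0l // ltW.
Qed.

(** On a character, Q (z^n z^j) is zero as soon as n + j >= 0. *)
Lemma vanishing_Q x : L2 x -> vanishing (fun n => hcoproj (zn n%:Z * x)).
Proof.
apply: (vanishing_density (A := fun n x => hcoproj (zn n%:Z * x))).
- by move=> n y hy.
- move=> n a y w hy hw; rewrite mulrDr mulrCA; exact: Q_lin.
- by move=> n y hy; rewrite -[leRHS](nsq_zn_mul n) //; exact: nsq_Q_le.
- move=> j; apply: (@vanishing_near _ (absz j)) => n; first by [].
  move=> jn; rewrite -znD; apply: Q_H2.
  rewrite (_ : n%:Z + j = absz (n%:Z + j)); first exact: H2_zn.
  by lia.
Qed.

Lemma vanishing_P x : L2 x -> vanishing (fun n => hproj (zn (- n%:Z) * x)).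
Proof.
apply: (vanishing_density (A := fun n x => hproj (zn (- n%:Z) * x))).
- by move=> n y hy.
- move=> n a y w hy hw; rewrite mulrDr mulrCA; exact: P_lin.
- by move=> n y hy; rewrite -[leRHS](nsq_zn_mul (- n%:Z)) //; exact: nsq_P_le.
- move=> j; apply: (@vanishing_near _ (absz j).+1) => n; first by [].
  by move=> jn; rewrite -znD; apply: P_zn_neg; lia.
Qed.

End Bounds.
Section Asymptotics.
Context {R : realType}.
Notation C := R[i].
Notation P := (@hproj R).
Notation Q := (@hcoproj R).
Implicit Types (x y v b : R -> C) (a c : C).

Definition tends0 (u : nat -> C) := forall e : R, 0 < e ->
  exists n0 : nat, forall n, (n0 <= n)%N -> sqn (u n) <= e.

Lemma tends0D u w : tends0 u -> tends0 w -> tends0 (fun n => u n + w n).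
Proof.
move=> hu hw e e0; have e4 : 0 < e / 4 by rewrite divr_gt0.
have [n1 h1] := hu _ e4; have [n2 h2] := hw _ e4.
exists (maxn n1 n2) => n; rewrite geq_max => /andP[/h1 un /h2 wn].
by apply: (le_trans (sqnD_le _ _)); lra.
Qed.

Lemma tends0N u : tends0 u -> tends0 (fun n => - u n).
Proof.
move=> hu e /hu[n0 h]; exists n0 => n /h.
by case: (u n) => ? ?; rewrite /sqn /= !sqrrN.
Qed.

Lemma tends0_cst a : tends0 (fun=> a) -> a = 0.
Proof.
move=> ha; apply: sqn_eq0; apply/eqP; rewrite eq_le sqn_ge0 andbT.
by apply/ler_addgt0Pr => e /ha[n0 /(_ n0 (leqnn _))]; rewrite add0r.
Qed.

Lemma tends0_inner (K : R) (u w : nat -> R -> C) : 0 <= K ->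
  (forall n, L2 (u n)) -> (forall n, L2 (w n)) ->
  (forall n, nsq (w n) <= K) -> vanishing u ->
  tends0 (fun n => inner (u n) (w n)).
Proof.
move=> K0 hu hw wK vu e e0.
have K1 : 0 < K + 1 by rewrite ltr_wpDl.
have [n0 h] := vu (e / (K + 1)) (divr_gt0 e0 K1).
exists n0 => n /h un; apply: (le_trans (Cauchy_Schwarz (hu n) (hw n))).
apply: (@le_trans _ _ (e / (K + 1) * (K + 1))); last by rewrite divfK ?gt_eqF.
apply: ler_pM; rewrite ?nsq_ge0 //.
by apply: (le_trans (wK n)); rewrite lerDl.
Qed.

Lemma tends0_conj u w : (forall n, w n = (u n)^*) -> tends0 u -> tends0 w.
Proof.
move=> E hu e /hu[n0 h]; exists n0 => n /h; rewrite E.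
by case: (u n) => ? ?; rewrite /sqn /= sqrrN.
Qed.

Lemma tends0_innerB (K : R) (u u' w w' : nat -> R -> C) : 0 <= K ->
  (forall n, L2 (u n)) -> (forall n, L2 (u' n)) ->
  (forall n, L2 (w n)) -> (forall n, L2 (w' n)) ->
  (forall n, nsq (u' n) <= K) -> (forall n, nsq (w n) <= K) ->
  vanishing (fun n => u n - u' n) -> vanishing (fun n => w n - w' n) ->
  tends0 (fun n => inner (u n) (w n) - inner (u' n) (w' n)).
Proof.
move=> K0 hu hu' hw hw' uK wK vu vw.
have h1 : tends0 (fun n => inner (u n - u' n) (w n)).
  by apply: (tends0_inner K0) => // n; apply: L2B.
have h2 : tends0 (fun n => inner (u' n) (w n - w' n)).
  apply: (@tends0_conj (fun n => inner (w n - w' n) (u' n))) => [n|].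
    by apply: innerC => //; apply: L2B.
  by apply: (tends0_inner K0) => // n; apply: L2B.
have := tends0D h1 h2; congr tends0; apply/funext => n.
rewrite innerBl // innerBr //.
by cring.
Qed.

Variables f g : R -> C.
Hypotheses (hf : Linfty f) (hg : Linfty g).
Notation S := (sing f g).
Notation T := (singadj f g).

Lemma sing_bounded : exists2 K : R, 0 <= K & forall x, L2 x -> nsq (S x) <= K * nsq x.
Proof.
have [K1 K10 h1] := nsq_mul_bounded hf; have [K2 K20 h2] := nsq_mul_bounded hg.
exists (2 * K1 + 2 * K2); first by rewrite addr_ge0 // mulr_ge0.
move=> x hx; rewrite singE.
have a1 : L2 (f * P x) by []. have a2 : L2 (g * Q x) by [].
apply: (le_trans (nsqD_le a1 a2)).
have hP : nsq (f * P x) <= K1 * nsq x.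
  by apply: le_trans (h1 _ _) _ => //; rewrite ler_wpM2l // nsq_P_le.
have hQ : nsq (g * Q x) <= K2 * nsq x.
  by apply: le_trans (h2 _ _) _ => //; rewrite ler_wpM2l // nsq_Q_le.
lra.
Qed.

Lemma singadj_bounded : exists2 K : R, 0 <= K & forall x, L2 x -> nsq (T x) <= K * nsq x.
Proof.
have [K1 K10 h1] := nsq_mul_bounded (Linfty_cj hf).
have [K2 K20 h2] := nsq_mul_bounded (Linfty_cj hg).
exists (2 * K1 + 2 * K2); first by rewrite addr_ge0 // mulr_ge0.
move=> x hx; rewrite singadjE.
have a1 : L2 (P (cj f * x)) by []. have a2 : L2 (Q (cj g * x)) by [].
apply: (le_trans (nsqD_le a1 a2)).
have hP : nsq (P (cj f * x)) <= K1 * nsq x.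
  by apply: le_trans (nsq_P_le _) _ => //; exact: h1.
have hQ : nsq (Q (cj g * x)) <= K2 * nsq x.
  by apply: le_trans (nsq_Q_le _) _ => //; exact: h2.
lra.
Qed.

Notation qdefect := (qdefect f g).

(** Here e_ n is n or - n and b is f or g accordingly.  Along these powers S and T
become multiplication by b and b^*, for which the two inner products in qdefect
agree, since multiplications commute. *)
Lemma qdefect_tends0 b (e_ : nat -> int) x v : Linfty b -> L2 x -> L2 v ->
  (forall w, L2 w -> vanishing (fun n => S (zn (e_ n) * w) - b * (zn (e_ n) * w))) ->
  (forall w, L2 w -> vanishing (fun n => T (zn (e_ n) * w) - cj b * (zn (e_ n) * w))) ->
  tends0 (fun n => qdefect (zn (e_ n) * x) (zn (e_ n) * v)).
Proof.
move=> hb hx hv vS vT.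
have [KS KS0 hKS] := sing_bounded; have [KT KT0 hKT] := singadj_bounded.
pose X n : R -> C := zn (e_ n) * x; pose V n : R -> C := zn (e_ n) * v.
have hX n : L2 (X n) by rewrite /X.
have hV n : L2 (V n) by rewrite /V.
have zC (p w : R -> C) n : p * (zn n * w) = zn n * (p * w) by ring.
have nX (p : R -> C) n : Linfty p -> nsq (p * (zn (e_ n) * x)) = nsq (p * x).
  by move=> hp; rewrite zC nsq_zn_mul.
have Tsplit (u w : R -> C) : L2 u -> L2 w -> T u =ae T (u - w) + T w.
  move=> hu hw; rewrite -[in X in X =ae _](subrK w u).
  have := singadj_lin hf hg 1 (x := u - w) (y := w).
  by rewrite (_ : cst 1 = 1) // !mul1r; apply.
have Ssplit (u w : R -> C) : L2 u -> L2 w -> S u =ae S (u - w) + S w.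
  move=> hu hw; rewrite -[in X in X =ae _](subrK w u).
  have := @sing_lin _ f g 1 (u - w) w.
  by rewrite (_ : cst 1 = 1) // !mul1r; apply.
have vTS : vanishing (fun n => T (S (X n)) - cj b * (b * X n)).
  apply: (@vanishing_ae _ (fun n => T (S (X n) - b * X n) +
     (T (zn (e_ n) * (b * x)) - cj b * (zn (e_ n) * (b * x))))) => [n|n|n|] //.
    rewrite -!zC -/(X n) addrA; apply: aeB; last exact: ae_refl.
    by apply: ae_sym; exact: Tsplit.
  apply: vanishingD => [n|n||] //; last exact: vT.
  by apply: (vanishing_le KT0 _ (vS x hx)) => n; apply: hKT.
have vSS : vanishing (fun n => S (S (X n)) - b * (b * X n)).
  apply: (@vanishing_ae _ (fun n => S (S (X n) - b * X n) +
     (S (zn (e_ n) * (b * x)) - b * (zn (e_ n) * (b * x))))) => [n|n|n|] //.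
    rewrite -!zC -/(X n) addrA; apply: aeB; last exact: ae_refl.
    by apply: ae_sym; exact: Ssplit.
  apply: vanishingD => [n|n||] //; last exact: vS.
  by apply: (vanishing_le KS0 _ (vS x hx)) => n; apply: hKS.
have t1 : tends0 (fun n => inner (T (S (X n))) (T (V n)) -
    inner (cj b * (b * X n)) (cj b * V n)).
  apply: (@tends0_innerB (nsq (cj b * (b * x)) + KT * nsq v)) => // [|n|n|].
  - by rewrite addr_ge0 ?mulr_ge0 ?nsq_ge0.
  - by rewrite /X mulrA nX // -mulrA lerDl mulr_ge0 ?nsq_ge0.
  - apply: (le_trans (hKT _ (hV n))).
    by rewrite /V nsq_zn_mul // lerDr nsq_ge0.
  - exact: vT.
have t2 : tends0 (fun n => inner (S (S (X n))) (S (V n)) -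
    inner (b * (b * X n)) (b * V n)).
  apply: (@tends0_innerB (nsq (b * (b * x)) + KS * nsq v)) => // [|n|n|].
  - by rewrite addr_ge0 ?mulr_ge0 ?nsq_ge0.
  - by rewrite /X mulrA nX // -mulrA lerDl mulr_ge0 ?nsq_ge0.
  - apply: (le_trans (hKS _ (hV n))).
    by rewrite /V nsq_zn_mul // lerDr nsq_ge0.
  - exact: vS.
have := tends0D t1 (tends0N t2); congr tends0; apply/funext => n.
rewrite /qdefect -/(X n) -/(V n).
have -> : inner (cj b * (b * X n)) (cj b * V n) = inner (b * (b * X n)) (b * V n).
  rewrite [LHS]inner_Ml cjK [RHS]inner_Ml; congr inner; ring.
by cring.
Qed.

Lemma singBf x : L2 x -> S x - f * x = (g - f) * Q x.
Proof. by move=> hx; rewrite singE QE; fring. Qed.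

Lemma singBg x : L2 x -> S x - g * x = (f - g) * P x.
Proof. by move=> hx; rewrite singE QE; fring. Qed.

Lemma singadjBf x : T x - cj f * x = Q (cj g * x) - Q (cj f * x).
Proof. by rewrite singadjE [Q (cj f * x)]QE; fring. Qed.

Lemma singadjBg x : T x - cj g * x = P (cj f * x) - P (cj g * x).
Proof. by rewrite singadjE QE; fring. Qed.

Lemma vanishing_mul b (u : nat -> R -> C) : Linfty b -> (forall n, L2 (u n)) ->
  vanishing u -> vanishing (fun n => b * u n).
Proof.
move=> /nsq_mul_bounded[K K0 hK] hu; apply: (vanishing_le K0) => n; exact: hK.
Qed.

Lemma qdefect_zn_pos x v : L2 x -> L2 v ->
  tends0 (fun n : nat => qdefect (zn n * x) (zn n * v)).
Proof.
move=> hx hv; apply: (@qdefect_tends0 f (fun n : nat => n%:Z)) => // w hw.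
  have -> : (fun n : nat => S (zn n * w) - f * (zn n * w)) = (fun n : nat => (g - f) * Q (zn n * w)).
    by apply/funext => n; rewrite singBf.
  by apply: vanishing_mul => //; exact: vanishing_Q.
have -> : (fun n : nat => T (zn n * w) - cj f * (zn n * w)) =
    (fun n : nat => Q (zn n * (cj g * w)) + - Q (zn n * (cj f * w))).
  by apply/funext => n; rewrite singadjBf !(mulrCA _ (zn n)).
apply: vanishingD => //; first exact: vanishing_Q.
by apply: vanishingN => //; exact: vanishing_Q.
Qed.

Lemma qdefect_zn_neg x v : L2 x -> L2 v ->
  tends0 (fun n : nat => qdefect (zn (- n%:Z) * x) (zn (- n%:Z) * v)).
Proof.
move=> hx hv; apply: (@qdefect_tends0 g (fun n : nat => - n%:Z)) => // w hw.
  have -> : (fun n : nat => S (zn (- n%:Z) * w) - g * (zn (- n%:Z) * w)) =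
      (fun n : nat => (f - g) * P (zn (- n%:Z) * w)).
    by apply/funext => n; rewrite singBg.
  by apply: vanishing_mul => //; exact: vanishing_P.
have -> : (fun n : nat => T (zn (- n%:Z) * w) - cj g * (zn (- n%:Z) * w)) =
    (fun n : nat => P (zn (- n%:Z) * (cj f * w)) + - P (zn (- n%:Z) * (cj g * w))).
  by apply/funext => n; rewrite singadjBg !(mulrCA _ (zn (- n%:Z))).
apply: vanishingD => //; first exact: vanishing_P.
by apply: vanishingN => //; exact: vanishing_P.
Qed.

End Asymptotics.

(** * Quasinormality as a condition of finite rank *)

Section Quasinormal.
Context {R : realType}.
Notation C := R[i].
Notation P := (@hproj R).
Notation Q := (@hcoproj R).
Implicit Types (x y v b : R -> C) (a c : C).
Variables f g : R -> C.
Hypotheses (hf : Linfty f) (hg : Linfty g).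
Notation S := (sing f g).
Notation T := (singadj f g).
Notation qdefect := (qdefect f g).

Lemma singadjPr x y : L2 x -> L2 y -> inner (T x) y = inner x (S y).
Proof. by move=> hx hy; rewrite innerC // -singadjP // -innerC. Qed.

Definition shift_defect y v := inner y (T f) * inner f v - inner y (T g) * inner g v
  - inner y (T 1) * inner (T (f - g)) v
  - inner y (T (T (f - g)) - cst (inner (f - g) (f - g)) * T 1) * inner 1 v.

Lemma qdefect_shiftE y v : L2 y -> L2 v -> inner y 1 = 0 ->
  qdefect y v = qdefect (zn (-1) * y) (zn (-1) * v) + shift_defect y v.
Proof. by move=> hy hv y1; rewrite qdefect_shift // /shift_defect !addrA. Qed.

Lemma qdefectE y v : L2 y -> L2 v ->
  qdefect y v = inner y (T (S (T v)) - T (T (S v))).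
Proof.
by move=> hy hv; rewrite /qdefect singadjPr // !singadjP // innerBr.
Qed.

Lemma zn_perp1 (n : int) : n != 0 -> inner (zn n : R -> C) 1 = 0.
Proof. by move=> n0; rewrite -zn0 inner_zn (negbTE n0). Qed.

(** A vanishing shift_defect makes qdefect (z^j) v equal to
qdefect (z^(j - 1)) (z^-1 v) for j <> 0.  Only the step from 1 to z^-1 is
missing, so the nonnegative and the negative powers form two chains.  Along each
of them qdefect is constant, and its limit at infinity is 0.  Uniqueness of
Fourier coefficients extends the vanishing from characters to all y. *)
Theorem qdefect0P :
  (forall y v, L2 y -> L2 v -> qdefect y v = 0) <->
  (forall y v, L2 y -> L2 v -> inner y 1 = 0 -> shift_defect y v = 0).
Proof.
split=> [q0 y v hy hv y1|sd0].
  by have := qdefect_shiftE hy hv y1; rewrite !q0 // add0r => <-.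
have step y v : L2 y -> L2 v -> inner y 1 = 0 ->
    qdefect y v = qdefect (zn (-1) * y) (zn (-1) * v).
  by move=> hy hv y1; rewrite qdefect_shiftE // sd0 // addr0.
have q1 v : L2 v -> qdefect 1 v = 0.
  move=> hv; apply: tends0_cst.
  have := @qdefect_zn_pos _ _ _ hf hg 1 v (Linfty_L2 Linfty1) hv.
  congr tends0; apply/funext; elim=> [|n IH]; first by rewrite zn0 !mul1r.
  rewrite -IH step //; last by rewrite mulr1 zn_perp1.
  by rewrite !mulrA -!znD (_ : -1 + n.+1%:Z = n%:Z) //; lia.
have qm1 v : L2 v -> qdefect (zn (-1)) v = 0.
  move=> hv; apply: tends0_cst.
  have := @qdefect_zn_neg _ _ _ hf hg (zn (-1)) v (Linfty_L2 (Linfty_zn _)) hv.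
  congr tends0; apply/funext; elim=> [|n IH]; first by rewrite oppr0 zn0 !mul1r.
  rewrite -IH [in RHS]step //; last by rewrite -znD zn_perp1 //; lia.
  by rewrite !mulrA -!znD (_ : -1 + - n%:Z = - n.+1%:Z) //; lia.
have qpos (n : nat) v : L2 v -> qdefect (zn n) v = 0.
  elim: n v => [|n IH] v hv; first by rewrite zn0 q1.
  rewrite step //; last by rewrite zn_perp1.
  by rewrite -znD (_ : -1 + n.+1%:Z = n%:Z) ?IH //; lia.
have qneg (n : nat) v : L2 v -> qdefect (zn (- n.+1%:Z)) v = 0.
  elim: n v => [|n IH] v hv; first exact: qm1.
  have := step (zn (- n.+1%:Z)) (zn 1 * v).
  rewrite IH // -znD mulrA -znD addNr zn0 mul1r.
  rewrite (_ : -1 + - n.+1%:Z = - n.+2%:Z); last by lia.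
  by move=> <- //; rewrite zn_perp1.
move=> y v hy hv; rewrite qdefectE //; set w := _ - _.
have hw : L2 w by rewrite /w.
have w0 : w =ae 0.
  apply: Fourier_uniqueness => // n; rewrite innerC //.
  rewrite -qdefectE //; case: n => n; first by rewrite qpos ?rmorph0.
  by rewrite NegzE qneg ?rmorph0.
by rewrite (inner_aer hy hw (Linfty_L2 Linfty0) w0) inner0r.
Qed.

Lemma singintE : singint f g = S.
Proof.
by apply/funext => x; rewrite singE QE hproj.unlock.
Qed.

Lemma norm2E x : L2 x -> norm2 x = Num.sqrt (nsq x).
Proof. by move=> hx; rewrite /norm2 -nsqE. Qed.

Lemma bounded_sing : bounded_operator S.
Proof.
have [K K0 hK] := sing_bounded hf hg; split.
- by move=> x hx.
- by move=> a x y hx hy; exact: sing_lin.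
- exists (Num.sqrt K) => x hx; rewrite !norm2E // -sqrtrM //.
  by rewrite ler_wsqrtr // hK.
Qed.

(** An adjoint of S agrees with T up to almost everywhere equality, so commuting
with it is the identity of S T S and T S S, read off from inner products. *)
Theorem quasinormalP :
  quasinormal (singint f g) <-> forall y v, L2 y -> L2 v -> qdefect y v = 0.
Proof.
rewrite singintE; split=> [[_ [A [A2 adjA] comm]] y v hy hv|q0].
  have AT w : L2 w -> A w =ae T w.
    move=> hw; have hAw := A2 _ hw.
    apply: inner_ext => // u hu; rewrite innerC // -adjA // singadjP //.
    by rewrite -innerC.
  have hSy : L2 (S y) by [].
  have hA1 := A2 _ hSy; have hA2 := A2 _ (L2_sing hf hg hSy).
  have := inner_ael _ _ hv (comm y hy).
  rewrite (inner_ael _ _ hv (sing_ae f g _ _ (AT _ hSy))) //.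
  rewrite (inner_ael _ _ hv (AT _ (L2_sing hf hg hSy))) //.
  rewrite singadjP // singadjPr // /qdefect => E.
  by rewrite [X in X - _]singadjPr // E // singadjPr // subrr.
split; first exact: bounded_sing.
exists T; first split.
- by move=> y hy.
- by move=> x y hx hy; rewrite singadjP.
move=> x hx; apply: inner_ext => // v hv.
have E : inner (T (S x)) (T v) = inner (S (S x)) (S v) := subr0_eq (q0 x v hx hv).
by rewrite singadjP // E singadjPr.
Qed.

End Quasinormal.

(** * Functions that are constant almost everywhere *)

Section Constants.
Context {R : realType}.
Notation C := R[i].
Implicit Types (x y v b w : R -> C) (a c : C).

Lemma is_const_cst a : is_const (cst a : R -> C).
Proof. by exists a; exact: ae_refl. Qed.

Lemma is_constD x y : is_const x -> is_const y -> is_const (x + y).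
Proof. by move=> [a ha] [b hb]; exists (a + b); exact: (aeD ha hb). Qed.

Lemma is_constM x y : is_const x -> is_const y -> is_const (x * y).
Proof. by move=> [a ha] [b hb]; exists (a * b); exact: (aeM ha hb). Qed.

Lemma is_constN x : is_const x -> is_const (- x).
Proof. by move=> [a ha]; exists (- a); exact: (aeN ha). Qed.

Lemma is_constB x y : is_const x -> is_const y -> is_const (x - y).
Proof. by move=> hx hy; apply: is_constD => //; exact: is_constN. Qed.

Lemma is_const_cj x : is_const x -> is_const (cj x).
Proof. by move=> [a ha]; exists a^*; exact: (ae_cj ha). Qed.

Lemma is_constZ a x : is_const x -> is_const (cst a * x).
Proof. by move=> hx; apply: is_constM => //; exact: is_const_cst. Qed.

Lemma is_const_ae x y : x =ae y -> is_const x -> is_const y.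
Proof. by move=> xy [a ha]; exists a; exact: ae_trans (ae_sym xy) ha. Qed.

Lemma inner_cstr y a : L2 y -> inner y (cst a) = a^* * inner y 1.
Proof. by move=> hy; rewrite -innerZr // mulr1. Qed.

Lemma inner_cstl y a : L2 y -> inner (cst a) y = a * inner 1 y.
Proof. by move=> hy; rewrite -innerZl // mulr1. Qed.

Lemma perp_const y x : L2 y -> L2 x -> inner y 1 = 0 -> is_const x -> inner y x = 0.
Proof.
by move=> hy hx y1 [a ha]; rewrite (inner_aer hy hx _ ha) // inner_cstr // y1 mulr0.
Qed.

Lemma center_perp x : L2 x -> inner (x - cst (inner x 1)) 1 = 0.
Proof. by move=> hx; rewrite innerBl // inner_cstl // inner11 mulr1 subrr. Qed.

(** Test with x - <x, 1>, which is orthogonal to 1. *)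
Lemma is_constP x : L2 x ->
  (forall y, L2 y -> inner y 1 = 0 -> inner y x = 0) -> is_const x.
Proof.
move=> hx h; exists (inner x 1); apply/ae_subr0.
have h0 := center_perp hx; set x0 := x - _ in h0 *.
have hx0 : L2 x0 by rewrite /x0.
apply: inner_eq0 => //; rewrite {2}/x0 innerBr // h // inner_cstr // h0.
by rewrite mulr0 subr0.
Qed.

Lemma nonconst x : L2 x -> ~ is_const x ->
  exists y, [/\ L2 y, inner y 1 = 0 & inner y x <> 0].
Proof.
move=> hx nx; apply: contrapT => H; apply: nx; apply: is_constP => // y hy y1.
by apply: contrapT => yx; apply: H; exists y.
Qed.

Lemma is_constPl x : L2 x ->
  (forall y, L2 y -> inner y 1 = 0 -> inner x y = 0) -> is_const x.
Proof.
move=> hx h; apply: is_constP => // y hy y1.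
by rewrite innerC // h // rmorph0.
Qed.

Lemma const_Fourier x : L2 x ->
  is_const x <-> forall n : int, n != 0 -> inner x (zn n) = 0.
Proof.
move=> hx; split=> [xc n n0|h].
  by rewrite innerC // (perp_const _ hx _ xc) ?rmorph0 // zn_perp1.
exists (inner x 1); apply/ae_subr0; apply: Fourier_uniqueness => // n.
have [->|n0] := eqVneq n 0; first by rewrite zn0 center_perp.
have e : inner (1 : R -> C) (zn n) = 0.
  by rewrite -zn0 inner_zn eq_sym (negbTE n0).
by rewrite innerBl // h // inner_cstl // e mulr0 subr0.
Qed.

Lemma inner_cj x y : L2 x -> L2 y -> inner (cj x) (cj y) = (inner x y)^*.
Proof.
move=> hx hy; rewrite !innerE -Cint_cj ?cjM //.
by apply: L2_L1M.
Qed.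

(** The coefficients of x at negative indices vanish, and those at positive
indices are conjugates of coefficients of x^* at negative ones. *)
Lemma real_H2_const x : H2 x -> H2 (cj x) -> is_const x.
Proof.
move=> [hx xn] [hx' xn']; apply/const_Fourier => // n n0.
have [n1|n1] := ltP n 0; first exact: xn.
have E : inner (cj x) (zn (- n)) = 0 by apply: xn'; lia.
by rewrite -[LHS]conjCK -inner_cj // cj_zn E rmorph0.
Qed.

Lemma H2_const x : L2 x -> is_const x -> H2 x.
Proof. by move=> hx [a ha]; apply: (H2_ae hx (ae_sym ha)); exact: H2_cst. Qed.

Definition sq x : R -> C := fun t => `|x t| ^+ 2.

Lemma sqE x : sq x = x * cj x.
Proof. by apply/funext => t; exact: normCK. Qed.

Lemma cj_sq x : cj (x * cj x) = x * cj x.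
Proof. by rewrite cjM cjK mulrC. Qed.

(** The vector v is the component of f orthogonal to 1 and g; when it is zero, f is a
combination of g and 1. *)
Lemma affine_dependence f g : L2 f -> L2 g ->
  (exists mu, is_const (f - cst mu * g)) \/
  exists v, [/\ L2 v, inner v 1 = 0, inner g v = 0 & inner f v <> 0].
Proof.
move=> hf hg.
set f0 := f - cst (inner f 1); set g0 := g - cst (inner g 1).
have hf0 : L2 f0 by rewrite /f0.
have hg0 : L2 g0 by rewrite /g0.
have pf0 : inner f0 1 = 0 := center_perp hf.
have pg0 : inner g0 1 = 0 := center_perp hg.
set mu := inner f0 g0 / inner g0 g0.
set w := f0 - cst mu * g0.
have hw : L2 w by rewrite /w.
have w1 : inner w 1 = 0 by rewrite innerBl // innerZl // pf0 pg0 mulr0 subr0.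
have wg : inner w g0 = 0.
  rewrite innerBl // innerZl //.
  have [E|n0] := eqVneq (inner g0 g0) 0; last by rewrite /mu divfK // subrr.
  rewrite E mulr0 subr0 (inner_aer hf0 hg0 _ (inner_eq0 hg0 E)) ?inner0r //.
have g0w : inner g0 w = 0 by rewrite (innerC hw hg0) wg rmorph0.
have w1' : inner 1 w = 0 by rewrite (innerC hw (Linfty_L2 Linfty1)) w1 rmorph0.
have gw : inner g w = 0.
  have -> : g = g0 + cst (inner g 1) by rewrite /g0 subrK.
  by rewrite innerDl // inner_cstl // g0w w1' mulr0 addr0.
have [E|n0] := eqVneq (inner w w) 0.
  left; exists mu; apply: is_const_ae (is_const_cst (inner f 1 - mu * inner g 1)).
  have -> : f - cst mu * g = w + (cst (inner f 1) - cst mu * cst (inner g 1)).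
    by rewrite /w /f0 /g0; fring.
  have := aeD (ae_sym (inner_eq0 hw E)) (ae_refl (cst (inner f 1) - cst mu * cst (inner g 1))).
  by rewrite add0r.
right; exists w; split => //.
have [d fE] : exists d, f = w + cst mu * g + cst d.
  exists (inner f 1 - mu * inner g 1).
  have -> : cst (inner f 1 - mu * inner g 1) = cst (inner f 1) - cst mu * cst (inner g 1) :> (R -> C) by [].
  by rewrite /w /f0 /g0; fring.
clearbody w; clear -hf hg hw w1' gw n0 fE.
rewrite fE innerDl // innerDl // innerZl // gw inner_cstl // w1'.
by rewrite !mulr0 !addr0; exact/eqP.
Qed.

End Constants.

(** * The adjoint modulo constants *)

Section NormalForm.
Context {R : realType}.
Notation C := R[i].
Notation P := (@hproj R).
Notation Q := (@hcoproj R).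
Implicit Types (x y v b w : R -> C) (a c : C).
Variables f g : R -> C.
Hypotheses (hf : Linfty f) (hg : Linfty g).
Notation S := (sing f g).
Notation T := (singadj f g).
Notation h := (f - g).

Lemma P_zn_pos (n : int) : 0 <= n -> P (zn n) =ae zn n.
Proof.
case: n => // n _; apply: P_unique => //; first exact: H2_zn.
by move=> v [hv _]; rewrite subrr inner0l.
Qed.

(** S multiplies a character by f or by g according to the sign of its index. *)
Lemma singadj_Fourier b (n : int) : L2 b ->
  inner (T b) (zn n) = inner ((if 0 <= n then cj f else cj g) * b) (zn n).
Proof.
move=> hb; rewrite singadjPr // singE QE; case: ifPn => n0.
  rewrite inner_Ml cjK; apply: inner_aer => //.
  have -> : f * zn n = f * zn n + g * (zn n - zn n) by fring.
  have h0 := P_zn_pos n0.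
  by apply: aeD; apply: aeMl => //; apply: aeB => //; exact: ae_refl.
rewrite inner_Ml cjK; apply: inner_aer => //.
have -> : g * zn n = f * 0 + g * (zn n - 0) by fring.
have h0 : P (zn n) =ae 0 by apply: P_zn_neg; rewrite ltNge.
by apply: aeD; apply: aeMl => //; apply: aeB => //; exact: ae_refl.
Qed.

(** All coefficients of T b - w of nonzero index have to vanish.  By the previous
lemma the negative ones are those of g^* b - w, and the positive ones are the
conjugates of the negative ones of f b^* - w^*. *)
Lemma singadj_constP b w : L2 b -> L2 w ->
  is_const (T b - w) <-> H2 (f * cj b - cj w) /\ H2 (cj g * b - w).
Proof.
move=> hb hw; rewrite const_Fourier //.
have E (n : int) : inner (T b - w) (zn n) =
    inner ((if 0 <= n then cj f else cj g) * b - w) (zn n).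
  by rewrite innerBl // singadj_Fourier //; case: ifP => _; rewrite innerBl.
have E' (n : int) : inner (f * cj b - cj w) (zn n) =
    (inner (cj f * b - w) (zn (- n)))^*.
  by rewrite -inner_cj // cj_zn opprK cjB cjM cjK.
split=> [h|[h1 h2] n n0].
  split; apply: H2I => // n n0.
    have := h (- n); rewrite E E' oppr_ge0 (ltW n0) oppr_eq0 lt_eqF // => -> //.
    by rewrite rmorph0.
  by have := h n; rewrite E leNgt n0 lt_eqF // => ->.
rewrite E; case: ifPn => n1; last by apply: h2.2; rewrite ltNge.
have := E' (- n); rewrite opprK.
rewrite (_ : inner _ (zn (- n)) = 0); last by apply: h1.2; lia.
by move=> e; rewrite -[LHS]conjCK -e rmorph0.
Qed.

Lemma cst_ae_inj a c : (cst a : R -> C) =ae cst c -> a = c.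
Proof.
move=> ac; have := inner_ael (Linfty_L2 (Linfty_cst a)) (Linfty_L2 (Linfty_cst c)) (Linfty_L2 Linfty1) ac.
by rewrite (inner_cstl a) // (inner_cstl c) // inner11 !mulr1.
Qed.

(** If T h = w + k, both f h^* - w^* and g^* h - w are in H^2.  Their sum N is
real, hence a constant r.  Comparing mean values gives k + k^* - <h, h> = r,
and this is what makes the constants in shift_defect combine: the coefficient
of <1, v> becomes <S y, w + r>, where w + r = |f|^2 - |g|^2 - w^*. *)
Lemma shift_defect_normal w : Linfty w -> is_const (T h - w) ->
  is_const (f * cj f - g * cj g - w - cj w) /\
  forall y v, L2 y -> L2 v -> inner y 1 = 0 ->
    shift_defect f g y v =
      inner (S y) f * inner f v - inner (S y) g * inner g v
      - inner (S y) 1 * inner w v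
      - inner (S y) (f * cj f - g * cj g - cj w) * inner 1 v.
Proof.
move=> hw hwc; have hfg : L2 h by [].
have [hp hq] := (singadj_constP hfg (Linfty_L2 hw)).1 hwc.
set N := f * cj f - g * cj g - w - cj w.
have NE : N = (f * cj h - cj w) + (cj g * h - w) by rewrite /N cjB; fring.
have Nreal : cj N = N by rewrite /N !cjB !cjM !cjK; fring.
have hN : H2 N by rewrite NE; exact: H2D.
have hN2 := H2_L2 hN.
have Nc : is_const N by apply: real_H2_const; rewrite ?Nreal.
have [r Nr'] := Nc; have Nr : N =ae cst r := Nr'.
have rr : r^* = r.
  by apply: cst_ae_inj; apply: ae_trans (ae_cj (ae_sym Nr)) _; rewrite Nreal.
split => // y v hy hv y1.
have [k Tk'] := hwc; have Tk : T h - w =ae cst k := Tk'.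
pose k0 := inner h f - inner w 1.
have k_r : k + k^* - inner h h = r.
  have S1 : S 1 =ae f by have := sing_cst f g 1; rewrite (_ : cst 1 = 1) ?mul1r.
  have kE : k = k0.
    have := inner_ael _ _ (Linfty_L2 Linfty1) Tk.
    rewrite innerBl // (inner_cstl k) // inner11 mulr1 => <- //.
    by rewrite singadjPr // (inner_aer _ _ _ S1).
  have rE : inner N 1 = r.
    by rewrite (inner_ael _ _ _ Nr) // (inner_cstl r) // inner11 mulr1.
  rewrite -rE kE /k0 /N rmorphB /= -!innerC //.
  have sqE' (u x : R -> C) : inner (u * cj x) 1 = inner u x.
    by rewrite mulrC inner_Ml cjK mulr1.
  have -> : inner (f * cj f - g * cj g - w - cj w) 1 =
      inner f f - inner g g - inner w 1 - inner 1 w.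
    by rewrite 3?innerBl // 2?sqE' -[cj w]mul1r sqE'.
  rewrite !innerBr // !innerBl //.
  by cring.
have {}Tk' : T h =ae w + cst k.
  by have := aeD Tk (ae_refl w); rewrite subrK (addrC (cst k)).
rewrite /shift_defect !(innerBr hy) // (innerZr _ hy) // -!singadjP //.
have hhr : (inner h h)^* = inner h h by rewrite -innerC.
rewrite [inner (S (S y)) h]singadjP // hhr; set n := inner h h in k_r *.
rewrite (inner_aer _ _ _ Tk') // (inner_ael _ _ _ Tk') // innerDl // innerDr //.
have -> : inner (S y) (f * cj f - g * cj g - cj w) = inner (S y) (w + cst r).
  apply: inner_aer => //; have := aeD (ae_refl w) Nr.
  by congr (_ =ae _); rewrite /N; fring.
rewrite [inner (S y) (w + cst r)]innerDr // inner_cstl //.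
rewrite (inner_cstr k) // (inner_cstr r) // rr -k_r.
by cring.
Qed.

End NormalForm.

(** * Hardy space conditions and the case analysis *)

Section Cases.
Context {R : realType}.
Notation C := R[i].
Local Notation cst := (@cst R R[i]).
Implicit Types (x y v b w p q : R -> C) (a c mu alpha : C).

Lemma HinftyE p : Linfty p -> Hinfty p <-> H2 p.
Proof. by move=> hp; split=> [[]//|]; split. Qed.

Lemma H2_oppP p : H2 (- p) <-> H2 p.
Proof. by split=> [/H2N|/H2N //]; rewrite opprK. Qed.

(** <p q, z^n> = <p, q^* z^n> with n < 0, and q^* z^n has coefficients of negative
index only, so that it is orthogonal to H^2. *)
Lemma H2_mul p q : Hinfty p -> Hinfty q -> H2 (p * q).
Proof.
move=> [hp [hp2 p0]] [hq [hq2 q0]]; apply: H2I => // n n0.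
pose x := cj q * zn n; have hx : L2 x by rewrite /x.
have Px : hproj x =ae 0.
  apply: Fourier_uniqueness => // m; rewrite inner_P //.
  have [m0|m0] := ltP m 0.
    by rewrite (inner_aer _ _ _ (P_zn_neg m0)) // inner0r.
  rewrite (inner_aer _ _ _ (P_zn_pos m0)) // /x inner_Ml cjK innerC //.
  rewrite mulrC inner_Ml cj_zn -znD (_ : inner _ _ = 0) ?rmorph0 //.
  by apply: q0; lia.
have -> : inner (p * q) (zn n) = inner p x by rewrite mulrC inner_Ml.
have Pp : hproj p =ae p by apply/ae_sym/ae_subr0; rewrite -QE; exact: Q_H2.
rewrite -(inner_ael _ _ _ Pp) // inner_P // (inner_aer _ _ _ Px) //.
exact: inner0r.
Qed.

Lemma normf_ae x y : (fun t => `|x t|) =ae (fun t => `|y t|) <-> x * cj x =ae y * cj y.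
Proof.
rewrite -!sqE; split=> /aeE e; apply/aeE; apply: aeS e => t; rewrite /sq.
  by move=> ->.
by move/eqP; rewrite eqrXn2 // => /eqP.
Qed.

Lemma normf_const x : is_const (fun t => `|x t|) <-> is_const (x * cj x).
Proof.
rewrite -sqE; split=> -[c /aeE e].
  by exists (c ^+ 2); apply/aeE; apply: aeS e => t; rewrite /sq => ->.
exists (sqrtC c); apply/aeE; apply: aeS e => t; rewrite /sq => <-.
by rewrite sqrCK.
Qed.

Lemma PminusE x : Pminus x = hcoproj x.
Proof. by rewrite QE hproj.unlock. Qed.

Lemma Pminus_eq0 x : L2 x -> Pminus x =ae 0 <-> H2 x.
Proof.
move=> hx; rewrite PminusE; split; last exact: Q_H2.
by rewrite QE => /ae_subr0/ae_sym e; apply: (H2_ae hx e); exact: H2P.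
Qed.

Lemma Pminus_ae x y : L2 x -> L2 y -> Pminus x =ae Pminus y <-> H2 (x - y).
Proof.
move=> hx hy; rewrite -Pminus_eq0 // !PminusE -ae_subr0.
have E : hcoproj (x - y) =ae hcoproj x - hcoproj y.
  have := Q_lin (-1) hy hx; rewrite (_ : cst (-1) = -1) // !mulN1r.
  by rewrite ![- _ + _]addrC.
by split=> h; [apply: ae_trans E h|apply: ae_trans (ae_sym E) h].
Qed.

Lemma Vop_eq0 x : Vop x =ae 0 <-> x =ae 0.
Proof.
split=> /aeE e; apply/aeE; apply: aeS e => t.
  move/eqP; rewrite /Vop mulf_eq0 conjC_eq0 (negbTE (zfun_neq0 t)) conjC_eq0.
  by move/eqP.
by rewrite /Vop => ->; rewrite conjC0 mulr0.
Qed.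

Section Operator.
Variables f g : R -> C.
Hypotheses (hf : Linfty f) (hg : Linfty g).
Notation S := (sing f g).
Notation T := (singadj f g).
Notation h := (f - g).

(** The vectors b orthogonal to the image under S of the orthogonal complement of
the constants.  These annihilate all terms of shift_defect in which S y is
paired with them. *)
Definition sing_perp b := forall y, L2 y -> inner y 1 = 0 -> inner (S y) b = 0.

Lemma sing_perpP b : L2 b -> sing_perp b <-> is_const (T b).
Proof.
move=> hb; split=> [H|H y hy y1].
  by apply: is_constP => // y hy y1; rewrite -singadjP // H.
by rewrite singadjP //; exact: perp_const.
Qed.

Lemma sing_perp_H2 b : L2 b -> sing_perp b <-> H2 (f * cj b) /\ H2 (cj g * b).
Proof.
move=> hb; rewrite sing_perpP //.
have := singadj_constP hf hg hb (Linfty_L2 Linfty0).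
by rewrite cj0 !subr0.
Qed.

(** The four subcases with parameters, in the ring of functions, where they can be
computed with; they unfold to pointwise statements. *)
Definition caseA mu alpha :=
  is_const (f - cst mu * g) /\
  Hinfty (sq f - f * cj g - cst alpha^* * cj g) /\
  Hinfty (sq g - f * cj g + cst alpha * g) /\
  Hinfty (f * (cst mu * cj f - cj g - cst alpha)) /\
  Hinfty (cj g * (cst mu^* * f - g - cst alpha^*)) /\
  Hinfty (f * g * (cst mu * cj f - cj g - cst alpha)) /\
  Hinfty (cj g * cj g * (cst mu^* * f - g - cst alpha^*)).

Definition caseB mu alpha :=
  is_const (g - cst mu * f) /\
  Hinfty (sq f - f * cj g - cst alpha^* * cj f) /\
  Hinfty (sq g - f * cj g + cst alpha * f) /\
  Hinfty (f * (cj f - cst mu * cj g - cst alpha)) /\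
  Hinfty (cj g * (f - cst mu^* * g - cst alpha^*)) /\
  Hinfty (cj f * cj g * (f - cst mu^* * g - cst alpha^*)) /\
  Hinfty (f * f * (cj f - cst mu * cj g - cst alpha)).

Definition caseC mu alpha :=
  Hinfty (f * (cj f - cst mu^* * cj g)) /\
  Hinfty (cj g * (f - cst mu * g)) /\
  Hinfty (sq f - f * cj g - cst alpha^* * (cst mu * cj f - cj g)) /\
  Hinfty (f * cj g - sq g - cst alpha * (cst mu^* * f - g)) /\
  Hinfty (f * cj g - cst alpha * f) /\
  Hinfty (sq g - cst alpha^* * cj g) /\
  Hinfty (cj g * (sq f - sq g - cst alpha^* * cst mu * cj f + cst alpha^* * cj g)) /\
  Hinfty (f * (sq f - sq g - cst alpha * cst mu^* * f + cst alpha * g)).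

Definition caseD mu alpha :=
  Hinfty (f * (cj g - cst mu^* * cj f)) /\
  Hinfty (cj g * (g - cst mu * f)) /\
  Hinfty (sq f - f * cj g - cst alpha^* * (cj f - cst mu * cj g)) /\
  Hinfty (f * cj g - sq g - cst alpha * (f - cst mu^* * g)) /\
  Hinfty (f * cj g - cst alpha^* * cj g) /\
  Hinfty (sq f - cst alpha * f) /\
  Hinfty (cj g * (sq f - sq g + cst alpha^* * cst mu * cj g - cst alpha^* * cj f)) /\
  Hinfty (f * (sq f - sq g + cst alpha * cst mu^* * g - cst alpha * f)).


Let cj_cstC a : cj (cst a) = cst a^*. Proof. by []. Qed.

Let cj_cst_conj a : cj (cst a^*) = cst a.
Proof. by apply/funext => t; exact: conjCK. Qed.

Let cjE := (@cjD R, @cjN R, @cjM R, @cjK R, cj_cst_conj, cj_cstC).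

(** The first two memberships say that T h is alpha g up to a constant.  The other
four come in pairs, one for b and one for g^* b. *)
Lemma caseAP mu alpha : caseA mu alpha <->
  let b := cst mu^* * f - g - cst alpha^* in
  [/\ is_const (f - cst mu * g), is_const (T h - cst alpha * g),
      sing_perp b & sing_perp (cj g * b)].
Proof.
rewrite /caseA !sqE !HinftyE //=.
have e1 : f * cj f - f * cj g - cst alpha^* * cj g = f * cj h - cj (cst alpha * g).
  by rewrite !cjE; fring.
have e2 : g * cj g - f * cj g + cst alpha * g = - (cj g * h - cst alpha * g).
  by fring.
set b := cst mu^* * f - g - cst alpha^*; have hb : Linfty b by rewrite /b.
have e3 : cst mu * cj f - cj g - cst alpha = cj b by rewrite !cjE.
rewrite e1 e2 e3 H2_oppP.
rewrite (_ : f * g * cj b = f * cj (cj g * b)); last by rewrite !cjE; fring.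
rewrite -(mulrA (cj g) (cj g) b).
split=> [[hc [h1 [h2 [h3 [h4 [h5 h6]]]]]]|[hc]].
  by split=> //; [apply/singadj_constP|apply/sing_perp_H2|apply/sing_perp_H2].
move=> /singadj_constP[]// h1 h2 /sing_perp_H2[]// h3 h4 /sing_perp_H2[]//.
Qed.

Lemma caseBP mu alpha : caseB mu alpha <->
  let b := f - cst mu^* * g - cst alpha^* in
  [/\ is_const (g - cst mu * f), is_const (T h - cst alpha * f),
      sing_perp b & sing_perp (cj f * b)].
Proof.
rewrite /caseB !sqE !HinftyE //=.
have e1 : f * cj f - f * cj g - cst alpha^* * cj f = f * cj h - cj (cst alpha * f).
  by rewrite !cjE; fring.
have e2 : g * cj g - f * cj g + cst alpha * f = - (cj g * h - cst alpha * f).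
  by fring.
set b := f - cst mu^* * g - cst alpha^*; have hb : Linfty b by rewrite /b.
have e3 : cj f - cst mu * cj g - cst alpha = cj b by rewrite !cjE.
rewrite e1 e2 e3 H2_oppP.
rewrite (_ : f * f * cj b = f * cj (cj f * b)); last by rewrite !cjE; fring.
rewrite (_ : cj f * cj g * b = cj g * (cj f * b)); last by fring.
split=> [[hc [h1 [h2 [h3 [h4 [h5 h6]]]]]]|[hc]].
  by split=> //; [apply/singadj_constP|apply/sing_perp_H2|apply/sing_perp_H2].
move=> /singadj_constP[]// h1 h2 /sing_perp_H2[]// h3 h4 /sing_perp_H2[]//.
Qed.

Lemma caseCP mu alpha : caseC mu alpha <->
  let w := cst alpha * (cst mu^* * f - g) in
  [/\ sing_perp (f - cst mu * g), is_const (T h - w), sing_perp (g - cst alpha^*) &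
      sing_perp (f * cj f - g * cj g - cj w)].
Proof.
rewrite /caseC !sqE !HinftyE //=.
set w := cst alpha * _; have hw : Linfty w by rewrite /w.
set b := f * cj f - g * cj g - cj w; have hb : Linfty b by rewrite /b.
rewrite (_ : cj f - cst mu^* * cj g = cj (f - cst mu * g)); last by rewrite !cjE.
rewrite (_ : f * cj f - f * cj g - cst alpha^* * (cst mu * cj f - cj g) =
  f * cj h - cj w); last by rewrite /w !cjE; fring.
rewrite (_ : f * cj g - g * cj g - w = cj g * h - w); last by fring.
rewrite (_ : f * cj g - cst alpha * f = f * cj (g - cst alpha^*)); last first.
  by rewrite !cjE; fring.
rewrite (_ : g * cj g - cst alpha^* * cj g = cj g * (g - cst alpha^*)); last by fring.
rewrite (_ : f * cj f - g * cj g - _ * cj f + _ = b); last first.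
  by rewrite /b /w !cjE; fring.
rewrite (_ : f * cj f - g * cj g - _ + _ = cj b); last first.
  by rewrite /b /w !cjE; fring.
split=> [[h1 [h2 [h3 [h4 [h5 [h6 [h7 h8]]]]]]]|[]].
  by split; [apply/sing_perp_H2|apply/singadj_constP|apply/sing_perp_H2|
             apply/sing_perp_H2].
move=> /sing_perp_H2[]// h1 h2 /singadj_constP[]// h3 h4 /sing_perp_H2[]// h5 h6.
by move=> /sing_perp_H2[]//.
Qed.

Lemma caseDP mu alpha : caseD mu alpha <->
  let w := cst alpha * (f - cst mu^* * g) in
  [/\ sing_perp (g - cst mu * f), is_const (T h - w), sing_perp (f - cst alpha^*) &
      sing_perp (f * cj f - g * cj g - cj w)].
Proof.
rewrite /caseD !sqE !HinftyE //=.
set w := cst alpha * _; have hw : Linfty w by rewrite /w.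
set b := f * cj f - g * cj g - cj w; have hb : Linfty b by rewrite /b.
rewrite (_ : cj g - cst mu^* * cj f = cj (g - cst mu * f)); last by rewrite !cjE.
rewrite (_ : f * cj f - f * cj g - cst alpha^* * (cj f - cst mu * cj g) =
  f * cj h - cj w); last by rewrite /w !cjE; fring.
rewrite (_ : f * cj g - g * cj g - w = cj g * h - w); last by fring.
rewrite (_ : f * cj g - cst alpha^* * cj g = cj g * (f - cst alpha^*)); last by fring.
rewrite (_ : f * cj f - cst alpha * f = f * cj (f - cst alpha^*)); last first.
  by rewrite !cjE; fring.
rewrite (_ : f * cj f - g * cj g + _ - cst alpha^* * cj f = b); last first.
  by rewrite /b /w !cjE; fring.
rewrite (_ : f * cj f - g * cj g + _ - _ = cj b); last first.
  by rewrite /b /w !cjE; fring.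
split=> [[h1 [h2 [h3 [h4 [h5 [h6 [h7 h8]]]]]]]|[]].
  by split; [apply/sing_perp_H2|apply/singadj_constP|apply/sing_perp_H2|
             apply/sing_perp_H2].
move=> /sing_perp_H2[]// h1 h2 /singadj_constP[]// h3 h4 /sing_perp_H2[]// h6 h5.
by move=> /sing_perp_H2[]//.
Qed.

Lemma affine_inner mu x y : L2 x -> L2 y -> is_const (x - cst mu * y) ->
  exists k, (forall v, L2 v -> inner x v = mu * inner y v + k * inner 1 v) /\
    cj x - cst mu^* * cj y =ae cst k^*.
Proof.
move=> hx hy [k ck]; exists k; split.
  move=> v hv; have ck' : x - cst mu * y =ae cst k := ck.
  have := inner_ael _ _ hv ck'; rewrite innerBl // innerZl // (inner_cstl k) //.
  by move=> <- //; rewrite addrC subrK.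
have := ae_cj (ck : _ =ae cst k).
by rewrite !cjE.
Qed.

(** In the normal form for w = alpha g, the relation f = mu g + k removes the
vector f; since k is f - mu g, the vector paired with S y in the coefficient
of 1 becomes g^* b. *)
Lemma shift_defectA mu alpha y v :
  is_const (f - cst mu * g) -> is_const (T h - cst alpha * g) ->
  L2 y -> L2 v -> inner y 1 = 0 ->
  let b := cst mu^* * f - g - cst alpha^* in
  shift_defect f g y v =
    inner (S y) b * inner g v - inner (S y) (cj g * b) * inner 1 v.
Proof.
move=> hc hT hy hv y1 b.
have hw : Linfty (cst alpha * g) by [].
have [_ ->] // := shift_defect_normal hf hg hw hT.
have [k [fv ck]] := affine_inner (Linfty_L2 hf) (Linfty_L2 hg) hc.
have -> : f * cj f - g * cj g - cj (cst alpha * g) =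
    (cj f - cst mu^* * cj g) * f + cj g * b.
  by rewrite /b !cjE; fring.
have hb : Linfty b by rewrite /b.
rewrite (innerDr (L2_sing hf hg hy)) //.
have -> : inner (S y) ((cj f - cst mu^* * cj g) * f) = k * inner (S y) f.
  rewrite -[k in RHS]conjCK -innerZr //; apply: inner_aer => //.
  by apply: aeM => //; exact: ae_refl.
rewrite /b innerBr // innerBr // (innerZr mu^*) // (inner_cstr alpha^*) //.
by rewrite !conjCK fv // innerZl //; cring.
Qed.

Lemma shift_defectB mu alpha y v :
  is_const (g - cst mu * f) -> is_const (T h - cst alpha * f) ->
  L2 y -> L2 v -> inner y 1 = 0 ->
  let b := f - cst mu^* * g - cst alpha^* in
  shift_defect f g y v =
    inner (S y) b * inner f v - inner (S y) (cj f * b) * inner 1 v.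
Proof.
move=> hc hT hy hv y1 b.
have hw : Linfty (cst alpha * f) by [].
have [_ ->] // := shift_defect_normal hf hg hw hT.
have [k [gv ck]] := affine_inner (Linfty_L2 hg) (Linfty_L2 hf) hc.
have -> : f * cj f - g * cj g - cj (cst alpha * f) =
    cj f * b - (cj g - cst mu^* * cj f) * g.
  by rewrite /b !cjE; fring.
have hb : Linfty b by rewrite /b.
rewrite (innerBr (L2_sing hf hg hy)) //.
have -> : inner (S y) ((cj g - cst mu^* * cj f) * g) = k * inner (S y) g.
  rewrite -[k in RHS]conjCK -innerZr //; apply: inner_aer => //.
  by apply: aeM => //; exact: ae_refl.
rewrite /b innerBr // innerBr // (innerZr mu^*) // (inner_cstr alpha^*) //.
by rewrite !conjCK gv // innerZl //; cring.
Qed.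

Definition shift_invariant := forall y v, L2 y -> L2 v -> inner y 1 = 0 ->
  shift_defect f g y v = 0.

Lemma caseA_invariant mu alpha : caseA mu alpha -> shift_invariant.
Proof.
move=> /caseAP[hc hT h1 h2] y v hy hv y1.
by rewrite (shift_defectA hc hT) // h1 // h2 // !mul0r subr0.
Qed.

Lemma caseB_invariant mu alpha : caseB mu alpha -> shift_invariant.
Proof.
move=> /caseBP[hc hT h1 h2] y v hy hv y1.
by rewrite (shift_defectB hc hT) // h1 // h2 // !mul0r subr0.
Qed.

Lemma caseC_invariant mu alpha : caseC mu alpha -> shift_invariant.
Proof.
move=> /caseCP[hfg hT hg1 hr] y v hy hv y1.
set w := cst alpha * _ in hT hr; have hw : Linfty w by rewrite /w.
have [_ ->] // := shift_defect_normal hf hg hw hT.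
have := hfg y hy y1; rewrite innerBr // innerZr // => /eqP; rewrite subr_eq0 => /eqP ->.
have := hg1 y hy y1; rewrite innerBr // (inner_cstr alpha^*) // conjCK.
move=> /eqP; rewrite subr_eq0 => /eqP ->; rewrite hr //.
by rewrite /w innerZl // innerBl // innerZl //; cring.
Qed.

Lemma caseD_invariant mu alpha : caseD mu alpha -> shift_invariant.
Proof.
move=> /caseDP[hgf hT hf1 hr] y v hy hv y1.
set w := cst alpha * _ in hT hr; have hw : Linfty w by rewrite /w.
have [_ ->] // := shift_defect_normal hf hg hw hT.
have := hgf y hy y1; rewrite innerBr // innerZr // => /eqP; rewrite subr_eq0 => /eqP ->.
have := hf1 y hy y1; rewrite innerBr // (inner_cstr alpha^*) // conjCK.
move=> /eqP; rewrite subr_eq0 => /eqP ->; rewrite hr //.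
by rewrite /w innerZl // innerBl // innerZl //; cring.
Qed.

Lemma sing_perp_const b : L2 b -> is_const b -> sing_perp 1 -> sing_perp b.
Proof.
move=> hb [k bk] H1 y hy y1; have bk' : b =ae cst k := bk.
by rewrite (inner_aer _ _ _ bk') // (inner_cstr k) // H1 // mulr0.
Qed.

Lemma sing_perpB x b : L2 x -> L2 b -> sing_perp x -> sing_perp b -> sing_perp (x - b).
Proof. by move=> ha hb pa pb y hy y1; rewrite innerBr // pa // pb // subrr. Qed.

Lemma shift_defect_perp y v : sing_perp h -> L2 y -> L2 v -> inner y 1 = 0 ->
  shift_defect f g y v = inner (S y) f * inner f v - inner (S y) g * inner g v
    - inner (S y) (f * cj f - g * cj g) * inner 1 v.
Proof.
move=> /sing_perpP hT hy hv y1.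
have hT0 : is_const (T h - 0) by rewrite subr0; exact: hT.
have [_ ->] // := shift_defect_normal hf hg Linfty0 hT0.
by rewrite cj0 !subr0 inner0l // mulr0 subr0.
Qed.

(** The case w = 0 of the normal form. *)
Lemma sing_perp_norm_diff : sing_perp h -> is_const (f * cj f - g * cj g).
Proof.
move=> /sing_perpP hT.
have hT0 : is_const (T h - 0) by rewrite subr0; exact: hT.
by have [] := shift_defect_normal hf hg Linfty0 hT0; rewrite cj0 !subr0.
Qed.

Lemma perp_invariant : sing_perp h -> sing_perp f -> sing_perp g ->
  sing_perp (f * cj f - g * cj g) -> shift_invariant.
Proof.
move=> hh pf pg pd y v hy hv y1.
by rewrite shift_defect_perp // pf // pg // pd // !mul0r !subr0.
Qed.

(** The case mu = 1, alpha = 0 of shift_defectA. *)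
Lemma shift_defect_const_diff y v : is_const h -> sing_perp h -> L2 y -> L2 v -> inner y 1 = 0 ->
  shift_defect f g y v =
    inner (S y) h * inner g v - inner (S y) (cj g * h) * inner 1 v.
Proof.
move=> hc /sing_perpP hT hy hv y1.
have E1 : cst 1 = 1 by [].
have E0 : cst 0 = 0 by [].
rewrite (@shift_defectA 1 0) //; last 2 first.
- by rewrite E1 mul1r.
- by rewrite E0 mul0r subr0; exact: hT.
by rewrite rmorph1 rmorph0 E1 E0 mul1r !subr0.
Qed.

Lemma H2_constM b x : Linfty b -> is_const b -> H2 x -> H2 (b * x).
Proof.
move=> hc [k ck] hx; have hx2 := H2_L2 hx.
have ck' : b =ae cst k := ck.
apply: (H2_ae _ _ (H2Z k hx)) => //.
by apply: aeM; [exact: ae_sym|exact: ae_refl].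
Qed.

(** Both sides amount to f h^*, g^* h, f g h^* and g^* g^* h being in H^2.  As h
is constant, g^* g^* h is f^* g^* h up to a multiple of g^* h, so the last two
memberships say that f g h^* and its conjugate are in H^2, hence that it is
constant. *)
Lemma case3P : is_const h ->
  (is_const (f * (g * cj g) - g * (f * cj f)) /\ H2 (f * cj f - g * cj g) /\
     H2 (g * cj g - f * cj g)) <->
  (sing_perp h /\ sing_perp (cj g * h)).
Proof.
move=> hc; rewrite !sing_perp_H2 //.
have hcc := is_const_cj hc.
have e1 : g * cj g - f * cj g = - (cj g * h) by fring.
have e2 : f * cj f - g * cj g = f * cj h + cj g * h by rewrite !cjE; fring.
have e3 : f * (g * cj g) - g * (f * cj f) = - (f * cj (cj g * h)).
  by rewrite !cjE; fring.
have e4 : cj g * (cj g * h) = cj (f * cj (cj g * h)) - cj h * (cj g * h).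
  by rewrite !cjE; fring.
rewrite e1 e2 e3 H2_oppP; split=> [[h1 [h2 h3]]|[[h1 h2] [h3 h4]]].
  have h1' : is_const (f * cj (cj g * h)) by rewrite -[X in is_const X]opprK; exact: is_constN.
  split; split => //.
  - by rewrite -[f * cj h](addrK (cj g * h)); exact: H2B.
  - exact: H2_const.
  - rewrite e4; apply: H2B; last exact: H2_constM.
    by apply: H2_const => //; exact: is_const_cj.
split; last by split => //; exact: H2D.
apply: is_constN; apply: real_H2_const => //.
have -> : cj (f * cj (cj g * h)) = cj g * (cj g * h) + cj h * (cj g * h).
  by rewrite e4 subrK.
by apply: H2D => //; exact: H2_constM.
Qed.

Lemma real_sq_const x : H2 (x * cj x) -> is_const (x * cj x).
Proof. by move=> hx; apply: real_H2_const => //; rewrite cj_sq. Qed.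

(** Only v orthogonal to 1 matters, for which the last term drops out. *)
Lemma is_const_dep x y (a b c : C) : L2 x -> L2 y -> a <> 0 ->
  (forall v, L2 v -> a * inner x v - b * inner y v - c * inner 1 v = 0) ->
  is_const (x - cst (b / a) * y).
Proof.
move=> hx hy a0 H; apply: is_constPl => // v hv v1.
rewrite innerBl // innerZl //; apply: (mulfI (introN eqP a0)).
have := H v hv; rewrite (_ : inner 1 v = 0); last by rewrite innerC // v1 rmorph0.
by rewrite mulr0 subr0 mulr0 mulrBr mulrA mulrCA divff ?mulr1 //; apply/eqP.
Qed.

Definition case1 := [/\ is_const (f * cj f), is_const (g * cj g), H2 f & H2 (cj g)].
Definition case2 := [/\ f * cj f =ae g * cj g, is_const (f * cj f) & H2 (f * cj g)].
Definition case3 := [/\ is_const h, sing_perp h & sing_perp (cj g * h)].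

Lemma case1_invariant : case1 -> shift_invariant.
Proof.
move=> [cf cg f2 g2].
have fg2 : H2 (f * cj g) by apply: H2_mul; apply/HinftyE.
have hcf : H2 (f * cj f) by exact: H2_const.
have hcg : H2 (cj g * g) by rewrite mulrC; exact: H2_const.
have p1 : sing_perp 1 by apply/sing_perp_H2 => //; rewrite cj1 !mulr1.
have pf : sing_perp f by apply/sing_perp_H2 => //; rewrite (mulrC (cj g)).
have pg : sing_perp g by apply/sing_perp_H2.
apply: perp_invariant => //; first exact: sing_perpB.
by apply: sing_perp_const => //; exact: is_constB.
Qed.

Lemma case2_invariant : case2 -> shift_invariant.
Proof.
move=> [cfg cf fg2].
have hcf : H2 (f * cj f) by exact: H2_const.
have hcg : H2 (cj g * g) by rewrite mulrC; apply: (H2_ae _ cfg).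
have pf : sing_perp f by apply/sing_perp_H2 => //; rewrite (mulrC (cj g)).
have pg : sing_perp g by apply/sing_perp_H2.
apply: perp_invariant => //; first exact: sing_perpB.
move=> y hy y1; have h0 : f * cj f - g * cj g =ae 0 by apply/ae_subr0.
by rewrite (inner_aer _ _ _ h0) // inner0r.
Qed.

Lemma case3_invariant : case3 -> shift_invariant.
Proof.
move=> [hc p1 p2] y v hy hv y1.
by rewrite shift_defect_const_diff // p1 // p2 // !mul0r subrr.
Qed.

Lemma not_sing_perp b : ~ sing_perp b ->
  exists y, [/\ L2 y, inner y 1 = 0 & inner (S y) b <> 0].
Proof.
move=> nb; apply: contrapT => H; apply: nb => y hy y1.
by apply: contrapT => yb; apply: H; exists y.
Qed.

Lemma H2_affine m x y : L2 x -> L2 y -> is_const (x - cst m * y) -> H2 y -> H2 x.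
Proof.
move=> hx hy hc h2; rewrite -[x](subrK (cst m * y)).
by apply: H2D; [exact: H2_const|exact: H2Z].
Qed.

Lemma sing_perp_norm : sing_perp f -> sing_perp g ->
  [/\ is_const (f * cj f), is_const (g * cj g) & H2 (f * cj g)].
Proof.
move=> /sing_perp_H2[]// ff2 _ /sing_perp_H2[]// fg2 gg2.
by split => //; apply: real_sq_const; rewrite ?(mulrC g).
Qed.

(** Here f and g^* are in H^2.  If <S y, f> were nonzero, f would be an affine
function of g, so f^* would be in H^2 and f constant; but then T f is constant
and <S y, f> = 0.  The argument for g is the same. *)
Lemma invariant_case1 : shift_invariant -> sing_perp 1 -> case1.
Proof.
move=> H p1; have [] := (sing_perp_H2 (Linfty_L2 Linfty1)).1 p1.
rewrite cj1 !mulr1 => f2 g2.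
have E y v : L2 y -> L2 v -> inner y 1 = 0 ->
    inner (S y) f * inner f v - inner (S y) g * inner g v
    - inner y (T (T h) - cst (inner h h) * T 1) * inner 1 v = 0.
  move=> hy hv y1; have := H y v hy hv y1; rewrite /shift_defect.
  by rewrite -!singadjP // p1 // mul0r subr0.
have pf : sing_perp f.
  apply: contrapT => /not_sing_perp[y [hy y1 yf]].
  apply: (yf); apply: sing_perp_const => //; apply: real_H2_const => //.
  pose m := inner (S y) g / inner (S y) f.
  apply: (@H2_affine m^* _ (cj g)) => //.
  have -> : cj f - cst m^* * cj g = cj (f - cst m * g) by rewrite !cjE.
  by apply: is_const_cj; apply: is_const_dep => // v hv; exact: E.
have pg : sing_perp g.
  apply: contrapT => /not_sing_perp[y [hy y1 yg]].
  apply: (yg); apply: sing_perp_const => //; apply: real_H2_const => //.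
  pose m := inner (S y) f / inner (S y) g.
  apply: (@H2_affine m _ f) => //.
  have -> : m = - inner (S y) f / - inner (S y) g by rewrite invrN mulrNN.
  pose X := T (T h) - cst (inner h h) * T 1.
  apply: (@is_const_dep _ _ _ _ (inner y X)) => //.
    by move=> /eqP; rewrite oppr_eq0 => /eqP.
  by move=> v hv; apply: etrans (E y v hy hv y1); rewrite /X; cring.
by have [] := sing_perp_norm pf pg.
Qed.

(** The coefficient of 1 reduces to r <S y, 1>, where r is the constant
|f|^2 - |g|^2: either r = 0, or T 1 is constant. *)
Lemma perp_case12 : shift_invariant -> sing_perp h -> sing_perp f -> case1 \/ case2.
Proof.
move=> H ph pf.
have pg : sing_perp g.
  have -> : g = f - h by fring.
  exact: sing_perpB.
have [cf cg fg2] := sing_perp_norm pf pg.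
have pd : sing_perp (f * cj f - g * cj g).
  move=> y hy y1; have := H y 1 hy (Linfty_L2 Linfty1) y1.
  rewrite shift_defect_perp // pf // pg // inner11 !mul0r subrr sub0r mulr1.
  by move/eqP; rewrite oppr_eq0 => /eqP.
have [r cr] := sing_perp_norm_diff ph.
have cr' : f * cj f - g * cj g =ae cst r := cr.
have [r0|r0] := eqVneq r 0.
  by right; split => //; apply/ae_subr0; rewrite r0 in cr'.
left; apply: invariant_case1 => // y hy y1.
have := pd y hy y1; rewrite (inner_aer _ _ _ cr') // (inner_cstr r) // => /eqP.
by rewrite mulf_eq0 conjC_eq0 (negbTE r0) => /eqP.
Qed.

(** Since <S y, f> = <S y, g>, the form is <S y, f> <f - g, v> up to a multiple of
<1, v>, and some <S y, f> is nonzero. *)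
Lemma perp_case3 : shift_invariant -> sing_perp h -> ~ sing_perp f -> case3.
Proof.
move=> H ph /not_sing_perp[y0 [hy0 y01 yf]].
have fg0 y : L2 y -> inner y 1 = 0 -> inner (S y) f = inner (S y) g.
  by move=> hy y1; apply: subr0_eq; rewrite -innerBr // ph.
have hc : is_const h.
  have -> : h = f - cst (inner (S y0) g / inner (S y0) f) * g.
    by rewrite -fg0 // divff ?mul1r //; apply/eqP.
  apply: (@is_const_dep _ _ _ _ (inner (S y0) (f * cj f - g * cj g))) => // v hv.
  by have := H y0 v hy0 hv y01; rewrite shift_defect_perp.
split=> // y hy y1; have := H y 1 hy (Linfty_L2 Linfty1) y1.
rewrite shift_defect_const_diff // ph // inner11 mul0r sub0r mulr1.
by move/eqP; rewrite oppr_eq0 => /eqP.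
Qed.

(** A nonconstant x and 1 are linearly independent. *)
Lemma affine_eq0 x (A B : C) : L2 x -> ~ is_const x ->
  (forall v, L2 v -> A * inner x v - B * inner 1 v = 0) -> A = 0 /\ B = 0.
Proof.
move=> hx /(nonconst hx)[v [hv v1 vx]] H.
have A0 : A = 0.
  have := H v hv; rewrite (innerC hv) // (innerC hv (Linfty_L2 Linfty1)) v1.
  rewrite rmorph0 mulr0 subr0 => /eqP; rewrite mulf_eq0 conjC_eq0.
  by case/orP => /eqP.
split=> //; have := H 1 (Linfty_L2 Linfty1).
by rewrite A0 inner11 mul0r sub0r mulr1 => /eqP; rewrite oppr_eq0 => /eqP.
Qed.

(** A vector y0 with <S y0, 1> <> 0 shows that T h equals a f - b g up to a
constant.  If f = mu g + k, this is a multiple of g up to a constant, and the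
coefficients of g and 1 have to vanish; similarly if g = mu f + k.  If f, g and 1 are independent,
testing against vectors dual to f and to g gives <S y, f> = a <S y, 1> and
<S y, g> = b <S y, 1>.  The two last subcases are b <> 0, with alpha = b and
mu^* = a / b, and b = 0, with alpha = a and mu = 0.  In all four, alpha = 0 is
excluded because T h is not constant. *)
Lemma invariant_case4 : shift_invariant -> ~ sing_perp 1 -> ~ sing_perp h ->
  exists mu alpha, alpha <> 0 /\
    (caseA mu alpha \/ caseB mu alpha \/ caseC mu alpha \/ caseD mu alpha).
Proof.
move=> H /not_sing_perp[y0 [hy0 y01 ys]] nh.
pose k := inner (S y0) 1; have k0 : k != 0 by apply/eqP.
pose a := inner (S y0) f / k; pose b := inner (S y0) g / k.
have hT : is_const (T h - (cst a * f - cst b * g)).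
  apply: is_constPl => // v hv v1.
  have := H y0 v hy0 hv y01; rewrite /shift_defect -!singadjP // -/k.
  rewrite (innerC hv (Linfty_L2 Linfty1)) v1 rmorph0 mulr0 subr0.
  have -> : inner (S y0) f = k * a by rewrite mulrC divfK.
  have -> : inner (S y0) g = k * b by rewrite mulrC divfK.
  rewrite -!mulrA -!mulrBr => /eqP; rewrite mulf_eq0 (negbTE k0) /= => /eqP e.
  rewrite innerBl // innerBl // !innerZl //.
  by rewrite -[LHS]opprK opprB e oppr0.
have nT w : L2 w -> is_const w -> ~ is_const (T h - w).
  move=> hw hwc hTw; apply/nh/sing_perpP => //.
  by rewrite -(subrK w (T h)); exact: is_constD.
have nT0 w alpha : Linfty w -> is_const (T h - cst alpha * w) -> alpha <> 0.
  move=> hw + alpha0; apply: nT => //.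
  by rewrite alpha0 (_ : _ * w = 0) ?mul0r //; exact: is_const_cst.
have nTc w alpha : Linfty w -> is_const (T h - cst alpha * w) -> ~ is_const w.
  by move=> hw hTw wc; apply: nT hTw => //; exact: is_constZ.
have [[mu fmu]|[v1 [hv1 v11 gv1 fv1]]] := affine_dependence (Linfty_L2 hf) (Linfty_L2 hg).
  have hTg : is_const (T h - cst (a * mu - b) * g).
    have -> : T h - cst (a * mu - b) * g =
        T h - (cst a * f - cst b * g) + cst a * (f - cst mu * g).
      rewrite (_ : cst (a * mu - b) = cst a * cst mu - cst b) //.
      by move: (T h) => Th; fring.
    by apply: is_constD => //; exact: is_constZ.
  exists mu, (a * mu - b); split; first exact: nT0 hTg.
  left; apply/caseAP => bA; have hbA : Linfty bA by rewrite /bA.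
  have main y : L2 y -> inner y 1 = 0 ->
      inner (S y) bA = 0 /\ inner (S y) (cj g * bA) = 0.
    move=> hy y1; apply: (affine_eq0 (x := g)) => //; first exact: nTc hTg.
    by move=> v hv; rewrite -(shift_defectA fmu hTg) // H.
  by split=> // y hy y1; have [] := main y hy y1.
have [[mu gmu]|[v2 [hv2 v21 fv2 gv2]]] := affine_dependence (Linfty_L2 hg) (Linfty_L2 hf).
  have hTf : is_const (T h - cst (a - b * mu) * f).
    have -> : T h - cst (a - b * mu) * f =
        T h - (cst a * f - cst b * g) - cst b * (g - cst mu * f).
      rewrite (_ : cst (a - b * mu) = cst a - cst b * cst mu) //.
      by move: (T h) => Th; fring.
    by apply: is_constB => //; exact: is_constZ.
  exists mu, (a - b * mu); split; first exact: nT0 hTf.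
  right; left; apply/caseBP => bB; have hbB : Linfty bB by rewrite /bB.
  have main y : L2 y -> inner y 1 = 0 ->
      inner (S y) bB = 0 /\ inner (S y) (cj f * bB) = 0.
    move=> hy y1; apply: (affine_eq0 (x := f)) => //; first exact: nTc hTf.
    by move=> v hv; rewrite -(shift_defectB gmu hTf) // H.
  by split=> // y hy y1; have [] := main y hy y1.
have hw : Linfty (cst a * f - cst b * g) by [].
have [_ nf] := shift_defect_normal hf hg hw hT.
set w := cst a * f - cst b * g in hT hw nf.
have wv v : L2 v -> inner w v = a * inner f v - b * inner g v.
  by move=> hv; rewrite /w innerBl // !innerZl.
have sf y : L2 y -> inner y 1 = 0 -> inner (S y) f = a * inner (S y) 1.
  move=> hy y1; have := nf y v1 hy hv1 y1; rewrite H // wv // gv1.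
  rewrite (innerC hv1 (Linfty_L2 Linfty1)) v11 rmorph0 !mulr0 !subr0 mulrA -mulrBl.
  move=> /esym/eqP; rewrite mulf_eq0 => /orP[|/eqP//].
  by rewrite subr_eq0 mulrC => /eqP.
have sg y : L2 y -> inner y 1 = 0 -> inner (S y) g = b * inner (S y) 1.
  move=> hy y1; have := nf y v2 hy hv2 y1; rewrite H // wv // fv2.
  rewrite (innerC hv2 (Linfty_L2 Linfty1)) v21 rmorph0 !mulr0 subr0 !sub0r mulrN.
  rewrite opprK mulrA addrC -mulrBl.
  move=> /esym/eqP; rewrite mulf_eq0 => /orP[|/eqP//].
  by rewrite subr_eq0 mulrC => /eqP.
have pN : sing_perp (f * cj f - g * cj g - cj w).
  move=> y hy y1; have := nf y 1 hy (Linfty_L2 Linfty1) y1.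
  rewrite H // wv // sf // sg // inner11 mulr1 => /esym/eqP.
  set A := _ - _ * (_ - _); have -> : A = 0 by rewrite /A; cring.
  by rewrite sub0r oppr_eq0 => /eqP.
have [b0|b0] := eqVneq b 0.
  have a0 : a <> 0.
    move=> a0; apply: nT hT => //; rewrite /w a0 b0.
    rewrite (_ : _ - _ = cst 0) //; first exact: is_const_cst.
    by rewrite (_ : cst 0 = 0) // !mul0r subrr.
  exists 0, a; split => //; do 3 right; apply/caseDP.
  have E0 : cst 0 = 0 by [].
  have -> : cst a * (f - cst 0^* * g) = w.
    by rewrite /w b0 rmorph0 E0 !mul0r !subr0.
  split => //.
  - by rewrite E0 mul0r subr0 => y hy y1; rewrite sg // b0 mul0r.
  - move=> y hy y1; rewrite innerBr // (inner_cstr a^*) // conjCK sf //.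
    by rewrite subrr.
exists (a / b)^*, b; split; first exact/eqP.
right; right; left; apply/caseCP.
have -> : cst b * (cst (a / b)^*^* * f - g) = w.
  have -> : cst (a / b)^*^* = cst (a / b) by rewrite conjCK.
  rewrite mulrBr mulrA (_ : cst b * cst (a / b) = cst a) //.
  by apply/funext => t; rewrite /cst; exact: (etrans (mulrC _ _) (divfK b0 a)).
split => //.
- move=> y hy y1; rewrite innerBr // (innerZr (a / b)^*) // conjCK sf // sg //.
  by rewrite mulrA divfK // subrr.
- by move=> y hy y1; rewrite innerBr // (inner_cstr b^*) // conjCK sg // subrr.
Qed.

Definition alternatives :=
  [/\ is_const (fun t => `|f t|), is_const (fun t => `|g t|), Hinfty f & Hinfty (cj g)] \/
  [/\ (fun t => `|f t|) =ae (fun t => `|g t|), is_const (fun t => `|f t|) & Hinfty (f * cj g)] \/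
  [/\ is_const (f - g), is_const (f * sq g - g * sq f),
     Pminus (sq f) =ae Pminus (sq g) & Pminus (sq g) =ae Pminus (f * cj g)] \/
  [/\ ~ (Vop (Pminus f) =ae 0 /\ Pminus (cj g) =ae 0),
      ~ (Vop (Pminus (sq f - f * cj g)) =ae 0 /\ Pminus (f * cj g - sq g) =ae 0) &
      (exists mu alpha, alpha <> 0 /\ caseA mu alpha) \/
      (exists mu alpha, alpha <> 0 /\ caseB mu alpha) \/
      (exists mu alpha, alpha <> 0 /\ caseC mu alpha) \/
      (exists mu alpha, alpha <> 0 /\ caseD mu alpha)].

Lemma invariantP : shift_invariant <-> case1 \/ case2 \/ case3 \/
  [/\ ~ sing_perp 1, ~ sing_perp h & exists mu alpha, alpha <> 0 /\
    (caseA mu alpha \/ caseB mu alpha \/ caseC mu alpha \/ caseD mu alpha)].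
Proof.
split=> [H|].
  have [p1|n1] := pselect (sing_perp 1); first by left; exact: invariant_case1.
  have [ph|nh] := pselect (sing_perp h); last first.
    by do 3 right; split=> //; exact: invariant_case4.
  have [pf|nf] := pselect (sing_perp f).
    by have [?|?] := perp_case12 H ph pf; [left|right; left].
  by right; right; left; exact: perp_case3.
move=> [/case1_invariant//|[/case2_invariant//|[/case3_invariant//|[_ _]]]].
move=> [mu [alpha [_ [|[|[|]]]]]].
- exact: caseA_invariant.
- exact: caseB_invariant.
- exact: caseC_invariant.
- exact: caseD_invariant.
Qed.

Theorem quasinormal_alternatives : quasinormal (singint f g) <-> alternatives.
Proof.
rewrite quasinormalP // qdefect0P // [X in X <-> _]invariantP.
have e1 : [/\ is_const (fun t => `|f t|), is_const (fun t => `|g t|), Hinfty f &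
    Hinfty (cj g)] <-> case1.
  by rewrite !(propext (normf_const _)) !(propext (HinftyE _)).
have e2 : [/\ (fun t => `|f t|) =ae (fun t => `|g t|), is_const (fun t => `|f t|) &
    Hinfty (f * cj g)] <-> case2.
  by rewrite (propext (normf_ae _ _)) (propext (normf_const _)) (propext (HinftyE _)).
have e3 : [/\ is_const (f - g), is_const (f * sq g - g * sq f),
     Pminus (sq f) =ae Pminus (sq g) & Pminus (sq g) =ae Pminus (f * cj g)] <-> case3.
  rewrite !sqE !(propext (Pminus_ae _ _)) //; split=> [[hc h1 h2 h3]|[hc h1 h2]].
    by have [] := (case3P hc).1 (conj h1 (conj h2 h3)).
  by have [? [? ?]] := (case3P hc).2 (conj h1 h2).
have e4 : Vop (Pminus f) =ae 0 /\ Pminus (cj g) =ae 0 <-> sing_perp 1.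
  by rewrite Vop_eq0 !Pminus_eq0 // sing_perp_H2 // cj1 !mulr1.
have e5 : Vop (Pminus (sq f - f * cj g)) =ae 0 /\ Pminus (f * cj g - sq g) =ae 0 <->
    sing_perp h.
  rewrite Vop_eq0 !sqE !Pminus_eq0 // sing_perp_H2 //.
  rewrite (_ : f * cj h = f * cj f - f * cj g); last by rewrite !cjE; fring.
  by rewrite (_ : cj g * h = f * cj g - g * cj g); last by fring.
rewrite /alternatives e1 e2 e3 (propext e4) (propext e5).
split=> -[?|[?|[?|[n1 nh h4]]]]; [by left|by right; left|by right; right; left| |
  by left|by right; left|by right; right; left|]; do 3 right; split=> //.
  move: h4 => [mu [alpha [a0 [|[|[|]]]]]] hcase; [left|right; left|
    right; right; left|do 3 right]; by exists mu, alpha.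
by move: h4 => [|[|[|]]] [mu [alpha [a0 hcase]]]; exists mu, alpha; split=> //;
  [left|right; left|right; right; left|do 3 right].
Qed.

End Operator.
End Cases.

Theorem theorem5p13 (R : realType) (f g : R -> R[i])
    (hf : Linfty f) (hg : Linfty g) :
  quasinormal (singint f g) <->
  ((* (1) *)
   [/\ is_const (fun t => `|f t|), is_const (fun t => `|g t|),
       Hinfty f & Hinfty (fun t => (g t)^*)]
   \/
   (* (2) *)
   [/\ (fun t => `|f t|) = (fun t => `|g t|) %[ae circle R],
       is_const (fun t => `|f t|) &
       Hinfty (fun t => f t * (g t)^*)]
   \/
   (* (3) *)
   [/\ is_const (fun t => f t - g t),
       is_const (fun t => f t * `|g t| ^+ 2 - g t * `|f t| ^+ 2),
       Pminus (fun t => `|f t| ^+ 2) = Pminus (fun t => `|g t| ^+ 2)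
         %[ae circle R] &
       Pminus (fun t => `|g t| ^+ 2) = Pminus (fun t => f t * (g t)^*)
         %[ae circle R]]
   \/
   (* (4) *)
   [/\ ~ (Vop (Pminus f) = (fun=> 0) %[ae circle R] /\
          Pminus (fun t => (g t)^*) = (fun=> 0) %[ae circle R]),
       ~ (Vop (Pminus (fun t => `|f t| ^+ 2 - f t * (g t)^*)) = (fun=> 0)
            %[ae circle R] /\
          Pminus (fun t => f t * (g t)^* - `|g t| ^+ 2) = (fun=> 0)
            %[ae circle R]) &
       (* (a) *)
       (exists mu alpha : R[i],
         alpha <> 0 /\
         is_const (fun t => f t - mu * g t) /\
         Hinfty (fun t => `|f t| ^+ 2 - f t * (g t)^* - alpha^* * (g t)^*) /\
         Hinfty (fun t => `|g t| ^+ 2 - f t * (g t)^* + alpha * g t) /\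
         Hinfty (fun t => f t * (mu * (f t)^* - (g t)^* - alpha)) /\
         Hinfty (fun t => (g t)^* * (mu^* * f t - g t - alpha^*)) /\
         Hinfty (fun t => f t * g t * (mu * (f t)^* - (g t)^* - alpha)) /\
         Hinfty (fun t => (g t)^* ^+ 2 * (mu^* * f t - g t - alpha^*)))
       \/
       (* (b) *)
       (exists mu alpha : R[i],
         alpha <> 0 /\
         is_const (fun t => g t - mu * f t) /\
         Hinfty (fun t => `|f t| ^+ 2 - f t * (g t)^* - alpha^* * (f t)^*) /\
         Hinfty (fun t => `|g t| ^+ 2 - f t * (g t)^* + alpha * f t) /\
         Hinfty (fun t => f t * ((f t)^* - mu * (g t)^* - alpha)) /\
         Hinfty (fun t => (g t)^* * (f t - mu^* * g t - alpha^*)) /\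
         Hinfty (fun t => (f t)^* * (g t)^* * (f t - mu^* * g t - alpha^*)) /\
         Hinfty (fun t => f t ^+ 2 * ((f t)^* - mu * (g t)^* - alpha)))
       \/
       (* (c) *)
       (exists mu alpha : R[i],
         alpha <> 0 /\
         Hinfty (fun t => f t * ((f t)^* - mu^* * (g t)^*)) /\
         Hinfty (fun t => (g t)^* * (f t - mu * g t)) /\
         Hinfty (fun t => `|f t| ^+ 2 - f t * (g t)^*
                          - alpha^* * (mu * (f t)^* - (g t)^*)) /\
         Hinfty (fun t => f t * (g t)^* - `|g t| ^+ 2
                          - alpha * (mu^* * f t - g t)) /\
         Hinfty (fun t => f t * (g t)^* - alpha * f t) /\
         Hinfty (fun t => `|g t| ^+ 2 - alpha^* * (g t)^*) /\
         Hinfty (fun t => (g t)^* * (`|f t| ^+ 2 - `|g t| ^+ 2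
                          - alpha^* * mu * (f t)^* + alpha^* * (g t)^*)) /\
         Hinfty (fun t => f t * (`|f t| ^+ 2 - `|g t| ^+ 2
                          - alpha * mu^* * f t + alpha * g t)))
       \/
       (* (d) *)
       (exists mu alpha : R[i],
         alpha <> 0 /\
         Hinfty (fun t => f t * ((g t)^* - mu^* * (f t)^*)) /\
         Hinfty (fun t => (g t)^* * (g t - mu * f t)) /\
         Hinfty (fun t => `|f t| ^+ 2 - f t * (g t)^*
                          - alpha^* * ((f t)^* - mu * (g t)^*)) /\
         Hinfty (fun t => f t * (g t)^* - `|g t| ^+ 2
                          - alpha * (f t - mu^* * g t)) /\
         Hinfty (fun t => f t * (g t)^* - alpha^* * (g t)^*) /\
         Hinfty (fun t => `|f t| ^+ 2 - alpha * f t) /\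
         Hinfty (fun t => (g t)^* * (`|f t| ^+ 2 - `|g t| ^+ 2
                          + alpha^* * mu * (g t)^* - alpha^* * (f t)^*)) /\
         Hinfty (fun t => f t * (`|f t| ^+ 2 - `|g t| ^+ 2
                          + alpha * mu^* * g t - alpha * f t)))]).
Proof. exact: (quasinormal_alternatives hf hg). Qed.
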